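(* Let $(M,\omega)$ be a symplectic manifold of dimension $2m$ and let $\Lambda=(E,\lambda)$ and $\tilde\Lambda=(\tilde E,\tilde\lambda)$ be two transversal Lagrangian fields on $M$. Let $f:V\to M^2$ be the mapping defined in the context, where $V$ is a neighborhood of the zero section of $T^*M$. Then $f$ determines a local symplectic groupoid $V\rightrightarrows M$ (with symplectic form $-d\theta|_V$ and with the groupoid operations transported by $f$ from the pair groupoid, as described in the context) with source $s=\pi_2\circ f$ and target $t=\pi_1\circ f$, where $\pi_1,\pi_2:M^2\to M$ are the projections onto the first and second factors, and $$s(T_x^*M\cap V)\subset\Lambda_x\quad\text{and}\quad t(T_x^*M\cap V)\subset\tilde\Lambda_x$$ for all $x\in M$.
   Context: Lagrangian fields. A Lagrangian field $\Lambda=(E,\lambda)$ on $M$ is a (real, smooth) vector bundle $\pi:E\to M$ of rank $m$ equipped with a surjective submersion $\lambda:E\to M$ whose restriction to each fiber $E_x$, $x\in M$, is an embedding onto a Lagrangian submanifold $\Lambda_x:=\lambda(E_x)$ of $M$ and such that $\lambda=\pi$ on the zero section $Z_E$ of $E$ (so $x\in\Lambda_x$). For $\tilde\Lambda=(\tilde E,\tilde\lambda)$ the bundle projection is $\tilde\pi:\tilde E\to M$ and $\tilde\Lambda_x:=\tilde\lambda(\tilde E_x)$. The fields $\Lambda$ and $\tilde\Lambda$ are transversal if $\Lambda_x$ intersects $\tilde\Lambda_x$ transversally at $x$ for all $x\in M$. The forms $\phi,\tilde\phi$ and the mapping $\chi$. A form on the total space of a bundle is horizontal if it is annihilated by insertion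 of vertical vectors. There is a unique horizontal 1-form $\phi$ on $E$ vanishing on $Z_E$ with $\lambda^*\omega-\pi^*\omega=d\phi$, and a unique horizontal 1-form $\tilde\phi$ on $\tilde E$ vanishing on $Z_{\tilde E}$ with $\tilde\lambda^*\omega-\tilde\pi^*\omega=d\tilde\phi$. Let $\hat E:=E\oplus\tilde E=\{(z,\tilde z)\in E\times\tilde E\mid \pi(z)=\tilde\pi(\tilde z)\}$ with bundle projection $\hat\pi:\hat E\to M$, and let $\tau:\hat E\to E$, $\tilde\tau:\hat E\to\tilde E$ be $\tau(z,\tilde z)=z$, $\tilde\tau(z,\tilde z)=\tilde z$. The 1-form $\tilde\tau^*\tilde\phi-\tau^*\phi$ is horizontal on $\hat E$ and vanishes on the zero section $Z_{\hat E}$. The mapping $\chi:\hat E\to T^*M$ sends $(z,\tilde z)\in\hat E_x$ to the unique $\chi(z,\tilde z)\in T^*_xM$ with $(d\hat\pi_{(z,\tilde z)})^*\chi(z,\tilde z)=(\tilde\tau^*\tilde\phi-\tau^*\phi)(z,\tilde z)$. The mapping $f$. There are open neighborhoods $W_1,W_2$ of $Z_{\hat E}$ in $\hat E$ such that $\chi|_{W_1}$ is a diffeomorphism onto a neighborhood of the zero section of $T^*M$ and $(z,\tilde z)\mapsto(\tilde\lambda(\tilde z),\lambda(z))$ is a diffeomorphism of $W_2$ onto a neighborhood of the diagonal in $M^2$. Fix such $W_1,W_2$ and put $W:=W_1\cap W_2$, $V:=\chi(W)\subset T^*M$. Then $f:V\to M^2$ is the unique mapping, a diffeomorphism onto its image,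 with $f(\chi(z,\tilde z))=(\tilde\lambda(\tilde z),\lambda(z))$ for $(z,\tilde z)\in W$. Symplectic conventions. $\theta$ is the canonical 1-form on $T^*M$, $\theta=\xi_i\,dx^i$ in local coordinates $x^i$ on $M$ and dual fiber coordinates $\xi_i$; $T^*M$ carries the symplectic form $-d\theta$. $M$ is identified with the zero section of $T^*M$, $x\mapsto z_x$ (the zero covector at $x$). Groupoid conventions. A groupoid $\Sigma\rightrightarrows M$ has unit mapping $\epsilon$, inverse mapping $i$, source $s$ and target $t$; the product $\alpha\beta$ is defined when $s(\alpha)=t(\beta)$, with $t(\alpha\beta)=t(\alpha)$, $s(\alpha\beta)=s(\beta)$. The pair groupoid of $M$ has morphisms $M^2$, $s(x,y)=y$, $t(x,y)=x$, $\epsilon(x)=(x,x)$, $i(x,y)=(y,x)$, $(x,y)(y,z)=(x,z)$. In a local Lie groupoid the structure mappings have the same properties as in a Lie groupoid (smooth, $\epsilon$ an embedding, $s$ and $t$ surjective submersions), except that elements must also be close to each other (close to the units) for the operations to be defined. On $V$ the operations transported by $f$ are: unit $x\mapsto z_x$; inverse $\alpha\mapsto f^{-1}(s(\alpha),t(\alpha))$ when $(s(\alpha),t(\alpha))\in f(V)$; product $\alpha\beta=f^{-1}(t(\alpha),s(\beta))$ when $s(\alpha)=t(\beta)$ and $(t(\alpha),s(\beta))\in f(V)$. A (local) symplectic groupoid is a (local) Lie groupoid $\Sigma\rightrightarrows M$ where $\Sigma$ is a symplectic manifold, the unit space $\epsilon(M)$ is Lagrangian, the inverse mapping is an anti-symplectomorphism,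 and the set of 3-cycles (triples $(\alpha_1,\alpha_2,\alpha_3)$ whose product $\alpha_1\alpha_2\alpha_3$ is defined and equal to a unit; for the local structure on $V$ this means $s(\alpha_1)=t(\alpha_2)$, $s(\alpha_2)=t(\alpha_3)$, $s(\alpha_3)=t(\alpha_1)$) is a Lagrangian submanifold of $\Sigma^3$. *)

(* Defs.v *)
From HB Require Import structures.
From mathcomp Require Import all_boot all_order all_algebra.
From mathcomp Require Import all_classical all_reals all_analysis.

Set Implicit Arguments.
Unset Strict Implicit.
Unset Printing Implicit Defensive.

Import Order.TTheory GRing.Theory Num.Theory.
Import numFieldNormedType.Exports.
Local Open Scope classical_set_scope.
Local Open Scope ring_scope.

(* Conventions.  A manifold is a set with an atlas; its topology is the one
   generated by the atlas.  A [chartedSpace] carries the data only, and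
   [smooth_manifold] states the axioms.  Every point x has a preferred chart
   [chart_at x], and the tangent space at x is R^n, a tangent vector being
   represented by its coordinates in [chart_at x]. *)

(* Meaningful for open N only. *)
Fixpoint Ck (R : realType) (V W : normedModType R) (k : nat) (N : set V)
    (f : V -> W) : Prop :=
  match k with
  | 0 => forall x, N x -> {for x, continuous f}
  | j.+1 => (forall x, N x -> differentiable f x) /\
            (forall v, Ck j N (fun x => 'd f x v))
  end.

Definition Cinfty (R : realType) (V W : normedModType R) (N : set V)
  (f : V -> W) : Prop := forall k, Ck k N f.

Record chart (R : realType) (n : nat) (T : Type) := Chart {
  dom : set T;
  fwd : T -> 'rV[R]_n;
  bwd : 'rV[R]_n -> T }.

Record chartedSpace (R : realType) (n : nat) := ChartedSpace {
  carrier :> Type;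
  charts : set (chart R n carrier);
  chart_at : carrier -> chart R n carrier }.

Arguments charts {R n} X : rename.
Arguments chart_at {R n X} x : rename.

Section Manifolds.
Context {R : realType}.

Definition mopen {n} (X : chartedSpace R n) (U : set X) : Prop :=
  forall c, charts X c -> open (fwd c @` (dom c `&` U)).

Definition smooth_manifold {n} (X : chartedSpace R n) : Prop :=
  [/\ forall x : X, charts X (chart_at x) /\ dom (chart_at x) x,
      forall c, charts X c -> forall x, dom c x -> bwd c (fwd c x) = x,
      forall c d, charts X c -> charts X d ->
        let N := fwd c @` (dom c `&` dom d) in
        open N /\ Cinfty N (fun y => fwd d (bwd c y)),
      forall x y : X, x <> y -> exists U V : set X,
        [/\ mopen U, mopen V, U x, V y & U `&` V = set0] &
      exists B : nat -> set X, (forall i, mopen (B i)) /\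
        (forall U x, mopen U -> U x -> exists i, B i x /\ B i `<=` U)].

Definition euclid_chart n : chart R n 'rV[R]_n := Chart setT id id.

Definition euclid n : chartedSpace R n :=
  @ChartedSpace R n 'rV[R]_n [set euclid_chart n] (fun=> euclid_chart n).

Definition prod_chart {n p} {S T : Type} (c : chart R n S) (d : chart R p T) :
    chart R (n + p) (S * T) :=
  Chart [set z | dom c z.1 /\ dom d z.2]
        (fun z => row_mx (fwd c z.1) (fwd d z.2))
        (fun y => (bwd c (lsubmx y), bwd d (rsubmx y))).

Definition prod_mfd {n p} (X : chartedSpace R n) (Y : chartedSpace R p) :
    chartedSpace R (n + p) :=
  @ChartedSpace R (n + p) (X * Y)
    [set prod_chart c d | c in charts X & d in charts Y]
    (fun z => prod_chart (chart_at z.1) (chart_at z.2)).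

(* Charts at x and f x in which f is smooth near x; this makes U a
   neighborhood of each of its points. *)
Definition smooth_on {n p} (X : chartedSpace R n) (Y : chartedSpace R p)
    (U : set X) (f : X -> Y) : Prop :=
  forall x, U x -> exists c d,
    [/\ charts X c, charts Y d, dom c x, dom d (f x) &
        exists N : set 'rV[R]_n,
          [/\ open N, N (fwd c x),
              N `<=` fwd c @` (dom c `&` U `&` f @^-1` dom d) &
              Cinfty N (fun y => fwd d (f (bwd c y)))]].

(* For an arbitrary subset A: local extendability to a smooth map. *)
Definition smooth_on_subset {n p} (X : chartedSpace R n)
    (Y : chartedSpace R p) (A : set X) (f : X -> Y) : Prop :=
  forall x, A x -> exists (U : set X) (g : X -> Y),
    [/\ mopen U, U x, smooth_on U g & forall y, A y -> U y -> g y = f y].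

Definition tmap {n p} (X : chartedSpace R n) (Y : chartedSpace R p)
    (f : X -> Y) (x : X) : 'rV[R]_n -> 'rV[R]_p :=
  'd (fun y : 'rV[R]_n => fwd (chart_at (f x)) (f (bwd (chart_at x) y)))
     (fwd (chart_at x) x).

(* [tmap] of a chart and of its inverse. *)
Definition tfwd_chart {n} (X : chartedSpace R n) (c : chart R n X) (x : X) :
  'rV[R]_n -> 'rV[R]_n := tmap (Y := euclid n) (fwd c) x.
Definition tbwd_chart {n} (X : chartedSpace R n) (c : chart R n X)
  (y : 'rV[R]_n) : 'rV[R]_n -> 'rV[R]_n := tmap (X := euclid n) (bwd c) y.

Definition diffeo_onto {n p} (X : chartedSpace R n) (Y : chartedSpace R p)
    (U : set X) (O : set Y) (f : X -> Y) : Prop :=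
  [/\ mopen U, mopen O, f @` U = O, smooth_on U f &
      exists g : Y -> X, smooth_on O g /\ forall x, U x -> g (f x) = x].

Definition submersion_on {n p} (X : chartedSpace R n) (Y : chartedSpace R p)
    (U : set X) (f : X -> Y) : Prop :=
  smooth_on U f /\ forall x, U x -> forall w, exists v, tmap f x v = w.

Definition surjective_submersion_on {n p} (X : chartedSpace R n)
    (Y : chartedSpace R p) (U : set X) (f : X -> Y) : Prop :=
  submersion_on U f /\ f @` U = setT.

Definition embedding {n p} (X : chartedSpace R n) (Y : chartedSpace R p)
    (f : X -> Y) : Prop :=
  [/\ smooth_on setT f, injective f, forall x, injective (tmap f x) &
      forall U : set X, mopen U ->
        exists O : set Y, mopen O /\ f @` U = O `&` range f].

Definition smooth_chart {n} (X : chartedSpace R n) (c : chart R n X) : Prop :=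
  diffeo_onto (Y := euclid n) (dom c) (fwd c @` dom c) (fwd c) /\
  forall x, dom c x -> bwd c (fwd c x) = x.

Definition submanifold {n} (X : chartedSpace R n) (k : nat) (S : set X) :
    Prop :=
  (k <= n)%N /\
  forall x, S x -> exists c : chart R n X,
    [/\ smooth_chart c, dom c x &
        forall y, dom c y ->
          (S y <-> forall i : 'I_n, (k <= i)%N -> fwd c y 0 i = 0)].

(* Velocities at x of smooth curves in S; the curve parameter is in R^1. *)
Definition tangent_space {n} (X : chartedSpace R n) (S : set X) (x : X) :
    set 'rV[R]_n :=
  [set v | exists (N : set 'rV[R]_1) (g : euclid 1 -> X),
     [/\ open N, N 0, smooth_on (X := euclid 1) N g, g @` N `<=` S &
         g 0 = x /\ tmap g 0 (const_mx 1) = v]].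

Definition transversal_at {n} (X : chartedSpace R n) (S T : set X) (x : X) :
    Prop :=
  [/\ S x, T x &
      forall w, exists u v,
        [/\ tangent_space S x u, tangent_space T x v & w = u + v]].

Definition form1 {n} (X : chartedSpace R n) := X -> 'rV[R]_n -> R.
Definition form2 {n} (X : chartedSpace R n) :=
  X -> 'rV[R]_n -> 'rV[R]_n -> R.

Definition linear_form {n} (a : 'rV[R]_n -> R) : Prop :=
  forall (k : R) u v, a (k *: u + v) = k * a u + a v.

Definition coef1 {n} (X : chartedSpace R n) (c : chart R n X) (a : form1 X)
    (v y : 'rV[R]_n) : R^o :=
  a (bwd c y) (tbwd_chart c y v).

Definition coef2 {n} (X : chartedSpace R n) (c : chart R n X) (w : form2 X)
    (u v y : 'rV[R]_n) : R^o :=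
  w (bwd c y) (tbwd_chart c y u) (tbwd_chart c y v).

Definition smooth_form1 {n} (X : chartedSpace R n) (a : form1 X) : Prop :=
  (forall x, linear_form (a x)) /\
  (forall c, charts X c -> forall v, Cinfty (fwd c @` dom c) (coef1 c a v)).

Definition smooth_form2_on {n} (X : chartedSpace R n) (U : set X)
    (w : form2 X) : Prop :=
  (forall x, U x -> [/\ forall u, linear_form (w x u),
                        forall v, linear_form (fun u => w x u v) &
                        forall u, w x u u = 0]) /\
  (forall c, charts X c -> forall u v,
     Cinfty (fwd c @` (dom c `&` U)) (coef2 c w u v)).

(* The exterior derivatives at x, computed in the chart [chart_at x], in which
   u, v, t are coordinate vectors. *)
Definition ext_d1 {n} (X : chartedSpace R n) (a : form1 X) : form2 X :=
  fun x u v => let c := chart_at x in let y := fwd c x in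
    'D_u (coef1 c a v) y - 'D_v (coef1 c a u) y.

Definition closed_form2_on {n} (X : chartedSpace R n) (U : set X)
    (w : form2 X) : Prop :=
  forall x, U x -> forall u v t,
    let c := chart_at x in let y := fwd c x in
    'D_u (coef2 c w v t) y - 'D_v (coef2 c w u t) y
      + 'D_t (coef2 c w u v) y = 0.

Definition pull1 {n p} (X : chartedSpace R n) (Y : chartedSpace R p)
    (f : X -> Y) (a : form1 Y) : form1 X :=
  fun x v => a (f x) (tmap f x v).

Definition pull2 {n p} (X : chartedSpace R n) (Y : chartedSpace R p)
    (f : X -> Y) (w : form2 Y) : form2 X :=
  fun x u v => w (f x) (tmap f x u) (tmap f x v).

(* The open subset U of X, with the form w, is a symplectic manifold. *)
Definition symplectic_on {n} (X : chartedSpace R n) (U : set X)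
    (w : form2 X) : Prop :=
  [/\ smooth_manifold X, mopen U, smooth_form2_on U w, closed_form2_on U w &
      forall x, U x -> forall u, (forall v, w x u v = 0) -> u = 0].

Definition lagrangian_submanifold {n} (X : chartedSpace R n) (w : form2 X)
    (S : set X) : Prop :=
  (exists k, (k + k = n)%N /\ submanifold k S) /\
  (forall x, S x -> forall u v,
     tangent_space S x u -> tangent_space S x v -> w x u v = 0).

Record localTriv (m : nat) (B : Type) (F : B -> lmodType R) := LocalTriv {
  base : set B;
  tfwd : forall x, F x -> 'rV[R]_m;
  tbwd : forall x, 'rV[R]_m -> F x }.

Record bundle {n} (m : nat) (M : chartedSpace R n) := Bundle {
  fib : M -> lmodType R;
  trivs : set (localTriv m fib);
  triv_at : M -> localTriv m fib }.

Arguments trivs {n m M} E : rename.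
Arguments triv_at {n m M} E x : rename.

Definition vector_bundle {n m} (M : chartedSpace R n) (E : bundle m M) :
    Prop :=
  [/\ forall x : M, trivs E (triv_at E x) /\ base (triv_at E x) x,
      forall t, trivs E t -> mopen (base t),
      forall t, trivs E t -> forall x, base t x ->
        [/\ linear (@tfwd _ _ _ t x), cancel (@tfwd _ _ _ t x) (@tbwd _ _ _ t x) &
            cancel (@tbwd _ _ _ t x) (@tfwd _ _ _ t x)] &
      forall t t', trivs E t -> trivs E t' -> forall v,
        smooth_on (Y := euclid m) (base t `&` base t')
                  (fun x => tfwd t' (tbwd t x v))].

Definition bundle_chart {n m} (M : chartedSpace R n) (E : bundle m M)
    (c : chart R n M) (t : localTriv m (fib E)) :
    chart R (n + m) {x : M & fib E x} :=
  Chart [set z | dom c (projT1 z) /\ base t (projT1 z)]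
        (fun z => row_mx (fwd c (projT1 z)) (tfwd t (projT2 z)))
        (fun y => existT (fun x => fib E x) (bwd c (lsubmx y))
                         (tbwd t _ (rsubmx y))).

Definition total_space {n m} (M : chartedSpace R n) (E : bundle m M) :
    chartedSpace R (n + m) :=
  @ChartedSpace R (n + m) {x : M & fib E x}
    [set bundle_chart c t | c in charts M & t in trivs E]
    (fun z => bundle_chart (chart_at (projT1 z)) (triv_at E (projT1 z))).

Definition bproj {n m} (M : chartedSpace R n) (E : bundle m M) :
  total_space E -> M := fun z => projT1 z.

Definition bpt {n m} (M : chartedSpace R n) (E : bundle m M) (x : M)
  (e : fib E x) : total_space E := existT (fun x => fib E x) x e.

Definition zero_section {n m} (M : chartedSpace R n) (E : bundle m M) :
  M -> total_space E := fun x => bpt (0 : fib E x).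

Definition fiber {n m} (M : chartedSpace R n) (E : bundle m M) (x : M) :
    chartedSpace R m :=
  @ChartedSpace R m (fib E x)
    [set Chart setT (@tfwd _ _ _ t x) (tbwd t x)
       | t in [set t | trivs E t /\ base t x]]
    (fun=> Chart setT (@tfwd _ _ _ (triv_at E x) x) (tbwd (triv_at E x) x)).

Definition sum_triv {m p} (B : Type) (F G : B -> lmodType R)
    (s : localTriv m F) (t : localTriv p G) :
    @localTriv (m + p) B (fun x => (F x * G x)%type : lmodType R) :=
  @LocalTriv (m + p) B (fun x => (F x * G x)%type : lmodType R)
    (base s `&` base t)
    (fun x e => row_mx (tfwd s e.1) (tfwd t e.2))
    (fun x y => (tbwd s x (lsubmx y), tbwd t x (rsubmx y))).

Definition whitney_sum {n m p} (M : chartedSpace R n) (E : bundle m M)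
    (F : bundle p M) : bundle (m + p) M :=
  @Bundle n (m + p) M (fun x => (fib E x * fib F x)%type : lmodType R)
    [set sum_triv s t | s in trivs E & t in trivs F]
    (fun x => sum_triv (triv_at E x) (triv_at F x)).

Definition wproj1 {n m p} (M : chartedSpace R n) (E : bundle m M)
    (F : bundle p M) (z : total_space (whitney_sum E F)) : total_space E :=
  bpt (projT2 z).1.
Definition wproj2 {n m p} (M : chartedSpace R n) (E : bundle m M)
    (F : bundle p M) (z : total_space (whitney_sum E F)) : total_space F :=
  bpt (projT2 z).2.

(* T*M: the fibre at x is the dual of the tangent space at x, and a chart c of
   M gives the dual fibre coordinates xi_i = xi (d/dc^i). *)
Definition cotangent_triv {n} (M : chartedSpace R n) (c : chart R n M) :
    localTriv n (fun _ : M => 'Hom('rV[R]_n, R^o) : lmodType R) :=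
  @LocalTriv n M (fun _ => 'Hom('rV[R]_n, R^o) : lmodType R)
    (dom c)
    (fun x xi => \row_i xi (tbwd_chart c (fwd c x) (delta_mx 0 i)))
    (fun x y => linfun (fun v => \sum_i y 0 i * tfwd_chart c x v 0 i : R^o)).

Definition cotangent {n} (M : chartedSpace R n) : bundle n M :=
  @Bundle n n M (fun _ => 'Hom('rV[R]_n, R^o) : lmodType R)
    [set cotangent_triv c | c in charts M]
    (fun x => cotangent_triv (chart_at x)).

Definition pairing {n} (M : chartedSpace R n) (z : total_space (cotangent M))
    (v : 'rV[R]_n) : R := (projT2 z : 'Hom('rV[R]_n, R^o)) v.

(* The canonical 1-form theta = xi_i dx^i. *)
Definition canonical_form {n} (M : chartedSpace R n) :
    form1 (total_space (cotangent M)) :=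
  fun z v => pairing z (tmap (@bproj _ _ M (cotangent M)) z v).

Definition minus_dtheta {n} (M : chartedSpace R n) :
    form2 (total_space (cotangent M)) :=
  fun z u v => - ext_d1 (@canonical_form n M) z u v.

Definition leaf {n m} (M : chartedSpace R n) (E : bundle m M)
    (lam : total_space E -> M) (x : M) : set M :=
  range (fun e : fib E x => lam (bpt e)).

Definition lagrangian_field {n m} (M : chartedSpace R n) (w : form2 M)
    (E : bundle m M) (lam : total_space E -> M) : Prop :=
  [/\ vector_bundle E, surjective_submersion_on setT lam,
      forall x, embedding (X := fiber E x) (fun e : fib E x => lam (bpt e)),
      forall x, lagrangian_submanifold w (leaf lam x) &
      forall x, lam (zero_section E x) = x].

Definition transversal_fields {n m p} (M : chartedSpace R n)
    (E : bundle m M) (lam : total_space E -> M)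
    (E' : bundle p M) (lam' : total_space E' -> M) : Prop :=
  forall x, transversal_at (leaf lam x) (leaf lam' x) x.

(* phi is the (unique) horizontal 1-form vanishing on the zero section such
   that lam^* w - pi^* w = d phi. *)
Definition is_phi {n m} (M : chartedSpace R n) (w : form2 M)
    (E : bundle m M) (lam : total_space E -> M) (phi : form1 (total_space E)) : Prop :=
  [/\ smooth_form1 phi,
      forall z v, tmap (@bproj _ _ M E) z v = 0 -> phi z v = 0,
      forall x v, phi (zero_section E x) v = 0 &
      forall z u v, pull2 lam w z u v - pull2 (@bproj _ _ M E) w z u v
                    = ext_d1 phi z u v].

Definition is_chi {n m p} (M : chartedSpace R n)
    (E : bundle m M) (E' : bundle p M)
    (phi : form1 (total_space E)) (phi' : form1 (total_space E'))
    (chi : total_space (whitney_sum E E') -> total_space (cotangent M)) : Prop :=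
  forall z, bproj (chi z) = bproj z /\
    forall v, pairing (chi z) (tmap (@bproj _ _ M (whitney_sum E E')) z v)
      = pull1 (@wproj2 _ _ _ M E E') phi' z v
        - pull1 (@wproj1 _ _ _ M E E') phi z v.

(* Partial operations are total functions together with a domain.  [lcycles]
   is the set of 3-cycles.  It is part of the data because, in a local
   groupoid, "the triple product is a unit" has a meaning also for triples whose
   partial products are undefined. *)
Record localGroupoid (M S : Type) := LocalGroupoid {
  arrows : set S;
  lsrc : S -> M;
  ltgt : S -> M;
  lunit : M -> S;
  linvdom : set S;
  linv : S -> S;
  lmuldom : set (S * S);
  lmul : S * S -> S;
  lcycles : set (S * S * S) }.

Definition composable {M S : Type} (G : localGroupoid M S) : set (S * S) :=
  [set z | [/\ arrows G z.1, arrows G z.2 & lsrc G z.1 = ltgt G z.2]].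

Definition local_groupoid_laws {M S : Type} (G : localGroupoid M S) : Prop :=
  [/\ forall x, [/\ arrows G (lunit G x), lsrc G (lunit G x) = x &
                    ltgt G (lunit G x) = x],
      forall a, arrows G a ->
        [/\ lmuldom G (lunit G (ltgt G a), a),
            lmul G (lunit G (ltgt G a), a) = a,
            lmuldom G (a, lunit G (lsrc G a)) &
            lmul G (a, lunit G (lsrc G a)) = a],
      (forall x, linvdom G (lunit G x) /\ linv G (lunit G x) = lunit G x) /\
      (forall a, linvdom G a ->
        ([/\ arrows G a, linvdom G (linv G a), linv G (linv G a) = a,
             lsrc G (linv G a) = ltgt G a & ltgt G (linv G a) = lsrc G a]) /\
        [/\ lmuldom G (a, linv G a),
            lmul G (a, linv G a) = lunit G (ltgt G a),
            lmuldom G (linv G a, a) &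
            lmul G (linv G a, a) = lunit G (lsrc G a)]),
      forall a b, lmuldom G (a, b) ->
        [/\ composable G (a, b), arrows G (lmul G (a, b)),
            ltgt G (lmul G (a, b)) = ltgt G a &
            lsrc G (lmul G (a, b)) = lsrc G b] &
      forall a b c, lmuldom G (a, b) -> lmuldom G (b, c) ->
        (lmuldom G (lmul G (a, b), c) <-> lmuldom G (a, lmul G (b, c))) /\
        (lmuldom G (lmul G (a, b), c) ->
           lmul G (lmul G (a, b), c) = lmul G (a, lmul G (b, c)))].

Definition local_lie_groupoid {n p} (M : chartedSpace R n)
    (S : chartedSpace R p) (G : localGroupoid M S) : Prop :=
  [/\ [/\ smooth_manifold M, smooth_manifold S & mopen (arrows G)],
      local_groupoid_laws G,
      [/\ surjective_submersion_on (arrows G) (lsrc G),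
          surjective_submersion_on (arrows G) (ltgt G) &
          embedding (lunit G)],
      mopen (linvdom G) /\ smooth_on (linvdom G) (linv G) &
      (exists O : set (prod_mfd S S), mopen O /\
         lmuldom G = O `&` composable G) /\
      smooth_on_subset (X := prod_mfd S S) (lmuldom G) (lmul G)].

(* A triple is in [lcycles] only if it is composable around the triangle, and,
   as soon as its product is defined by the partial multiplication, it is in
   [lcycles] exactly when that product is a unit. *)
Definition lcycles_spec {M S : Type} (G : localGroupoid M S) : Prop :=
  [/\ forall a b c, lcycles G (a, b, c) ->
        [/\ composable G (a, b), composable G (b, c) & composable G (c, a)],
      forall a b c, lmuldom G (a, b) -> lmuldom G (lmul G (a, b), c) ->
        (lcycles G (a, b, c) <->
         exists x, lmul G (lmul G (a, b), c) = lunit G x) &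
      forall a b c, lmuldom G (b, c) -> lmuldom G (a, lmul G (b, c)) ->
        (lcycles G (a, b, c) <->
         exists x, lmul G (a, lmul G (b, c)) = lunit G x)].

Definition sum3_form {p} (S : chartedSpace R p) (w : form2 S) :
    form2 (prod_mfd (prod_mfd S S) S) :=
  fun z u v =>
    pull2 (X := prod_mfd (prod_mfd S S) S) (fun a => a.1.1) w z u v
    + pull2 (X := prod_mfd (prod_mfd S S) S) (fun a => a.1.2) w z u v
    + pull2 (X := prod_mfd (prod_mfd S S) S) (fun a => a.2) w z u v.

Definition local_symplectic_groupoid {n p} (M : chartedSpace R n)
    (S : chartedSpace R p) (w : form2 S) (G : localGroupoid M S) : Prop :=
  [/\ local_lie_groupoid G, symplectic_on (arrows G) w,
      lagrangian_submanifold w (range (lunit G)),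
      forall a, linvdom G a -> forall u v, pull2 (linv G) w a u v = - w a u v &
      lcycles_spec G /\
      lagrangian_submanifold (X := prod_mfd (prod_mfd S S) S)
        (sum3_form w) (lcycles G)].

End Manifolds.

(* The inverse of f on f(V), with value [d] outside f(V). *)
Definition inverse_on (S T : Type) (V : set S) (f : S -> T) (d : S) (y : T) :
    S :=
  if pselect (exists a, V a /\ f a = y) is left H then projT1 (cid H) else d.

Definition transported_groupoid (R : realType) (n : nat)
    (M : chartedSpace R n) (V : set (total_space (cotangent M)))
    (f : total_space (cotangent M) -> prod_mfd M M) :
    localGroupoid M (total_space (cotangent M)) :=
  let S := total_space (cotangent M) in
  let s : S -> M := fun a => (f a).2 in
  let t : S -> M := fun a => (f a).1 in
  let g : M * M -> S :=
    fun y => inverse_on V f (zero_section (cotangent M) y.1) y in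
  @LocalGroupoid M S
    V s t
    (zero_section (cotangent M))
    [set a | V a /\ (f @` V) (s a, t a)]
    (fun a => g (s a, t a))
    [set z | [/\ V z.1, V z.2, s z.1 = t z.2 & (f @` V) (t z.1, s z.2)]]
    (fun z => g (t z.1, s z.2))
    [set z | [/\ V z.1.1, V z.1.2 & V z.2] /\
             [/\ s z.1.1 = t z.1.2, s z.1.2 = t z.2 & s z.2 = t z.1.1]].

(* Main.v *)
(* Write s and t for the second and first components of f.  Everything follows
   from the identity -dtheta = s^* omega - t^* omega on V.  By definition of chi,
   chi^* theta = tau'^* phi' - tau^* phi; taking d, the two terms pi^* omega
   cancel and d(chi^* theta) = (lam' tau')^* omega - (lam tau)^* omega, where
   f o chi = (lam' tau', lam tau).  So f identifies V with an open neighborhood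
   of the diagonal in the pair groupoid, with the form omega_2 - omega_1: on
   units s = t, inversion exchanges s and t, and on a 3-cycle the six pullbacks
   of omega cancel in pairs.  The coordinates t1, t2, t3, s1 - t2, s2 - t3,
   s3 - t1 show that the 3-cycles form a submanifold of half the dimension. *)
Require Import Defs.
From mathcomp Require Import all_boot all_order all_algebra.
From mathcomp Require Import all_classical all_reals all_analysis.
From HB Require Import structures.
From mathcomp Require Import ring lra.
Require Import Defs.

Set Implicit Arguments.
Unset Strict Implicit.
Unset Printing Implicit Defensive.

Import Order.TTheory GRing.Theory Num.Theory.
Import numFieldNormedType.Exports.
Local Open Scope classical_set_scope.
Local Open Scope ring_scope.

(** * Calculus of smooth maps between normed spaces *)

(** A tangent vector is given by its coordinates in the preferred chart of its base point, and that
    chart may jump from point to point. So [tmap], [pull1] and [ext_d1] need not depend smoothly on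
    the point as they stand, and differentiation is carried out in one fixed chart, through [coef1]
    and [coef2]. The analytic core is that d commutes with pullbacks. It rests on the symmetry of
    second derivatives and serves twice: along [chi] and the projections of the Whitney sum, to
    obtain the identity for -dtheta, and along the inverse of a chart, to see that [ext_d1] has the
    same expression in all charts. Smoothness and closedness of -dtheta then come from exactness,
    non-degeneracy from the formula for theta in bundle coordinates. The other obstacle is that f
    and the inverse maps are controlled only on open sets, and that some identities hold only along
    a submanifold. Hence the lemmas on [tmap] carry an open set of smoothness, and vectors tangent
    to the units or to the 3-cycles are treated through curves. *)

Section Calculus.
Context {R : realType}.

(** Near x both maps have the same remainder, so the differential of f is one for g, and
    differentials are unique. *)
Lemma diff_near_eq (V W : normedModType R) (f g : V -> W) (x : V) :
  (\forall y \near x, f y = g y) -> differentiable f x ->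
  differentiable g x /\ 'd g x = 'd f x :> (V -> W).
Proof.
move=> fg df.
have fgx : f x = g x by exact: nbhs_singleton fg.
have E : g \o shift x = cst (g x) + 'd f x +o_ 0 id.
  apply/eqaddoP => e e0.
  have /eqaddoP /(_ e e0) H := diff_locally df.
  have fg0 : \forall y \near (0 : V), f (y + x) = g (y + x).
    by move: fg; rewrite (near_shift 0 x) /=; apply: filterS => y /=; rewrite subr0.
  apply: filterS2 H fg0 => y.
  by rewrite /= !fctE /= => H Efg; rewrite -Efg -fgx.
have dE : 'd g x = 'd f x :> (V -> W).
  by apply: diff_unique => //; apply: diff_continuous.
split=> //; apply/diff_locallyP; rewrite dE; split=> //.
exact: diff_continuous.
Qed.

Lemma rV_linear_continuous n (W : normedModType R) (L : {linear 'rV[R]_n -> W}) :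
  continuous L.
Proof.
have -> : (L : _ -> _) = (fun v => \sum_i v 0 i *: L (delta_mx 0 i)).
  rewrite funeqE => v; rewrite [in LHS](row_sum_delta v) linear_sum.
  by apply: eq_bigr => i _; rewrite linearZ.
rewrite (_ : (fun _ => _) = \sum_(i < n)
    (fun v : 'rV[R]_n => v 0 i *: L (delta_mx 0 i))); last first.
  by rewrite funeqE => v; rewrite fct_sumE.
move=> v; apply: differentiable_continuous; apply: differentiable_sum => i.
by apply: differentiableZl; exact: differentiable_coord.
Qed.

(** Since N is open, f and g agree near each of its points; their derivatives then agree on N as
    well, which feeds the induction. *)
Lemma Ck_eq (V W : normedModType R) k (N : set V) (f g : V -> W) :
  open N -> (forall x, N x -> f x = g x) -> Ck k N f -> Ck k N g.
Proof.
move=> oN; elim: k f g => [|k IH] f g fg /=.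
  move=> fN x Nx; have := fN x Nx; rewrite /prop_for /continuous_at fg //.
  apply: cvg_trans; apply: near_eq_cvg.
  by apply: filterS (open_nbhs_nbhs (conj oN Nx)) => y Ny; rewrite fg.
have near_fg x : N x -> \forall y \near x, f y = g y.
  by move=> Nx; apply: filterS (open_nbhs_nbhs (conj oN Nx)) => y Ny; rewrite fg.
move=> [df Cf]; split.
  by move=> x Nx; have [] := diff_near_eq (near_fg x Nx) (df x Nx).
move=> v; apply: IH (Cf v) => x Nx.
by have [_ ->] := diff_near_eq (near_fg x Nx) (df x Nx).
Qed.

Lemma Ck_sub (V W : normedModType R) k (N N' : set V) (f : V -> W) :
  N' `<=` N -> Ck k N f -> Ck k N' f.
Proof.
move=> NN'; elim: k f => [|k IH] f /=; first by move=> fN x /NN'; apply: fN.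
by move=> [df Cf]; split=> [x /NN'/df|v] //; apply: IH.
Qed.

Lemma Ck_pred (V W : normedModType R) k (N : set V) (f : V -> W) :
  Ck k.+1 N f -> Ck k N f.
Proof.
elim: k f => [|k IH] f /=.
  by move=> [df _] x /df; exact: differentiable_continuous.
by move=> [df Cf]; split=> // v; apply: IH; apply: Cf.
Qed.

Lemma Ck_cst (V W : normedModType R) k (N : set V) (w : W) : Ck k N (cst w).
Proof.
elim: k w => [|k IH] w /=; first by move=> x _; exact: cvg_cst.
split=> [x _|v]; first exact: differentiable_cst.
rewrite (_ : (fun _ => _) = cst 0); first exact: IH.
by rewrite funeqE => x; rewrite diff_cst.
Qed.

Lemma Ck_add (V W : normedModType R) k (N : set V) (f g : V -> W) :
  open N -> Ck k N f -> Ck k N g -> Ck k N (fun x => f x + g x).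
Proof.
move=> oN; elim: k f g => [|k IH] f g /=.
  by move=> fN gN x Nx; apply: (@cvgD _ _ _ _ _ f g); [apply: fN|apply: gN].
move=> [df Cf] [dg Cg]; split=> [x Nx|v].
  by apply: (@differentiableD _ _ _ f g); [apply: df|apply: dg].
apply: Ck_eq (IH _ _ (Cf v) (Cg v)) => // x Nx.
by rewrite [in RHS](@diffD _ _ _ f g) //; [exact: df|exact: dg].
Qed.

Lemma Ck_post (V W W' : normedModType R) k (N : set V) (f : V -> W)
    (L : {linear W -> W'}) :
  open N -> continuous L -> Ck k N f -> Ck k N (fun x => L (f x)).
Proof.
move=> oN cL; elim: k f => [|k IH] f /=.
  by move=> fN x Nx; apply: (@continuous_comp _ _ _ f L); [exact: fN|exact: cL].
have dL y : differentiable L y by exact: linear_differentiable.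
move=> [df Cf]; split=> [x Nx|v].
  by apply: (@differentiable_comp _ _ _ _ f L); [exact: df|].
apply: Ck_eq (IH _ (Cf v)) => // x Nx.
by rewrite [in RHS](@diff_comp _ _ _ _ f L) //=; [rewrite diff_lin|exact: df].
Qed.

Lemma Ck_linear (V W : normedModType R) k (N : set V) (L : {linear V -> W}) :
  continuous L -> Ck k N L.
Proof.
move=> cL; case: k => [|k] /=; first by move=> x _; exact: cL.
split=> [x _|v]; first exact: linear_differentiable.
rewrite (_ : (fun _ => _) = cst (L v)); first exact: Ck_cst.
by rewrite funeqE => x; rewrite diff_lin.
Qed.

(** The Leibniz rule multiplies a derivative, of class k, by an undifferentiated factor, of class
    k+1. The induction hypothesis wants both in class k, whence [Ck_pred]. *)
Lemma Ck_mul (V : normedModType R) k (N : set V) (f g : V -> R^o) :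
  open N -> Ck k N f -> Ck k N g -> Ck k N (fun x => f x * g x : R^o).
Proof.
move=> oN; elim: k f g => [|k IH] f g.
  by move=> fN gN x Nx; apply: (@cvgM _ _ _ _ f g); [apply: fN|apply: gN].
move=> Cf Cg; have [df Df] := Cf; have [dg Dg] := Cg.
split=> [x Nx|v].
  by apply: (@differentiableM _ _ f g); [apply: df|apply: dg].
apply: (@Ck_eq _ _ _ _ (fun x => f x * 'd g x v + g x * 'd f x v : R^o)) => //.
  by move=> x Nx; rewrite (@diffM _ _ f g) //; [exact: df|exact: dg].
have Cf' := Ck_pred Cf; have Cg' := Ck_pred Cg.
apply: (Ck_add oN); first exact: (IH _ _ Cf' (Dg v)).
exact: (IH _ _ Cg' (Df v)).
Qed.

Lemma Ck_sum (V W : normedModType R) k (N : set V) (I : Type) (r : seq I)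
    (f : I -> V -> W) :
  open N -> (forall i, Ck k N (f i)) -> Ck k N (fun x => \sum_(i <- r) f i x).
Proof.
move=> oN Cf; elim: r => [|i r IH].
  by under [X in Ck _ _ X]eq_fun do rewrite big_nil; exact: Ck_cst.
by under [X in Ck _ _ X]eq_fun do rewrite big_cons; exact: Ck_add.
Qed.

End Calculus.

Section SmoothMaps.
Context {R : realType}.

Definition linear_fun (U V : lmodType R) (f : U -> V) (lf : linear f) :
  {linear U -> V} := HB.pack f (GRing.isLinear.Build _ _ _ _ f lf).

Lemma coord_linear n (i : 'I_n) : linear (fun v : 'rV[R]_n => v 0 i : R^o).
Proof. by move=> a u v; rewrite !mxE. Qed.

Lemma scalel_linear (W : lmodType R) (w : W) : linear (fun r : R^o => r *: w).
Proof. by move=> a u v; rewrite scalerDl scalerA. Qed.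

Lemma Ck_coord (V : normedModType R) n k (N : set V) (f : V -> 'rV[R]_n) i :
  open N -> Ck k N f -> Ck k N (fun x => f x 0 i : R^o).
Proof.
move=> oN; apply: (@Ck_post _ _ _ _ _ _ f (linear_fun (coord_linear i))) => //.
exact: rV_linear_continuous.
Qed.

Lemma Ck_row (V : normedModType R) n k (N : set V) (f : V -> 'rV[R]_n) :
  open N -> (forall i, Ck k N (fun x => f x 0 i : R^o)) -> Ck k N f.
Proof.
move=> oN Cf.
apply: (@Ck_eq _ _ _ _ _ (fun x => \sum_i f x 0 i *: delta_mx 0 i)) => //.
  by move=> x _; rewrite -row_sum_delta.
apply: Ck_sum => // i.
apply: (@Ck_post _ _ _ _ _ _ (fun x => f x 0 i : R^o)
  (linear_fun (scalel_linear (delta_mx 0 i : 'rV[R]_n)))) => //.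
exact: scalel_continuous.
Qed.

Lemma diff_sum_delta n (W : normedModType R) (f : 'rV[R]_n -> W) x v :
  'd f x v = \sum_i v 0 i *: 'd f x (delta_mx 0 i).
Proof.
rewrite [in LHS](row_sum_delta v) linear_sum.
by apply: eq_bigr => i _; rewrite linearZ.
Qed.

(** In the chain rule both the point and the vector at which the differential of g is taken vary
    with x. Expanding the vector in the standard basis leaves a finite sum of products of a
    coordinate of the derivative of f with a partial derivative of g composed with f, and the
    induction hypothesis covers the latter. Scalar values make [Ck_mul] applicable. *)
Lemma Ck_comp_scalar (V : normedModType R) n k (N : set V) (N' : set 'rV[R]_n)
    (f : V -> 'rV[R]_n) (g : 'rV[R]_n -> R^o) :
  open N -> N `<=` f @^-1` N' -> Ck k N f -> Ck k N' g ->
  Ck k N (fun x => g (f x)).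
Proof.
move=> oN fN; elim: k f g fN => [|k IH] f g fN.
  move=> cf cg x Nx; apply: (@continuous_comp _ _ _ f g); first exact: cf.
  by apply: cg; exact: fN.
move=> Cf Cg; have [df Df] := Cf; have [dg Dg] := Cg.
split=> [x Nx|v].
  apply: (@differentiable_comp _ _ _ _ f g); first exact: df.
  by apply: dg; exact: fN.
have := @Ck_eq _ _ _ _ _ (fun x => \sum_i 'd f x v 0 i * 'd g (f x) (delta_mx 0 i) :
    R^o).
apply; first exact: oN.
  move=> x Nx; rewrite (@diff_comp _ _ _ _ f g); first last.
  - by apply: dg; exact: fN.
  - exact: df.
  by rewrite /= diff_sum_delta.
apply: (Ck_sum _ oN) => i; apply: (Ck_mul oN).
  exact: (Ck_coord i oN (Df v)).
exact: (IH f _ fN (Ck_pred Cf) (Dg (delta_mx 0 i))).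
Qed.

Lemma Cinfty_eq (V W : normedModType R) (N : set V) (f g : V -> W) :
  open N -> (forall x, N x -> f x = g x) -> Cinfty N f -> Cinfty N g.
Proof. by move=> oN fg Cf k; apply: Ck_eq (Cf k). Qed.

Lemma Cinfty_sub (V W : normedModType R) (N N' : set V) (f : V -> W) :
  N' `<=` N -> Cinfty N f -> Cinfty N' f.
Proof. by move=> NN' Cf k; apply: Ck_sub (Cf k). Qed.

Lemma Cinfty_differentiable (V W : normedModType R) (N : set V) (f : V -> W) x :
  Cinfty N f -> N x -> differentiable f x.
Proof. by move=> /(_ 1%N) [df _] /df. Qed.

Lemma Cinfty_diff (V W : normedModType R) (N : set V) (f : V -> W) v :
  Cinfty N f -> Cinfty N (fun x => 'd f x v).
Proof. by move=> Cf k; have [_] := Cf k.+1; apply. Qed.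

Lemma Cinfty_cst (V W : normedModType R) (N : set V) (w : W) :
  Cinfty N (fun=> w).
Proof. move=> k; exact: Ck_cst. Qed.

Lemma Cinfty_add (V W : normedModType R) (N : set V) (f g : V -> W) :
  open N -> Cinfty N f -> Cinfty N g -> Cinfty N (fun x => f x + g x).
Proof. by move=> oN Cf Cg k; apply: Ck_add. Qed.

Lemma Cinfty_mul (V : normedModType R) (N : set V) (f g : V -> R^o) :
  open N -> Cinfty N f -> Cinfty N g -> Cinfty N (fun x => f x * g x : R^o).
Proof. by move=> oN Cf Cg k; apply: Ck_mul. Qed.

Lemma Cinfty_sum (V W : normedModType R) (N : set V) (I : Type) (r : seq I)
    (f : I -> V -> W) : open N ->
  (forall i, Cinfty N (f i)) -> Cinfty N (fun x => \sum_(i <- r) f i x).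
Proof. by move=> oN Cf k; apply: Ck_sum => // i; apply: Cf. Qed.

Lemma Cinfty_linear n (W : normedModType R) (N : set 'rV[R]_n)
  (L : 'rV[R]_n -> W) : linear L -> Cinfty N L.
Proof.
move=> lL k; apply: (@Ck_linear _ _ _ _ _ (linear_fun lL)).
exact: rV_linear_continuous.
Qed.

Lemma diff_linear n (W : normedModType R) (L : 'rV[R]_n -> W) x v :
  linear L -> 'd L x v = L v.
Proof.
move=> lL; rewrite -[L]/(linear_fun lL : _ -> _) diff_lin //.
exact: rV_linear_continuous.
Qed.

Lemma Cinfty_coord (V : normedModType R) n (N : set V) (f : V -> 'rV[R]_n) i :
  open N -> Cinfty N f -> Cinfty N (fun x => f x 0 i : R^o).
Proof. by move=> oN Cf k; apply: Ck_coord. Qed.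

Lemma Cinfty_row (V : normedModType R) n (N : set V) (f : V -> 'rV[R]_n) :
  open N -> (forall i, Cinfty N (fun x => f x 0 i : R^o)) -> Cinfty N f.
Proof. by move=> oN Cf k; apply: Ck_row => // i; apply: Cf. Qed.

Lemma Cinfty_comp_scalar (V : normedModType R) n (N : set V)
    (N' : set 'rV[R]_n) (f : V -> 'rV[R]_n) (g : 'rV[R]_n -> R^o) :
  open N -> N `<=` f @^-1` N' -> Cinfty N f -> Cinfty N' g ->
  Cinfty N (fun x => g (f x)).
Proof. by move=> oN fN Cf Cg k; apply: Ck_comp_scalar (Cg k). Qed.

Lemma Cinfty_comp (V : normedModType R) n p (N : set V) (N' : set 'rV[R]_n)
    (f : V -> 'rV[R]_n) (g : 'rV[R]_n -> 'rV[R]_p) :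
  open N -> open N' -> N `<=` f @^-1` N' -> Cinfty N f -> Cinfty N' g ->
  Cinfty N (fun x => g (f x)).
Proof.
move=> oN oN' fN Cf Cg; apply: Cinfty_row => // i.
apply: (@Cinfty_comp_scalar _ _ _ N' f (fun y => g y 0 i)) => //.
exact: Cinfty_coord.
Qed.

Lemma Cinfty_row_mx (V : normedModType R) n p (N : set V)
    (f : V -> 'rV[R]_n) (g : V -> 'rV[R]_p) : open N ->
  Cinfty N f -> Cinfty N g -> Cinfty N (fun x => row_mx (f x) (g x)).
Proof.
move=> oN Cf Cg; apply: Cinfty_row => // i; case: (split_ordP i) => j ->.
  under [X in Cinfty _ X]eq_fun do rewrite row_mxEl; exact: Cinfty_coord.
under [X in Cinfty _ X]eq_fun do rewrite row_mxEr; exact: Cinfty_coord.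
Qed.

Lemma open_preimage_Cinfty (V W : normedModType R) (N : set V) (f : V -> W)
    (O : set W) :
  open N -> Cinfty N f -> open O -> open (N `&` f @^-1` O).
Proof.
move=> oN Cf oO; rewrite openE => x [Nx Ofx].
apply: filterI; first exact: open_nbhs_nbhs (conj oN Nx).
apply: differentiable_continuous (Cinfty_differentiable Cf Nx) _ _.
exact: open_nbhs_nbhs (conj oO Ofx).
Qed.

End SmoothMaps.

(** * Symmetry of second derivatives *)

Section Schwarz.
Context {R : realType}.

(** The one-variable mean value theorem for the restriction of F to the line p + t w. *)
Lemma MVT_line (V : normedModType R) (F : V -> R^o) (p w : V) (s : R) :
  0 < s -> (forall t, 0 <= t <= s -> differentiable F (p + t *: w)) ->
  exists c, 0 < c < s /\ F (p + s *: w) - F p = s * 'd F (p + c *: w) w.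
Proof.
move=> s0 dF.
pose g (t : R) := p + t *: w.
have dg t : is_diff t g ( *:%R^~ w).
  have := @is_diffD _ _ _ _ _ _ _ t (is_diff_cst p t) (is_diff_scalel t w).
  by rewrite add0r.
have dFg (t : R) : 0 <= t <= s -> is_derive t 1 (F \o g : R -> R) ('d F (g t) w).
  move=> ts.
  have dFt : differentiable (F \o g) t.
    by apply: differentiable_comp; [exact: ex_diff | exact: dF].
  apply: DeriveDef; first exact: diff_derivable.
  rewrite deriveE // diff_comp //=; last exact: dF.
  by rewrite diff_val scale1r.
have [||c /andP[c0 cs] E] := @MVT R (F \o g) (fun t => 'd F (g t) w) 0 s s0.
- by move=> t; rewrite in_itv /= => /andP[t0 ts]; apply: dFg; rewrite !ltW.
- apply: derivable_within_continuous => t; rewrite in_itv /= => ts.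
  exact: (@ex_derive _ _ _ _ _ _ _ (dFg t ts)).
exists c; split; first by move: c0 cs; rewrite !bnd_simp => -> ->.
by move: E; rewrite /= /g scale0r addr0 subr0 mulrC.
Qed.

(* The mean value theorem along u, then along v. *)
Lemma second_difference (V : normedModType R) (f : V -> R^o) (x u v : V)
    (r s : R) :
  (forall y, ball x r y -> differentiable f y) ->
  (forall y, ball x r y -> differentiable (fun y => 'd f y u : R^o) y) ->
  0 < s -> s * (`|u| + `|v|) < r ->
  exists2 y, ball x r y &
    f (x + s *: v + s *: u) - f (x + s *: u) - (f (x + s *: v) - f x)
      = s * (s * 'd (fun y => 'd f y u : R^o) y v).
Proof.
move=> df ddf s0 sr.
have inball (a b : R) : 0 <= a <= s -> 0 <= b <= s -> ball x r (x + a *: v + b *: u).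
  move=> /andP[a0 as_] /andP[b0 bs]; rewrite -ball_normE /ball_ /=.
  rewrite -addrA opprD addrA subrr add0r normrN.
  apply: le_lt_trans (ler_normD _ _) (le_lt_trans _ sr).
  rewrite !normrZ !ger0_norm // mulrDr addrC.
  by apply: lerD; apply: ler_wpM2r.
have s1 : 0 <= s <= s by rewrite lexx ltW.
have s2 : (0 : R) <= 0 <= s by rewrite lexx ltW.
have iv (a : R) : 0 <= a <= s -> ball x r (x + a *: u).
  by move=> ha; have := inball 0 a s2 ha; rewrite scale0r addr0.
pose F y := f (y + s *: v) - f y : R^o.
have dF (t : R) : 0 <= t <= s -> is_diff (x + t *: u) F
    (('d f (x + s *: v + t *: u) : V -> R^o) - ('d f (x + t *: u) : V -> R^o)).
  move=> ts; have B1 : ball x r (x + t *: u + s *: v).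
    by rewrite addrAC; exact: inball.
  have d1 : is_diff (x + t *: u) (fun y : V => f (y + s *: v))
      ('d f (x + s *: v + t *: u)).
    rewrite addrAC; have d2 : is_diff (x + t *: u) (fun y => y + s *: v) id.
      have := @is_diffD _ _ _ _ _ _ _ (x + t *: u) (is_diff_id _)
          (is_diff_cst (s *: v) _).
      by rewrite addr0.
    have d3 := differentiableP (df _ B1).
    exact: (@is_diff_comp _ _ _ _ (fun y => y + s *: v) id f _ _ d2 d3).
  have d3 := differentiableP (df _ (iv t ts)).
  exact: (@is_diffB _ _ _ _ _ _ _ _ d1 d3).
have [|c [/andP[c0 cs] E]] := @MVT_line V F x u s s0.
  by move=> t ts; exact: (@ex_diff _ _ _ _ _ _ _ (dF t ts)).
have cs' : 0 <= c <= s by rewrite !ltW.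
have [|d [/andP[d0 ds] E2]] := @MVT_line V (fun y => 'd f y u) (x + c *: u) v s s0.
  by move=> t ts; apply: ddf; rewrite addrAC; exact: inball.
exists (x + c *: u + d *: v); first by rewrite addrAC; apply: inball; rewrite // !ltW.
rewrite -E2; move: E; rewrite /F.
rewrite (@diff_val _ _ _ _ _ _ _ (dF c cs')) /= fctE /=.
rewrite [x + s *: u + _]addrAC => ->.
by congr (_ * (_ - _)); rewrite addrAC.
Qed.

(** The second difference over a small parallelogram does not depend on the order of u and v. Read
    in the two orders, it equates a value of one mixed derivative with a value of the other, at two
    points close to x; continuity at x does the rest. The inequality is enough, because u and v can
    be exchanged. *)
Lemma schwarz_le (V : normedModType R) (N : set V) (f : V -> R^o) (x u v : V) :
  open N -> N x -> Cinfty N f ->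
  'd (fun y => 'd f y u : R^o) x v <= 'd (fun y => 'd f y v : R^o) x u.
Proof.
move=> oN Nx Cf.
pose h y := 'd (fun y => 'd f y u : R^o) y v.
pose h' y := 'd (fun y => 'd f y v : R^o) y u.
change (h x <= h' x); apply/ler_addgt0Pr => e e0.
have Ch : Cinfty N h by apply: Cinfty_diff; apply: Cinfty_diff.
have Ch' : Cinfty N h' by apply: Cinfty_diff; apply: Cinfty_diff.
have e20 : 0 < e / 2 by rewrite divr_gt0.
have /cvgrPdist_lt /(_ _ e20) n1 := differentiable_continuous
    (Cinfty_differentiable Ch Nx).
have /cvgrPdist_lt /(_ _ e20) n2 := differentiable_continuous
    (Cinfty_differentiable Ch' Nx).
have /nbhs_ballP[r r0 B] : nbhs x (N `&`
    ([set t | `|h x - h t| < e / 2] `&` [set t | `|h' x - h' t| < e / 2])).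
  by apply: filterI (filterI n1 n2); exact: open_nbhs_nbhs (conj oN Nx).
(* The summand 1 keeps the denominator positive when u = v = 0 and makes the parallelogram fit
   strictly inside the ball. *)
pose s := r / (`|u| + `|v| + 1).
have uv0 : 0 < `|u| + `|v| + 1 by rewrite ltr_wpDl // addr_ge0.
have s0 : 0 < s by rewrite divr_gt0.
have sr : s * (`|u| + `|v|) < r.
  by rewrite /s mulrAC ltr_pdivrMr // ltr_pM2l // ltrDl.
have sr' : s * (`|v| + `|u|) < r by rewrite addrC.
have dN w y : ball x r y -> differentiable (fun y => 'd f y w : R^o) y.
  move=> /B [Ny _]; apply: Cinfty_differentiable Ny; exact: Cinfty_diff.
have d1 y : ball x r y -> differentiable f y.
  by move=> /B [Ny _]; apply: Cinfty_differentiable Ny.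
have [y yB E1] := second_difference d1 (dN u) s0 sr.
have [z zB E2] := second_difference d1 (dN v) s0 sr'.
have hyz : h y = h' z.
  have sn0 : s != 0 by rewrite gt_eqF.
  apply: (mulfI sn0); apply: (mulfI sn0); rewrite /h /h' -E1 -E2.
  by rewrite [x + s *: v + s *: u]addrAC !opprB; ring.
have [_ [/= B1 _]] := B _ yB; have [_ [_ /= B2]] := B _ zB.
move: B1 B2; rewrite -hyz !ltr_norml => /andP[_ B1] /andP[B2 _].
clear -B1 B2; move: (h x) (h' x) (h y) B1 B2 => a b c B1 B2; lra.
Qed.

Lemma schwarz (V : normedModType R) (N : set V) (f : V -> R^o) (x u v : V) :
  open N -> N x -> Cinfty N f ->
  'd (fun y => 'd f y u : R^o) x v = 'd (fun y => 'd f y v : R^o) x u.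
Proof.
by move=> oN Nx Cf; apply/le_anti/andP; split; apply: schwarz_le Nx Cf.
Qed.

End Schwarz.

(** * Exterior derivative of a pullback, in coordinates *)

Section LocalForms.
Context {R : realType}.

Lemma linear_form_sum n (a : 'rV[R]_n -> R) (v : 'rV[R]_n) :
  linear_form a -> a v = \sum_i v 0 i * a (delta_mx 0 i).
Proof.
move=> la.
have la' : linear (a : 'rV[R]_n -> R^o) by [].
have := linear_sum (linear_fun la') => E.
rewrite [in LHS](row_sum_delta v) -[a]/(linear_fun la' : _ -> _) linear_sum.
by apply: eq_bigr => i _; rewrite linearZ.
Qed.

Lemma diff_chain (U V W : normedModType R) (f : U -> V) (g : V -> W) x v :
  differentiable f x -> differentiable g (f x) ->
  'd (fun y => g (f y)) x v = 'd g (f x) ('d f x v).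
Proof.
by move=> df dg; rewrite -[fun y => g (f y)]/(g \o f) diff_comp.
Qed.

Lemma Cinfty_derivable (V W : normedModType R) (N : set V) (f : V -> W) x v :
  Cinfty N f -> N x -> derivable f x v.
Proof. by move=> Cf Nx; apply: diff_derivable; apply: Cinfty_differentiable Nx. Qed.

Lemma near_open (T : topologicalType) (N : set T) (P : T -> Prop) x :
  open N -> N x -> (forall y, N y -> P y) -> \forall y \near x, P y.
Proof.
by move=> oN Nx NP; apply: filterS (open_nbhs_nbhs (conj oN Nx)) => y /NP.
Qed.

(* The second derivatives of F cancel by [schwarz]. *)
Lemma local_ext_d_pullback n p (N : set 'rV[R]_n) (N' : set 'rV[R]_p)
    (F : 'rV[R]_n -> 'rV[R]_p) (A : 'rV[R]_p -> 'rV[R]_p -> R^o) x u v :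
  open N -> open N' -> N `<=` F @^-1` N' -> Cinfty N F ->
  (forall y, N' y -> linear_form (A ^~ y)) -> (forall w, Cinfty N' (A w)) ->
  N x ->
  let B w y : R^o := A ('d F y w) (F y) in
  'D_u (B v) x - 'D_v (B u) x
    = 'D_('d F x u) (A ('d F x v)) (F x) - 'D_('d F x v) (A ('d F x u)) (F x).
Proof.
move=> oN oN' FN CF lA CA Nx B.
pose G i y : R^o := F y 0 i.
have CG i : Cinfty N (G i) by exact: Cinfty_coord.
have dG i w y : N y -> 'd (G i) y w = 'd F y w 0 i.
  move=> Ny; have -> : G i = (fun M : 'rV[R]_p => M 0 i : R^o) \o F by [].
  rewrite diff_comp /=; first last.
  - exact: differentiable_coord.
  - exact: Cinfty_differentiable Ny.
  by rewrite diff_linear //; exact: coord_linear.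
have CAF i : Cinfty N (fun y => A (delta_mx 0 i) (F y)).
  exact: Cinfty_comp_scalar (CA _).
have DA w z : 'D_z (A w) (F x) = \sum_i w 0 i * 'D_z (A (delta_mx 0 i)) (F x).
  have -> : 'D_z (A w) (F x)
      = 'D_z (\sum_i (w 0 i *: A (delta_mx 0 i) : _ -> R^o)) (F x).
    apply: near_eq_derive; apply: near_open oN' (FN _ Nx) _ => y N'y.
    by rewrite (linear_form_sum w (lA y N'y)) fct_sumE.
  have dA i : derivable (A (delta_mx 0 i)) (F x) z.
    by apply: Cinfty_derivable (CA _) _; exact: FN.
  rewrite derive_sum; last by move=> i; apply: derivableZ.
  by apply: eq_bigr => i _; rewrite deriveZ.
(* The Leibniz rule: the first term differentiates the coefficients of the form, the second is a
   second derivative of F. After antisymmetrization the first terms give the right-hand side of the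
   lemma. *)
have DB w z : 'D_z (B w) x = \sum_i
    ('d F x w 0 i * 'D_('d F x z) (A (delta_mx 0 i)) (F x)
     + A (delta_mx 0 i) (F x) * 'd (fun y => 'd (G i) y w : R^o) x z).
  pose K i : 'rV[R]_n -> R^o := fun y => 'd (G i) y w.
  have CK i : Cinfty N (K i) by exact: Cinfty_diff.
  have -> : 'D_z (B w) x
      = 'D_z (\sum_i (K i * (fun y => A (delta_mx 0 i) (F y)) : _ -> R^o)) x.
    apply: near_eq_derive; apply: near_open oN Nx _ => y Ny.
    rewrite /B (linear_form_sum _ (lA _ (FN _ Ny))) fct_sumE.
    by apply: eq_bigr => i _; rewrite /K fctE dG.
  have dK i : derivable (K i) x z by exact: Cinfty_derivable Nx.
  have dA i : derivable (fun y => A (delta_mx 0 i) (F y)) x z.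
    exact: Cinfty_derivable Nx.
  rewrite derive_sum; last by move=> i; apply: derivableM.
  apply: eq_bigr => i _.
  rewrite (deriveM (dK i) (dA i)) (_ : K i x = 'd F x w 0 i); last exact: dG.
  have dKx := Cinfty_differentiable (CK i) Nx.
  have dFx := Cinfty_differentiable CF Nx.
  have dAx : differentiable (A (delta_mx 0 i)) (F x).
    by apply: Cinfty_differentiable (CA _) _; exact: FN.
  rewrite (deriveE _ dKx) (deriveE _ dAx).
  rewrite (deriveE _ (Cinfty_differentiable (CAF i) Nx)).
  exact: (congr1 (fun t => 'd F x w 0 i * t + _) (diff_chain z dFx dAx)).
rewrite !DB !DA !big_split /= opprD addrACA -[RHS]addr0; congr (_ + _).
apply/eqP; rewrite subr_eq0; apply/eqP; apply: eq_bigr => i _.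
exact: (congr1 (fun t => A (delta_mx 0 i) (F x) * t) (schwarz v u oN Nx (CG i))).
Qed.

End LocalForms.

(** * Charts and smooth maps *)

Section Atlases.
Context {R : realType}.

(* Calculus in charts uses neither separation nor countability. *)
Definition smooth_atlas {n} (X : chartedSpace R n) : Prop :=
  [/\ forall x : X, charts X (chart_at x) /\ dom (chart_at x) x,
      forall c, charts X c -> forall x, dom c x -> bwd c (fwd c x) = x &
      forall c d, charts X c -> charts X d ->
        let N := fwd c @` (dom c `&` dom d) in
        open N /\ Cinfty N (fun y => fwd d (bwd c y))].

Lemma smooth_manifold_atlas n (X : chartedSpace R n) :
  smooth_manifold X -> smooth_atlas X.
Proof. by case. Qed.

Section OneSpace.
Context {n : nat} {X : chartedSpace R n}.
Hypothesis hX : smooth_atlas X.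

Lemma chart_at_charts (x : X) : charts X (chart_at x).
Proof. by have [/(_ x)[]] := hX. Qed.

Lemma dom_chart_at (x : X) : dom (chart_at x) x.
Proof. by have [/(_ x)[]] := hX. Qed.

Lemma fwdK c (x : X) : charts X c -> dom c x -> bwd c (fwd c x) = x.
Proof. by move=> hc cx; have [_ E _] := hX; exact: E. Qed.

Lemma bwd_dom c y : charts X c -> (fwd c @` dom c) y -> dom c (bwd c y).
Proof. by move=> hc [x xc <-]; rewrite fwdK. Qed.

Lemma bwdK c y : charts X c -> (fwd c @` dom c) y -> fwd c (bwd c y) = y.
Proof. by move=> hc [x xc <-]; rewrite fwdK. Qed.

Lemma open_transition c d : charts X c -> charts X d ->
  open (fwd c @` (dom c `&` dom d)).
Proof. by move=> hc hd; have [_ _ /(_ c d hc hd)[]] := hX. Qed.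

Lemma Cinfty_transition c d : charts X c -> charts X d ->
  Cinfty (fwd c @` (dom c `&` dom d)) (fun y => fwd d (bwd c y)).
Proof. by move=> hc hd; have [_ _ /(_ c d hc hd)[]] := hX. Qed.

Lemma open_fwd_dom c : charts X c -> open (fwd c @` dom c).
Proof. by move=> hc; have := open_transition hc hc; rewrite setIid. Qed.

(** [mopen] tests every chart of the atlas. By continuity of the transition maps, one chart around
    each point is enough. *)
Lemma mopenP (U : set X) :
  mopen U <-> forall x, U x -> exists c N,
    [/\ charts X c, dom c x, open N, N (fwd c x) &
        N `<=` fwd c @` (dom c `&` U)].
Proof.
split=> [oU x Ux|H d hd].
  exists (chart_at x), (fwd (chart_at x) @` (dom (chart_at x) `&` U)).
  split=> //; [exact: chart_at_charts|exact: dom_chart_at| |].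
    by apply: oU; exact: chart_at_charts.
  by exists x => //; split=> //; exact: dom_chart_at.
rewrite openE => _ [x [dx Ux] <-].
have [c [N [hc cx oN Nx NU]]] := H x Ux.
have oT := open_preimage_Cinfty (open_transition hd hc) (Cinfty_transition hd hc) oN.
apply: filterS (open_nbhs_nbhs (conj oT _)); last first.
  by split; [exists x|rewrite /= fwdK].
move=> _ [[x' [dx' cx'] <-]]; rewrite /= fwdK // => /NU[x'' [cx'' Ux''] E].
exists x' => //; split=> //.
by rewrite -(fwdK hc cx') -E fwdK.
Qed.

Lemma mopenI (U U' : set X) : mopen U -> mopen U' -> mopen (U `&` U').
Proof.
move=> oU oU' c hc.
have -> : fwd c @` (dom c `&` (U `&` U'))
    = fwd c @` (dom c `&` U) `&` fwd c @` (dom c `&` U').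
  apply/seteqP; split=> [_ [x [cx [Ux U'x]] <-]|_ [[x [cx Ux] <-] [x' [cx' U'x'] E]]].
    by split; exists x.
  have E' : x' = x by rewrite -(fwdK hc cx) -E fwdK.
  by exists x => //; rewrite -E' in Ux *; split.
by apply: openI; [exact: oU|exact: oU'].
Qed.

Lemma mopen_dom c : charts X c -> mopen (dom c).
Proof. by move=> hc d hd; apply: open_transition. Qed.

Lemma mopenT : mopen [set: X].
Proof. by move=> c hc; rewrite setIT; apply: open_fwd_dom. Qed.

Lemma mopen_fwd_preimage c (N : set 'rV[R]_n) : charts X c -> open N ->
  mopen (dom c `&` fwd c @^-1` N).
Proof.
move=> hc oN; apply/mopenP => x [cx Nx].
exists c, (fwd c @` dom c `&` N); split=> //.
  by apply: openI => //; exact: open_fwd_dom.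
by move=> _ [[x' cx' <-] Nx']; exists x'.
Qed.

End OneSpace.

Section Smooth.
Context {n p : nat} {X : chartedSpace R n} {Y : chartedSpace R p}.
Hypotheses (hX : smooth_atlas X) (hY : smooth_atlas Y).

(** [smooth_on] only provides some pair of charts at each point. In any other pair the map is the
    old representative composed with two transition maps; N is the set where all three factors are
    defined. *)
Lemma smooth_on_charts (U : set X) (f : X -> Y) x c d :
  smooth_on U f -> U x -> charts X c -> charts Y d -> dom c x -> dom d (f x) ->
  exists N : set 'rV[R]_n,
    [/\ open N, N (fwd c x), N `<=` fwd c @` (dom c `&` U `&` f @^-1` dom d) &
        Cinfty N (fun y => fwd d (f (bwd c y)))].
Proof.
move=> sf Ux hc hd cx dfx.
have [c' [d' [hc' hd' c'x d'fx [N' [oN' N'x N'U CN']]]]] := sf x Ux.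
have oT := open_transition hX hc hc'; have CT := Cinfty_transition hX hc hc'.
have oT' := open_transition hY hd' hd; have CT' := Cinfty_transition hY hd' hd.
pose N2 := N' `&` (fun y => fwd d' (f (bwd c' y))) @^-1` (fwd d' @` (dom d' `&` dom d)).
have oN2 : open N2 by apply: open_preimage_Cinfty.
pose N := fwd c @` (dom c `&` dom c') `&` (fun y => fwd c' (bwd c y)) @^-1` N2.
have oN : open N by apply: open_preimage_Cinfty.
have NE y : N y -> [/\ dom c (bwd c y), dom c' (bwd c y), U (bwd c y),
    dom d' (f (bwd c y)) & dom d (f (bwd c y))].
  move=> [[x' [cx' c'x'] <-]]; rewrite /preimage /= fwdK // => -[/= /N'U N'x'].
  rewrite fwdK // => -[y' [d'y' dy'] E].
  have [x'' [[c'x'' Ux''] d'fx''] E'] := N'x'.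
  have Exx : x'' = x' by rewrite -(fwdK hX hc' c'x') -E' fwdK.
  have d'f : dom d' (f x') by rewrite -Exx.
  have Ey : y' = f x' by rewrite -(fwdK hY hd' d'f) -E fwdK.
  by move: Ux'' dy'; rewrite Exx Ey.
exists N; split=> //.
- split; first by exists x.
  rewrite /preimage /= fwdK //; split=> //=.
  by rewrite fwdK //; exists (f x).
- move=> y Ny; have [h1 h2 h3 h4 h5] := NE y Ny.
  have [[x' [cx' _] E] _] := Ny.
  by exists x'; move: h1 h2 h3 h4 h5; rewrite -E fwdK.
apply: (@Cinfty_eq _ _ _ _
    (fun y => fwd d (bwd d' (fwd d' (f (bwd c' (fwd c' (bwd c y)))))))).
- exact: oN.
- move=> y Ny; have [h1 h2 h3 h4 h5] := NE y Ny.
  by rewrite (fwdK hX hc' h2) (fwdK hY hd' h4).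
have C1 : Cinfty N (fun y => fwd c' (bwd c y)).
  by apply: Cinfty_sub CT => y [].
have C2 : Cinfty N (fun y => fwd d' (f (bwd c' (fwd c' (bwd c y))))).
  have NN' : N `<=` (fun y => fwd c' (bwd c y)) @^-1` N' by move=> y [_ []].
  exact: (Cinfty_comp oN oN' NN' C1 CN').
have NT : N `<=` (fun y => fwd d' (f (bwd c' (fwd c' (bwd c y))))) @^-1`
    (fwd d' @` (dom d' `&` dom d)) by move=> y [_ []].
exact: (Cinfty_comp oN oT' NT C2 CT').
Qed.

Lemma smooth_on_mopen (U : set X) (f : X -> Y) : smooth_on U f -> mopen U.
Proof.
move=> sf; apply/(mopenP hX) => x Ux.
have [c [d [hc hd cx dfx [N [oN Nx NU _]]]]] := sf x Ux.
exists c, N; split=> //; apply: subset_trans NU _.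
by move=> _ [y [[cy Uy] _] <-]; exists y.
Qed.

Lemma smooth_on_local (U : set X) (f : X -> Y) :
  (forall x, U x -> exists U', [/\ U' x, U' `<=` U & smooth_on U' f]) ->
  smooth_on U f.
Proof.
move=> H x /H[U' [U'x U'U sf]].
have [c [d [hc hd cx dfx [N [oN Nx NU CN]]]]] := sf x U'x.
exists c, d; split=> //; exists N; split=> //; apply: subset_trans NU _.
by move=> _ [y [[cy Uy] dy] <-]; exists y => //; split=> //; split=> //; exact: U'U.
Qed.

Lemma smooth_on_chart_at (U : set X) (f : X -> Y) c d (N : set 'rV[R]_n) :
  charts X c -> charts Y d -> mopen U ->
  (forall x, U x -> [/\ dom c x, dom d (f x) & N (fwd c x)]) ->
  Cinfty N (fun y => fwd d (f (bwd c y))) -> smooth_on U f.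
Proof.
move=> hc hd oU H CN x Ux; have [cx dfx Nx] := H x Ux.
exists c, d; split=> //; exists (fwd c @` (dom c `&` U)); split.
- exact: oU.
- by exists x.
- by move=> _ [y [cy Uy] <-]; exists y => //; split=> //; have [] := H y Uy.
by apply: Cinfty_sub CN => _ [y [cy Uy] <-]; have [] := H y Uy.
Qed.

Lemma smooth_on_sub (U U' : set X) (f : X -> Y) :
  smooth_on U f -> mopen U' -> U' `<=` U -> smooth_on U' f.
Proof.
move=> sf oU' U'U x U'x.
have [c [d [hc hd cx dfx [N [oN Nx NU CN]]]]] := sf x (U'U _ U'x).
exists c, d; split=> //; exists (N `&` fwd c @` (dom c `&` U')); split.
- by apply: openI => //; exact: oU'.
- by split=> //; exists x.
- move=> z [/NU[y' [[cy' Uy'] dy'] E'] [y [cy U'y] E]].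
  have Eyy : y' = y by rewrite -(fwdK hX hc cy) E -E' fwdK.
  by exists y' => //; split=> //; split=> //; rewrite Eyy.
by apply: Cinfty_sub CN => y [].
Qed.

Lemma smooth_on_eq (U : set X) (f g : X -> Y) :
  smooth_on U f -> (forall x, U x -> f x = g x) -> smooth_on U g.
Proof.
move=> sf fg x Ux.
have [c [d [hc hd cx dfx [N [oN Nx NU CN]]]]] := sf x Ux.
exists c, d; rewrite -fg //; split=> //; exists N; split=> //.
  apply: subset_trans NU _ => _ [y [[cy Uy] dy] <-]; exists y => //.
  by split=> //; rewrite /preimage /= -fg.
apply: Cinfty_eq CN => // y Ny.
by have [y' [[cy Uy] _] <-] := NU y Ny; rewrite fwdK // fg.
Qed.

Lemma smooth_on_preimage (U : set X) (f : X -> Y) (O : set Y) :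
  smooth_on U f -> mopen O -> mopen (U `&` f @^-1` O).
Proof.
move=> sf oO; apply/(mopenP hX) => x [Ux Ofx].
have [c [d [hc hd cx dfx [N [oN Nx NU CN]]]]] := sf x Ux.
exists c, (N `&` (fun y => fwd d (f (bwd c y))) @^-1` (fwd d @` (dom d `&` O))).
split=> //.
- by apply: open_preimage_Cinfty => //; exact: oO.
- by split=> //; rewrite /preimage /= fwdK //; exists (f x).
move=> y [/NU[x' [[cx' Ux'] dfx'] <-]]; rewrite /preimage /= fwdK //.
move=> -[y' [dy' Oy'] E]; exists x' => //; split=> //; split=> //.
by rewrite /= -(fwdK hY hd dfx') -E fwdK.
Qed.

Lemma smooth_on_cst (U : set X) (y : Y) : mopen U -> smooth_on U (fun=> y).
Proof.
move=> oU x Ux; exists (chart_at x), (chart_at y).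
split; [exact: chart_at_charts|exact: chart_at_charts|exact: dom_chart_at|
        exact: dom_chart_at|].
exists (fwd (chart_at x) @` (dom (chart_at x) `&` U)); split.
- by apply: oU; exact: chart_at_charts.
- by exists x => //; split=> //; exact: dom_chart_at.
- move=> _ [x' [h1 h2] <-]; exists x' => //; split=> //.
  exact: dom_chart_at.
exact: Cinfty_cst.
Qed.

Lemma tmap_differentiable (U : set X) (f : X -> Y) x : smooth_on U f -> U x ->
  differentiable (fun y => fwd (chart_at (f x)) (f (bwd (chart_at x) y)))
    (fwd (chart_at x) x).
Proof.
move=> sf Ux.
have [N [oN Nx _ CN]] := smooth_on_charts sf Ux (chart_at_charts hX x)
  (chart_at_charts hY (f x)) (dom_chart_at hX x) (dom_chart_at hY (f x)).
exact: Cinfty_differentiable Nx.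
Qed.

(** [tmap] depends only on the germ at x. This is how a total function that is meaningful only on U
    can be replaced by its formula there. *)
Lemma tmap_eq (U : set X) (f g : X -> Y) x v :
  smooth_on U f -> U x -> (forall x, U x -> f x = g x) ->
  tmap f x v = tmap g x v.
Proof.
move=> sf Ux fg.
have [N [oN Nx NU CN]] := smooth_on_charts sf Ux (chart_at_charts hX x)
  (chart_at_charts hY (f x)) (dom_chart_at hX x) (dom_chart_at hY (f x)).
rewrite /tmap -(fg x Ux).
pose F y := fwd (chart_at (f x)) (f (bwd (chart_at x) y)).
pose G y := fwd (chart_at (f x)) (g (bwd (chart_at x) y)).
have FG : \forall y \near fwd (chart_at x) x, F y = G y.
  apply: near_open oN Nx _ => y /NU[x' [[cx' Ux'] _] <-].
  by rewrite /F /G (fwdK hX (chart_at_charts hX x) cx') (fg x' Ux').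
have [_ E] := diff_near_eq FG (Cinfty_differentiable CN Nx).
exact: (congr1 (@^~ v) (esym E)).
Qed.

Lemma tmap_linear (f : X -> Y) x : linear (tmap f x).
Proof. by move=> a u v; rewrite /tmap linearP. Qed.

End Smooth.

Lemma smooth_on_id n (X : chartedSpace R n) (U : set X) :
  smooth_atlas X -> mopen U -> smooth_on U id.
Proof.
move=> hX oU x Ux; exists (chart_at x), (chart_at x).
split; [exact: chart_at_charts|exact: chart_at_charts|exact: dom_chart_at|
        exact: dom_chart_at|].
exists (fwd (chart_at x) @` (dom (chart_at x) `&` U)); split.
- by apply: oU; exact: chart_at_charts.
- by exists x => //; split=> //; exact: dom_chart_at.
- by move=> _ [x' [h1 h2] <-]; exists x'.
have h := chart_at_charts hX x.
apply: (@Cinfty_eq _ _ _ _ id); first exact: oU.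
  by move=> _ [x' [h1 h2] <-]; rewrite fwdK.
by apply: Cinfty_linear => a u v.
Qed.

(** [fwd] after [bwd] is the identity only on the image of the chart, which is a neighborhood of the
    coordinates of x. *)
Lemma tmap_id n (X : chartedSpace R n) x v :
  smooth_atlas X -> tmap (X := X) (Y := X) id x v = v.
Proof.
move=> hX; have h := chart_at_charts hX x.
rewrite /tmap.
pose F y := fwd (chart_at x) (bwd (chart_at x) y).
have FG : \forall y \near fwd (chart_at x) x, id y = F y.
  apply: near_open (open_fwd_dom hX h) _ _; first exact: imageP (dom_chart_at hX x).
  by move=> y hy; rewrite /F (bwdK hX h hy).
have [_ E] := diff_near_eq FG (ex_diff (is_diff_def := is_diff_id _)).
apply: etrans (congr1 (@^~ v) E) _.
by apply: diff_linear => a u w.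
Qed.

Section Composition.
Context {n p q : nat} {X : chartedSpace R n} {Y : chartedSpace R p}
  {Z : chartedSpace R q}.
Hypotheses (hX : smooth_atlas X) (hY : smooth_atlas Y) (hZ : smooth_atlas Z).

Lemma smooth_on_comp (U : set X) (U' : set Y) (f : X -> Y) (g : Y -> Z) :
  smooth_on U f -> smooth_on U' g -> (forall x, U x -> U' (f x)) ->
  smooth_on U (fun x => g (f x)).
Proof.
move=> sf sg fU x Ux.
have [d [e [hd he dfx egfx [N' [oN' N'x N'U CN']]]]] := sg (f x) (fU x Ux).
have hc := chart_at_charts hX x; have cx := dom_chart_at hX x.
have [N [oN Nx NU CN]] := smooth_on_charts hX hY sf Ux hc hd cx dfx.
exists (chart_at x), e; split=> //.
exists (N `&` (fun y => fwd d (f (bwd (chart_at x) y))) @^-1` N'); split.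
- exact: open_preimage_Cinfty.
- by split=> //; rewrite /preimage /= fwdK.
- move=> y [/NU[x' [[cx' Ux'] dx'] <-]]; rewrite /preimage /= fwdK //.
  move=> /N'U[y' [[dy' U'y'] ey'] E].
  have E' : y' = f x' by rewrite -(fwdK hY hd dx') -E fwdK.
  by exists x' => //; split=> //; rewrite /= -E'.
set N'' := N `&` _.
have oN'' : open N'' by exact: open_preimage_Cinfty.
apply: (@Cinfty_eq _ _ _ _
    (fun y => fwd e (g (bwd d (fwd d (f (bwd (chart_at x) y))))))) => //.
  move=> y [/NU[x' [[cx' Ux'] dx'] <-] _].
  by rewrite (fwdK hX hc cx') (fwdK hY hd dx').
have NN' : N'' `<=` (fun y => fwd d (f (bwd (chart_at x) y))) @^-1` N' by move=> y [].
have CN'' : Cinfty N'' (fun y => fwd d (f (bwd (chart_at x) y))).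
  by apply: Cinfty_sub CN => y [].
exact: (Cinfty_comp oN'' oN' NN' CN'' CN').
Qed.

(** Both factors use [chart_at (f x)] as middle chart. It cancels near x, and the chain rule between
    Euclidean spaces applies. *)
Lemma tmap_comp (U : set X) (U' : set Y) (f : X -> Y) (g : Y -> Z) x v :
  smooth_on U f -> U x -> smooth_on U' g -> U' (f x) ->
  tmap (fun x => g (f x)) x v = tmap g (f x) (tmap f x v).
Proof.
move=> sf Ux sg U'fx.
have hc := chart_at_charts hX x; have cx := dom_chart_at hX x.
have hd := chart_at_charts hY (f x); have dfx := dom_chart_at hY (f x).
have [N [oN Nx NU CN]] := smooth_on_charts hX hY sf Ux hc hd cx dfx.
have df := tmap_differentiable hX hY sf Ux.
have dg := tmap_differentiable hY hZ sg U'fx.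
rewrite /tmap.
pose F y := fwd (chart_at (f x)) (f (bwd (chart_at x) y)).
pose G y := fwd (chart_at (g (f x))) (g (bwd (chart_at (f x)) y)).
pose H y := fwd (chart_at (g (f x))) (g (f (bwd (chart_at x) y))).
have EF : F (fwd (chart_at x) x) = fwd (chart_at (f x)) (f x).
  by rewrite /F (fwdK hX hc cx).
have dG : differentiable G (F (fwd (chart_at x) x)) by rewrite EF.
have GFH : \forall y \near fwd (chart_at x) x, G (F y) = H y.
  apply: near_open oN Nx _ => y /NU[x' [[cx' Ux'] dx'] <-].
  by rewrite /G /F /H (fwdK hX hc cx') (fwdK hY hd dx').
have [_ E] := diff_near_eq GFH (differentiable_comp df dG).
rewrite -/H; apply: etrans (congr1 (@^~ v) E) _.
apply: etrans (diff_chain v df dG) _.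
exact: (congr1 (fun z => 'd G z ('d F (fwd (chart_at x) x) v)) EF).
Qed.

End Composition.

End Atlases.

(** * Euclidean spaces and products as manifolds *)

Section Constructions.
Context {R : realType}.

(** At each order the condition is imposed point by point, so the neighborhoods may vary with the
    point, as they do in [smooth_on]. *)
Lemma Ck_local (V W : normedModType R) k (N : set V) (f : V -> W) :
  (forall x, N x -> exists2 N', N' x & Ck k N' f) -> Ck k N f.
Proof.
elim: k f => [|k IH] f H /=.
  by move=> x /H[N' N'x]; apply.
split; first by move=> x /H[N' N'x [df _]]; exact: df.
by move=> v; apply: IH => x /H[N' N'x [_ Cf]]; exists N' => //; exact: Cf.
Qed.

Lemma Cinfty_local (V W : normedModType R) (N : set V) (f : V -> W) :
  (forall x, N x -> exists2 N', N' x & Cinfty N' f) -> Cinfty N f.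
Proof. by move=> H k; apply: Ck_local => x /H[N' N'x Cf]; exists N' => //; exact: Cf.
    Qed.

Lemma smooth_on_Cinfty n p (X : chartedSpace R n) (Y : chartedSpace R p)
    (U : set X) (f : X -> Y) c d :
  smooth_atlas X -> smooth_atlas Y -> smooth_on U f -> charts X c -> charts Y d ->
  Cinfty (fwd c @` (dom c `&` U `&` f @^-1` dom d))
    (fun y => fwd d (f (bwd c y))).
Proof.
move=> hX hY sf hc hd; apply: Cinfty_local => _ [x [[cx Ux] dfx] <-].
by have [N [_ Nx _ CN]] := smooth_on_charts hX hY sf Ux hc hd cx dfx; exists N.
Qed.

Section Charts.
Context {n : nat} {X : chartedSpace R n}.
Hypothesis hX : smooth_atlas X.

Lemma smooth_atlas_euclid p : smooth_atlas (@euclid R p).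
Proof.
split=> [x|c -> //|c d -> ->]; first by split.
rewrite /= setIid image_id; split; first exact: openT.
by apply: Cinfty_linear => a u v.
Qed.

Lemma mopen_euclid p (N : set (@euclid R p)) : open N -> mopen N.
Proof. by move=> oN c -> /=; rewrite setTI image_id. Qed.

Lemma smooth_on_euclid p q (N : set 'rV[R]_p) (f : 'rV[R]_p -> 'rV[R]_q) :
  open N -> Cinfty N f -> smooth_on (X := euclid p) (Y := euclid q) N f.
Proof.
move=> oN CN; refine (smooth_on_chart_at (X := euclid p) (Y := euclid q)
    (c := euclid_chart p) (d := euclid_chart q) (N := N) _ _ _ _ _) => //.
exact: mopen_euclid.
Qed.

Lemma smooth_on_linear p q (f : 'rV[R]_p -> 'rV[R]_q) :
  linear f -> smooth_on (X := euclid p) (Y := euclid q) setT f.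
Proof. by move=> lf; apply: smooth_on_euclid (Cinfty_linear _ lf); exact: openT. Qed.

Lemma smooth_fwd c : charts X c -> smooth_on (Y := euclid n) (dom c) (fwd c).
Proof.
move=> hc; refine (smooth_on_chart_at (Y := euclid n) (c := c) (d := euclid_chart n)
    (N := fwd c @` dom c) _ _ _ _ _) => //.
  exact: mopen_dom.
apply: (@Cinfty_eq _ _ _ _ id); first exact: open_fwd_dom.
  by move=> y hy; rewrite /= (bwdK hX hc hy).
by apply: Cinfty_linear => a u v.
Qed.

Lemma smooth_bwd c : charts X c ->
  smooth_on (X := euclid n) (fwd c @` dom c) (bwd c).
Proof.
move=> hc; refine (smooth_on_chart_at (X := euclid n) (c := euclid_chart n) (d := c)
    (N := fwd c @` dom c) _ _ _ _ _) => //.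
- by apply: mopen_euclid; exact: open_fwd_dom.
- by move=> y hy; split=> //; exact: (bwd_dom hX hc hy).
apply: (@Cinfty_eq _ _ _ _ id); first exact: open_fwd_dom.
  by move=> y hy; rewrite /= (bwdK hX hc hy).
by apply: Cinfty_linear => a u v.
Qed.

Lemma smooth_row_mx p q (U : set X) (f : X -> 'rV[R]_p) (g : X -> 'rV[R]_q) :
  smooth_on (Y := euclid p) U f -> smooth_on (Y := euclid q) U g ->
  smooth_on (Y := euclid (p + q)) U (fun x => row_mx (f x) (g x)).
Proof.
move=> sf sg x Ux.
have hc := chart_at_charts hX x; have cx := dom_chart_at hX x.
have [N [oN Nx NU CN]] := @smooth_on_charts _ _ _ _ _ hX (smooth_atlas_euclid p)
  _ _ x _ (euclid_chart p) sf Ux hc erefl cx I.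
have [N' [oN' N'x N'U CN']] := @smooth_on_charts _ _ _ _ _ hX (smooth_atlas_euclid q)
  _ _ x _ (euclid_chart q) sg Ux hc erefl cx I.
exists (chart_at x), (euclid_chart (p + q)); split=> //.
exists (N `&` N'); split=> //.
- exact: openI.
- by move=> y [/NU[x' [[cx' Ux'] _] <-] _]; exists x'.
apply: Cinfty_row_mx; first exact: openI.
  by apply: Cinfty_sub CN => y [].
by apply: Cinfty_sub CN' => y [].
Qed.

Lemma smooth_linear_comp p q (U : set X) (f : X -> 'rV[R]_p)
    (L : 'rV[R]_p -> 'rV[R]_q) : linear L ->
  smooth_on (Y := euclid p) U f ->
  smooth_on (Y := euclid q) U (fun x => L (f x)).
Proof.
move=> lL sf.
exact: (smooth_on_comp hX (smooth_atlas_euclid p) sf (smooth_on_linear lL)).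
Qed.

End Charts.

Section Product.
Context {n p : nat} {X : chartedSpace R n} {Y : chartedSpace R p}.
Hypotheses (hX : smooth_atlas X) (hY : smooth_atlas Y).

Lemma lsubmx_linear a b : linear (@lsubmx R 1 a b).
Proof. by move=> k u v; rewrite linearP. Qed.

Lemma rsubmx_linear a b : linear (@rsubmx R 1 a b).
Proof. by move=> k u v; rewrite linearP. Qed.

Lemma open_row_mx a b (A : set 'rV[R]_a) (B : set 'rV[R]_b) :
  open A -> open B -> open [set y : 'rV[R]_(a + b) | A (lsubmx y) /\ B (rsubmx y)].
Proof.
move=> oA oB; apply: openI.
  by apply: open_comp => // y _; exact: continuous_lsubmx.
by apply: open_comp => // y _; exact: continuous_rsubmx.
Qed.

Lemma image_prod_chart (c : chart R n X) (d : chart R p Y) (A : set X) (B : set Y) :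
  fwd (prod_chart c d) @` [set z | A z.1 /\ B z.2]
  = [set y | (fwd c @` A) (lsubmx y) /\ (fwd d @` B) (rsubmx y)].
Proof.
apply/seteqP; split=> [_ [z [Az Bz] <-] /=|y /= [[x Ax ex] [x' Bx' ex']]].
  by rewrite row_mxKl row_mxKr; split; [exists z.1|exists z.2].
by exists (x, x') => //=; rewrite ex ex' hsubmxK.
Qed.

Lemma smooth_atlas_prod : smooth_atlas (prod_mfd X Y).
Proof.
split=> [[x y]|_ [c hc [d hd <-]] [x y] /= [cx dy]|].
- split; last by split; exact: dom_chart_at.
  exists (chart_at x); first exact: chart_at_charts.
  by exists (chart_at y) => //; exact: chart_at_charts.
- by rewrite row_mxKl row_mxKr (fwdK hX hc cx) (fwdK hY hd dy).
move=> _ _ [c hc [d hd <-]] [c' hc' [d' hd' <-]].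
move=> N; have EN : N = [set y | (fwd c @` (dom c `&` dom c')) (lsubmx y) /\
                              (fwd d @` (dom d `&` dom d')) (rsubmx y)].
  rewrite -image_prod_chart /N; congr (_ @` _).
  by apply/seteqP; split=> z /= [[? ?] [? ?]].
have oN : open N.
  by rewrite EN; exact: (open_row_mx (open_transition hX hc hc')
      (open_transition hY hd hd')).
split=> //; apply: Cinfty_row_mx => //.
  apply: (@Cinfty_comp _ _ _ _ N _ lsubmx (fun y => fwd c' (bwd c y)) oN
      (open_transition hX hc hc')).
  - by rewrite EN => y [].
  - exact: Cinfty_linear (@lsubmx_linear _ _).
  - exact: Cinfty_transition.
apply: (@Cinfty_comp _ _ _ _ N _ rsubmx (fun y => fwd d' (bwd d y)) oN
    (open_transition hY hd hd')).
- by rewrite EN => y [].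
- exact: Cinfty_linear (@rsubmx_linear _ _).
- exact: Cinfty_transition.
Qed.

Let hXY := smooth_atlas_prod.

Lemma smooth_fst : smooth_on (X := prod_mfd X Y) setT (fun z => z.1 : X).
Proof.
apply: smooth_on_local => -[x y] _.
have hc := chart_at_charts hX x; have hd := chart_at_charts hY y.
have hcd : charts (prod_mfd X Y) (prod_chart (chart_at x) (chart_at y)).
  by exists (chart_at x) => //; exists (chart_at y).
exists (dom (prod_chart (chart_at x) (chart_at y))); split=> //.
  by split; exact: dom_chart_at.
pose N := fwd (prod_chart (chart_at x) (chart_at y))
  @` dom (prod_chart (chart_at x) (chart_at y)).
refine (smooth_on_chart_at (N := N) hcd hc _ _ _).
- exact: mopen_dom hcd.
- by move=> z hz; split=> //; [case: hz|exists z].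
apply: (@Cinfty_eq _ _ _ _ lsubmx).
- exact: open_fwd_dom hcd.
- by move=> _ [z [cz dz] <-] /=; rewrite row_mxKl (fwdK hX hc cz).
exact: Cinfty_linear (@lsubmx_linear _ _).
Qed.

Lemma smooth_snd : smooth_on (X := prod_mfd X Y) setT (fun z => z.2 : Y).
Proof.
apply: smooth_on_local => -[x y] _.
have hc := chart_at_charts hX x; have hd := chart_at_charts hY y.
have hcd : charts (prod_mfd X Y) (prod_chart (chart_at x) (chart_at y)).
  by exists (chart_at x) => //; exists (chart_at y).
exists (dom (prod_chart (chart_at x) (chart_at y))); split=> //.
  by split; exact: dom_chart_at.
pose N := fwd (prod_chart (chart_at x) (chart_at y))
  @` dom (prod_chart (chart_at x) (chart_at y)).
refine (smooth_on_chart_at (N := N) hcd hd _ _ _).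
- exact: mopen_dom hcd.
- by move=> z hz; split=> //; [case: hz|exists z].
apply: (@Cinfty_eq _ _ _ _ rsubmx).
- exact: open_fwd_dom hcd.
- by move=> _ [z [cz dz] <-] /=; rewrite row_mxKr (fwdK hY hd dz).
exact: Cinfty_linear (@rsubmx_linear _ _).
Qed.

Lemma smooth_pair q (Z : chartedSpace R q) (U : set Z) (f : Z -> X) (g : Z -> Y) :
  smooth_atlas Z -> smooth_on U f -> smooth_on U g ->
  smooth_on (Y := prod_mfd X Y) U (fun z => (f z, g z)).
Proof.
move=> hZ sf sg z Uz.
have hc := chart_at_charts hZ z; have cz := dom_chart_at hZ z.
have hd := chart_at_charts hX (f z); have dfz := dom_chart_at hX (f z).
have he := chart_at_charts hY (g z); have egz := dom_chart_at hY (g z).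
have [N [oN Nx NU CN]] := smooth_on_charts hZ hX sf Uz hc hd cz dfz.
have [N' [oN' N'x N'U CN']] := smooth_on_charts hZ hY sg Uz hc he cz egz.
exists (chart_at z), (prod_chart (chart_at (f z)) (chart_at (g z))).
split=> //; first by exists (chart_at (f z)) => //; exists (chart_at (g z)).
exists (N `&` N'); split=> //.
- exact: openI.
- move=> y [/NU[z' [[cz' Uz'] dz'] <-] /N'U[z'' [[cz'' Uz''] ez''] E]].
  have Ez : z'' = z' by rewrite -(fwdK hZ hc cz') -E (fwdK hZ hc).
  by exists z' => //; split=> //; split=> //; rewrite /= -Ez.
apply: Cinfty_row_mx; first exact: openI.
  by apply: Cinfty_sub CN => y [].
by apply: Cinfty_sub CN' => y [].
Qed.

End Product.
End Constructions.

(** * Vector bundles *)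

Section Bundles.
Context {R : realType}.
Context {n m : nat} {M : chartedSpace R n} {E : bundle m M}.
Hypotheses (hM : smooth_atlas M) (hE : vector_bundle E).

Lemma triv_at_trivs x : trivs (b := E) (triv_at E x).
Proof. by have [/(_ x)[]] := hE. Qed.

Lemma base_triv_at x : base (triv_at E x) x.
Proof. by have [/(_ x)[]] := hE. Qed.

Lemma mopen_base t : trivs (b := E) t -> mopen (base t).
Proof. by have [_ H _ _] := hE; exact: H. Qed.

Lemma tfwdK t x : trivs (b := E) t -> base t x ->
    cancel (@tfwd _ _ _ _ t x) (@tbwd _ _ _ _ t x).
Proof. by move=> ht bx; have [_ _ /(_ t ht x bx)[]] := hE. Qed.

Lemma tbwdK t x : trivs (b := E) t -> base t x ->
    cancel (@tbwd _ _ _ _ t x) (@tfwd _ _ _ _ t x).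
Proof. by move=> ht bx; have [_ _ /(_ t ht x bx)[]] := hE. Qed.

Lemma tfwd_linear t x : trivs (b := E) t -> base t x -> linear (@tfwd _ _ _ _ t x).
Proof. by move=> ht bx; have [_ _ /(_ t ht x bx)[]] := hE. Qed.

Lemma tfwd0 t x : trivs (b := E) t -> base t x -> tfwd t (0 : fib E x) = 0.
Proof.
by move=> ht bx; exact: (linear0 (linear_fun (tfwd_linear ht bx))).
Qed.

Lemma tbwd_linear t x : trivs (b := E) t -> base t x -> linear (@tbwd _ _ _ _ t x).
Proof.
move=> ht bx a u v; apply: (can_inj (tfwdK ht bx)).
by rewrite (tfwd_linear ht bx) !(tbwdK ht bx).
Qed.

Lemma image_bundle_chart c t (A : set M) : trivs (b := E) t -> A `<=` base t ->
  fwd (bundle_chart c t) @` [set z | A (projT1 z)]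
  = [set y | (fwd c @` A) (lsubmx y)].
Proof.
move=> ht Ab; apply/seteqP; split=> [_ [[x e] /= Ax <-]|y /= [x Ax ex]].
  by rewrite row_mxKl; exists x.
exists (existT (fun x => fib E x) x (tbwd t x (rsubmx y))) => //=.
by rewrite ex (tbwdK ht (Ab _ Ax)) hsubmxK.
Qed.

Lemma open_lsubmx a b (A : set 'rV[R]_a) :
  open A -> open [set y : 'rV[R]_(a + b) | A (lsubmx y)].
Proof. by move=> oA; apply: open_comp => // y _; exact: continuous_lsubmx. Qed.

Lemma smooth_atlas_total : smooth_atlas (total_space E).
Proof.
split=> [[x e]|_ [c hc [t ht <-]] [x e] /= [cx bx]|].
- split; last by split; [exact: dom_chart_at|exact: base_triv_at].
  exists (chart_at x); first exact: chart_at_charts.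
  by exists (triv_at E x) => //; exact: triv_at_trivs.
- by rewrite row_mxKl row_mxKr (fwdK hM hc cx) (tfwdK ht bx).
move=> _ _ [c hc [t ht <-]] [c' hc' [t' ht' <-]] N.
pose A := (dom c `&` dom c') `&` (base t `&` base t').
have oA : open (fwd c @` A).
  rewrite /A -setIA.
  exact: (mopenI hM (mopen_dom hM hc') (mopenI hM (mopen_base ht) (mopen_base ht')) hc).
have EN : N = [set y | (fwd c @` A) (lsubmx y)].
  rewrite -(@image_bundle_chart c t) //; last by move=> x [_ []].
  rewrite /N; congr (_ @` _).
  by apply/seteqP; split=> z /=; [move=> [[? ?] [? ?]]|move=> [[? ?] [? ?]]].
have oN : open N by rewrite EN; exact: open_lsubmx.
split=> //; apply: (Cinfty_row_mx oN).
  have NT : N `<=` lsubmx @^-1` (fwd c @` (dom c `&` dom c')).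
    by rewrite EN => y [x [Ax _] ex]; exists x.
  exact: (Cinfty_comp oN (open_transition hM hc hc') NT
    (Cinfty_linear _ (@lsubmx_linear _ _ _)) (Cinfty_transition hM hc hc')).
(* The bundle axioms give smoothness of the fibre transition in x for each fixed v. Joint smoothness
   follows from linearity in v, by expanding v in the standard basis. *)
pose h v x := tfwd t' (tbwd t x v).
apply: (@Cinfty_eq _ _ _ _ (fun y : 'rV[R]_(n + m) =>
    \sum_j (rsubmx y 0 j *: h (delta_mx 0 j) (bwd c (lsubmx y))))) => //.
  rewrite EN => y [x [[cx c'x] [bx b'x]] ex] /=; rewrite -ex (fwdK hM hc cx) /h.
  have lh : linear (fun v => tfwd t' (tbwd t x v)).
    by move=> a u v; rewrite (tbwd_linear ht bx) (tfwd_linear ht' b'x).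
  rewrite [in RHS](row_sum_delta (rsubmx y)) -[RHS]/(linear_fun lh _) linear_sum.
  by apply: eq_bigr => j _; rewrite linearZ.
apply: (Cinfty_sum _ oN) => j.
have Ch : Cinfty N (fun y => h (delta_mx 0 j) (bwd c (lsubmx y))).
  have [_ _ _ /(_ t t' ht ht' (delta_mx 0 j)) sh] := hE.
  have Ch := smooth_on_Cinfty hM (@smooth_atlas_euclid _ m) sh hc erefl.
  have ES : fwd c @` A = fwd c @` (dom c `&` (base t `&` base t') `&`
     (fun x => tfwd t' (tbwd t x (delta_mx 0 j))) @^-1` dom (euclid_chart m)) `&` fwd
         c @` A.
    apply/seteqP; split=> [_ [x [[? ?] [? ?]] <-]|y []//].
    by split; exists x.
  have Ch' : Cinfty (fwd c @` A) (fun y => h (delta_mx 0 j) (bwd c y)).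
    by rewrite ES; apply: Cinfty_sub Ch => y [].
  have NA : N `<=` lsubmx @^-1` (fwd c @` A) by rewrite EN.
  exact: (Cinfty_comp oN oA NA (Cinfty_linear _ (@lsubmx_linear _ _ _)) Ch').
apply: Cinfty_row => // i.
under [X in Cinfty _ X]eq_fun do rewrite !mxE.
apply: Cinfty_mul => //; last exact: Cinfty_coord.
by apply: Cinfty_linear => a u v; rewrite !mxE.
Qed.

Let hT := smooth_atlas_total.

Lemma charts_bundle_chart c t : charts M c -> trivs (b := E) t ->
  charts (total_space E) (bundle_chart c t).
Proof. by move=> hc ht; exists c => //; exists t. Qed.

Lemma smooth_bproj : smooth_on setT (@bproj _ _ _ _ E).
Proof.
apply: smooth_on_local => z _.
pose x := projT1 z; pose C := chart_at (z : total_space E).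
have hC : charts (total_space E) C by exact: chart_at_charts.
exists (dom C); split=> //; first exact: dom_chart_at.
refine (smooth_on_chart_at (c := C) (d := chart_at x) (N := fwd C @` dom C) hC _ _ _ _).
- exact: chart_at_charts.
- exact: mopen_dom hC.
- by move=> w hw; split=> //; case: hw.
apply: (@Cinfty_eq _ _ _ _ lsubmx).
- exact: open_fwd_dom hC.
- by move=> _ [w [cw bw] <-] /=; rewrite row_mxKl /bproj /= (fwdK hM _ cw) //;
    exact: chart_at_charts.
exact: Cinfty_linear (@lsubmx_linear _ _ _).
Qed.

(** Smoothness into a total space splits into smoothness of the base point and of the fibre
    coordinate, the latter asked only where the trivialization is defined. *)
Lemma smooth_into_total p (X : chartedSpace R p) (U : set X) (f : X -> total_space E) :
  smooth_atlas X -> smooth_on U (fun z => bproj (f z)) ->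
  (forall t, trivs (b := E) t ->
     smooth_on (Y := euclid m) (U `&` (fun z => bproj (f z)) @^-1` base t)
       (fun z => tfwd t (projT2 (f z)))) -> smooth_on U f.
Proof.
move=> hX sf st x Ux.
pose y := bproj (f x); pose t := triv_at E y.
have ht : trivs (b := E) t by exact: triv_at_trivs.
have bty : base t y by exact: base_triv_at.
have hc := chart_at_charts hX x; have cx := dom_chart_at hX x.
have hd := chart_at_charts hM y; have dy := dom_chart_at hM y.
have [N [oN Nx NU CN]] := smooth_on_charts hX hM sf Ux hc hd cx dy.
have [N' [oN' N'x N'U CN']] := smooth_on_charts hX (@smooth_atlas_euclid _ m)
   (st t ht) (conj Ux bty) hc erefl cx I.
exists (chart_at x), (bundle_chart (chart_at y) t); split=> //.
  exact: charts_bundle_chart.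
exists (N `&` N'); split=> //.
- exact: openI.
- move=> w [/NU[z [[cz Uz] dz] <-] /N'U[z' [[cz' [Uz' bz']] _] e]].
  have ez : z' = z by rewrite -(fwdK hX hc cz) -e (fwdK hX hc cz').
  by exists z => //; split=> //; split=> //; rewrite -ez.
apply: Cinfty_row_mx; first exact: openI.
  by apply: Cinfty_sub CN => z [].
by apply: Cinfty_sub CN' => z [].
Qed.

Lemma smooth_triv t : trivs (b := E) t ->
  smooth_on (Y := euclid m) (@bproj _ _ _ _ E @^-1` base t)
    (fun z => tfwd t (projT2 z)).
Proof.
move=> ht; apply: smooth_on_local => z btz.
pose x := bproj z; pose C := bundle_chart (chart_at x) t.
have hC : charts (total_space E) C.
  by apply: charts_bundle_chart => //; exact: chart_at_charts.
exists (dom C); split=> //.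
- by split=> //; exact: dom_chart_at.
- by move=> w [].
refine (smooth_on_chart_at (X := total_space E) (Y := euclid m) (c := C)
    (d := euclid_chart m) (N := fwd C @` dom C) hC erefl _ _ _).
- exact: mopen_dom hC.
- by move=> w hw; split=> //; exists w.
apply: (@Cinfty_eq _ _ _ _ rsubmx).
- exact: open_fwd_dom hC.
- by move=> y hy; rewrite -{1}(bwdK hT hC hy) /= row_mxKr.
exact: Cinfty_linear (@rsubmx_linear _ _ _).
Qed.

Lemma smooth_zero_section : smooth_on setT (zero_section E).
Proof.
apply: smooth_into_total => //.
  exact: (smooth_on_id hM (mopenT hM)).
move=> t ht; rewrite setTI.
have s0 := smooth_on_cst hM (@smooth_atlas_euclid _ m) 0 (mopen_base ht).
by apply: (smooth_on_eq hM s0) => x bx; rewrite /= tfwd0.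
Qed.

End Bundles.

(** * Whitney sums *)

Section Whitney.
Context {R : realType}.
Context {n m p : nat} {M : chartedSpace R n} {E : bundle m M} {F : bundle p M}.
Hypotheses (hM : smooth_atlas M) (hE : vector_bundle E) (hF : vector_bundle F).

Lemma vector_bundle_whitney : vector_bundle (whitney_sum E F).
Proof.
split.
- move=> x; split; last by split; [exact: (base_triv_at hE)|exact: (base_triv_at hF)].
  exists (triv_at E x); first exact: (triv_at_trivs hE).
  by exists (triv_at F x) => //; exact: (triv_at_trivs hF).
- move=> _ [s hs [t ht <-]].
  by apply: (mopenI hM); [exact: (mopen_base hE)|exact: (mopen_base hF)].
- move=> _ [s hs [t ht <-]] x [bs bt]; split.
  + move=> k u v /=.
    by rewrite (tfwd_linear hE hs bs) (tfwd_linear hF ht bt) scale_row_mx add_row_mx.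
  + move=> [e e'] /=.
    by rewrite row_mxKl row_mxKr (tfwdK hE hs bs) (tfwdK hF ht bt).
  + move=> y /=; rewrite (tbwdK hE hs bs) (tbwdK hF ht bt); exact: hsubmxK.
move=> _ _ [s hs [t ht <-]] [s' hs' [t' ht' <-]] v /=.
have [_ _ _ /(_ s s' hs hs' (lsubmx v)) se] := hE.
have [_ _ _ /(_ t t' ht ht' (rsubmx v)) sf] := hF.
have oU : mopen (base s `&` base t `&` (base s' `&` base t')).
  by do !apply: (mopenI hM); do ?[exact: (mopen_base hE)|exact: (mopen_base hF)].
apply: (smooth_row_mx hM).
  by refine (smooth_on_sub hM se oU _) => x [[? _] [? _]].
by refine (smooth_on_sub hM sf oU _) => x [[_ ?] [_ ?]].
Qed.

Let hW := vector_bundle_whitney.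

Lemma smooth_wproj1 : smooth_on setT (@wproj1 _ _ _ _ _ E F).
Proof.
refine (smooth_into_total hM hE (f := @wproj1 _ _ _ _ _ E F)
    (smooth_atlas_total hM hW) (smooth_bproj hM hW) _).
move=> t ht; rewrite setTI; apply: smooth_on_local => z bz.
(* A trivialization of the sum also needs one of F, and none needs to exist over all of [base t]. It
   is chosen around each point, hence the local argument. *)
pose u := triv_at F (bproj z).
have hu : trivs (b := F) u by exact: (triv_at_trivs hF).
have htu : trivs (b := whitney_sum E F) (sum_triv t u) by exists t => //; exists u.
exists (@bproj _ _ _ _ (whitney_sum E F) @^-1` base (sum_triv t u)); split.
- by split=> //; exact: (base_triv_at hF).
- by move=> w [].
have := smooth_linear_comp (smooth_atlas_total hM hW) (@lsubmx_linear _ m p)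
    (smooth_triv hM hW htu).
by under eq_fun do rewrite /= row_mxKl.
Qed.

Lemma smooth_wproj2 : smooth_on setT (@wproj2 _ _ _ _ _ E F).
Proof.
refine (smooth_into_total hM hF (f := @wproj2 _ _ _ _ _ E F)
    (smooth_atlas_total hM hW) (smooth_bproj hM hW) _).
move=> t ht; rewrite setTI; apply: smooth_on_local => z bz.
pose u := triv_at E (bproj z).
have hu : trivs (b := E) u by exact: (triv_at_trivs hE).
have htu : trivs (b := whitney_sum E F) (sum_triv u t) by exists u => //; exists t.
exists (@bproj _ _ _ _ (whitney_sum E F) @^-1` base (sum_triv u t)); split.
- by split=> //; exact: (base_triv_at hE).
- by move=> w [].
have := smooth_linear_comp (smooth_atlas_total hM hW) (@rsubmx_linear _ m p)
    (smooth_triv hM hW htu).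
by under eq_fun do rewrite /= row_mxKr.
Qed.

End Whitney.

(** * The cotangent bundle *)

Section Cotangent.
Context {R : realType} {n : nat} {M : chartedSpace R n}.
Hypothesis hM : smooth_atlas M.

Lemma tbwd_tfwd_chart c (x : M) v : charts M c -> dom c x ->
  tbwd_chart c (fwd c x) (tfwd_chart c x v) = v.
Proof.
move=> hc cx.
have sf := smooth_fwd hM hc; have sb := smooth_bwd hM hc.
rewrite /tbwd_chart /tfwd_chart.
rewrite -(tmap_comp hM (@smooth_atlas_euclid _ n) hM v sf cx sb); last by exists x.
rewrite -[RHS](tmap_id x v hM); apply/esym.
apply: (tmap_eq hM hM v (smooth_on_id hM (mopen_dom hM hc)) cx).
by move=> y cy; rewrite (fwdK hM hc cy).
Qed.

(** This replaces preferred charts, hidden in [tfwd_chart] and [tbwd_chart], by the differential of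
    a transition map, whose smooth dependence on y is known. *)
Lemma tfwd_tbwd_transition c d (y v : 'rV[R]_n) : charts M c -> charts M d ->
  (fwd d @` (dom d `&` dom c)) y ->
  tfwd_chart c (bwd d y) (tbwd_chart d y v) = 'd (fun y => fwd c (bwd d y)) y v.
Proof.
move=> hc hd [x [dx cx] ex].
have sf := smooth_fwd hM hc; have sb := smooth_bwd hM hd.
rewrite /tbwd_chart /tfwd_chart.
rewrite -(tmap_comp (@smooth_atlas_euclid _ n) hM (@smooth_atlas_euclid _ n) v sb _
    sf) //.
  by exists x.
by rewrite -ex (fwdK hM hd dx).
Qed.

Lemma tfwd_tbwd_chart c (x : M) v : charts M c -> dom c x ->
  tfwd_chart c x (tbwd_chart c (fwd c x) v) = v.
Proof.
move=> hc cx.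
have sf := smooth_fwd hM hc; have sb := smooth_bwd hM hc.
have hy : (fwd c @` dom c) (fwd c x) by exists x.
have := tmap_comp (@smooth_atlas_euclid _ n) hM (@smooth_atlas_euclid _ n) v sb hy sf.
rewrite /tbwd_chart /tfwd_chart (fwdK hM hc cx) => <- //.
have hE := @smooth_atlas_euclid R n.
have oN : mopen (X := euclid n) (fwd c @` dom c) by apply: mopen_euclid;
    exact: (open_fwd_dom hM).
rewrite -[RHS](tmap_id (X := euclid n) (fwd c x) v hE); apply/esym.
apply: (tmap_eq (X := euclid n) (Y := euclid n) hE hE v (smooth_on_id hE oN) hy).
by move=> y cy; rewrite (bwdK hM hc cy).
Qed.

Lemma tfwd_chart_linear c (x : M) : linear (tfwd_chart c x).
Proof. exact: tmap_linear. Qed.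

Lemma tbwd_chart_linear (c : chart R n M) y : linear (tbwd_chart c y).
Proof. exact: (tmap_linear (X := euclid n)). Qed.

(** [linfun] evaluates to the given function only when that function is linear; here it is, because
    [tfwd_chart] is. *)
Lemma cotangent_tbwdE (c : chart R n M) x (eta v : 'rV[R]_n) :
  (tbwd (cotangent_triv c) x eta : 'Hom('rV[R]_n, R^o)) v
    = \sum_i eta 0 i * tfwd_chart c x v 0 i.
Proof.
have lh : linear (fun v => \sum_i eta 0 i * tfwd_chart c x v 0 i : R^o).
  move=> a u w; rewrite scaler_sumr -big_split /=; apply: eq_bigr => i _.
  rewrite (tfwd_chart_linear c x a u w) !mxE mulrDr; congr (_ + _).
  by rewrite mulrCA.
by rewrite /= (lfunE (linear_fun lh)).
Qed.

Lemma vector_bundle_cotangent : vector_bundle (cotangent M).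
Proof.
have hE := @smooth_atlas_euclid R n.
split.
- move=> x; split; last exact: (dom_chart_at hM).
  by exists (chart_at x) => //; exact: (chart_at_charts hM).
- by move=> _ [c hc <-]; exact: (mopen_dom hM).
- move=> _ [c hc <-] x cx; split.
  + move=> k u v /=; apply/rowP => i; rewrite !mxE.
    by rewrite add_lfunE scale_lfunE.
  + move=> xi; apply/lfunP => v; rewrite cotangent_tbwdE /=.
    under eq_bigr do rewrite mxE.
    rewrite -[in RHS](tbwd_tfwd_chart v hc cx).
    have lh := tbwd_chart_linear c (fwd c x).
    rewrite [in RHS](row_sum_delta (tfwd_chart c x v)).
    rewrite -[tbwd_chart _ _]/(linear_fun lh : _ -> _) !linear_sum.
    by apply: eq_bigr => i _; rewrite !linearZ /= mulrC.
  + move=> y /=; apply/rowP => i; rewrite mxE cotangent_tbwdE.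
    rewrite (bigD1 i) //= tfwd_tbwd_chart // mxE !eqxx mulr1.
    rewrite big1 ?addr0 // => j ji; rewrite mxE.
    by rewrite (negbTE ji) andbF mulr0.
move=> _ _ [c hc <-] [d hd <-] eta.
rewrite [X in smooth_on X]/=.
pose N := fwd d @` (dom d `&` dom c).
have oN : open N by exact: (open_transition hM).
have CT := Cinfty_transition hM hd hc.
(* Covectors change coordinates by the transpose of the Jacobian of the transition from d to c. Here
   it is applied to the fixed [eta], as a function of the d-coordinates y of the base point. *)
pose h (y : 'rV[R]_n) : 'rV[R]_n :=
  \row_i (\sum_j eta 0 j * ('d (fun y => fwd c (bwd d y)) y (delta_mx 0 i)) 0 j).
have Ch : Cinfty N h.
  apply: Cinfty_row => // i.
  apply: (@Cinfty_eq _ _ _ _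
      (fun y => \sum_j eta 0 j * ('d (fun y => fwd c (bwd d y)) y (delta_mx 0 i)) 0 j
      : R^o)) => //.
    by move=> y _; rewrite mxE.
  apply: (Cinfty_sum _ oN) => j; apply: Cinfty_mul => //; first exact: Cinfty_cst.
  by apply: Cinfty_coord => //; exact: Cinfty_diff.
have oU : mopen (dom c `&` dom d) by apply: (mopenI hM); exact: (mopen_dom hM).
have sd : smooth_on (Y := euclid n) (dom c `&` dom d) (fwd d).
  by refine (smooth_on_sub hM (smooth_fwd hM hd) oU _) => x [].
have sh := smooth_on_euclid oN Ch.
have := smooth_on_comp hM hE sd sh.
move=> /(_ (fun x (xU : (dom c `&` dom d) x) => ex_intro2 _ _ x (conj xU.2 xU.1)
    erefl)) shd.
apply: (smooth_on_eq hM shd) => x [cx dx].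
apply/rowP => i; rewrite !mxE cotangent_tbwdE; apply: eq_bigr => j _.
have := tfwd_tbwd_transition (delta_mx 0 i) hc hd (y := fwd d x).
by rewrite (fwdK hM hd dx) => <- //; exists x.
Qed.

End Cotangent.

(** * Separation and countability for total spaces *)

Section Topology.
Context {R : realType}.

(** Balls with rational centres and radii 1/(j+1), enumerated through [pickle]. A radius below e/2
    keeps a ball that contains x inside the ball of radius e around x, by the triangle
    inequality. *)
Lemma rV_countable_basis k : exists B : nat -> set 'rV[R]_k,
  (forall i, open (B i)) /\
  (forall U x, open U -> U x -> exists i, B i x /\ B i `<=` U).
Proof.
pose b (p : 'rV[rat]_k * nat) : set 'rV[R]_k :=
  ball (map_mx ratr p.1 : 'rV[R]_k) (p.2.+1%:R^-1).
exists (fun i => if unpickle i is Some p then b p else set0); split.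
  by move=> i; case: unpickle => [p|]; [exact: ball_open|exact: open0].
move=> U x oU Ux.
have /nbhs_ballP[e e0 eU] := open_nbhs_nbhs (conj oU Ux).
have e20 : 0 < e / 2 by rewrite divr_gt0.
have [j je] : exists j : nat, j.+1%:R^-1 < e / 2.
  exists (Num.truncn (e / 2)^-1).
  by rewrite invf_plt ?posrE // truncnS_gt.
have j0 : 0 < j.+1%:R^-1 :> R by rewrite invr_gt0.
have /choice[q hq] : forall i : 'I_k, exists q : rat, `|ratr q - x 0 i| < j.+1%:R^-1.
  move=> i; have xx : x 0 i - j.+1%:R^-1 < x 0 i + j.+1%:R^-1.
    by rewrite ltrBlDr -addrA ltrDl addr_gt0.
  have [q] := rat_in_itvoo xx; rewrite in_itv /= => /andP[q1 q2]; exists q.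
  by rewrite ltr_norml ltrBrDr ltrBlDr [- _ + _]addrC q1 /= addrC.
exists (pickle (\row_i q i, j)); rewrite pickleK.
have bx : b (\row_i q i, j) x.
  rewrite /b -ball_normE /ball_ /= [X in X < _]/Num.norm /= mx_normrE.
  by apply/bigmax_ltP; split=> // -[a i] _ /=; rewrite !mxE (ord1 a).
split=> // y yb; apply: eU; have := ball_triangle (ball_sym bx) yb.
by apply: le_ball; rewrite (splitr e) lerD // ltW.
Qed.

Context {n m : nat} {M : chartedSpace R n} {E : bundle m M}.
Hypotheses (hM : smooth_manifold M) (hE : vector_bundle E).

Lemma smooth_manifold_total : smooth_manifold (total_space E).
Proof.
have hA := smooth_manifold_atlas hM.
have hT := smooth_atlas_total hA hE.
have [_ _ _ hausM [BM [oBM bBM]]] := hM.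
have [hT1 hT2 hT3] := hT; split=> //.
- move=> [x e] [x' e'] ne.
  (* Distinct base points are separated by open sets pulled back from M; two points of one fibre are
     separated by their fibre coordinates. *)
  have [exx|nxx] := pselect (x = x'); last first.
    have [U [V [oU oV Ux Vx UV]]] := hausM x x' nxx.
    exists (@bproj _ _ _ _ E @^-1` U), (@bproj _ _ _ _ E @^-1` V); split=> //.
    + rewrite -[_ @^-1` _]setTI.
      exact: (smooth_on_preimage hT hA (smooth_bproj hA hE) oU).
    + rewrite -[_ @^-1` _]setTI.
      exact: (smooth_on_preimage hT hA (smooth_bproj hA hE) oV).
    by rewrite -preimage_setI UV preimage_set0.
  subst x'; pose t := triv_at E x.
  have ht : trivs (b := E) t := triv_at_trivs hE x.
  have bx : base t x := base_triv_at hE x.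
  have nee : tfwd t e != tfwd t e'.
    apply/eqP => /(can_inj (tfwdK hE ht bx)) eee; by rewrite eee in ne.
  have st := smooth_triv hA hE ht.
  have := @norm_hausdorff R 'rV[R]_m; rewrite open_hausdorff.
  move=> /(_ _ _ nee)[[A B] /=]; rewrite !inE => -[Ae Be'] [oA oB AB].
  exists (@bproj _ _ _ _ E @^-1` base t `&` (fun z => tfwd t (projT2 z)) @^-1` A).
  exists (@bproj _ _ _ _ E @^-1` base t `&` (fun z => tfwd t (projT2 z)) @^-1` B).
  split=> //.
  + exact: (smooth_on_preimage hT (@smooth_atlas_euclid _ m) st (mopen_euclid oA)).
  + exact: (smooth_on_preimage hT (@smooth_atlas_euclid _ m) st (mopen_euclid oB)).
  apply/seteqP; split=> // z [[_ Az] [_ Bz]].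
  have : (A `&` B) (tfwd t (projT2 z)) by split.
  by case/seteqP: AB => AB _ /AB.
(* One trivializing chart over each member of a countable basis of M. *)
have [BV [oBV bBV]] := rV_countable_basis (n + m).
pose good i (C : chart R (n + m) (total_space E)) := exists c t,
  [/\ charts M c, trivs (b := E) t, BM i `<=` dom c `&` base t & C = bundle_chart c t].
pose B k := if unpickle k is Some (i, j) then
    if pselect (exists C, good i C) is left H then
      dom (projT1 (cid H)) `&` fwd (projT1 (cid H)) @^-1` BV j else set0
  else set0 : set (total_space E).
have o0 : mopen (set0 : set (total_space E)).
  by move=> c hc; rewrite setI0 image_set0; exact: open0.
exists B; split.
  move=> k; rewrite /B; case: unpickle => [[i j]|//].
  case: pselect => // H; case: (cid H) => C gC /=; have [c [t [hc ht _ ->]]] := gC.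
  exact: (mopen_fwd_preimage hT (charts_bundle_chart hc ht) (oBV j)).
move=> U [x e] oU Uz.
pose c0 := chart_at x; pose t0 := triv_at E x.
have oct : mopen (dom c0 `&` base t0).
  apply: (mopenI hA); first exact: (mopen_dom hA (chart_at_charts hA x)).
  exact: (mopen_base hE (triv_at_trivs hE x)).
have [|i [Bx BU]] := bBM _ x oct.
  by split; [exact: (dom_chart_at hA)|exact: (base_triv_at hE)].
have H0 : exists C, good i C.
  exists (bundle_chart c0 t0), c0, t0; split=> //.
    exact: (chart_at_charts hA).
  exact: (triv_at_trivs hE).
have [C EC [hC gC]] : exists2 C, C = projT1 (cid H0) & charts (total_space E) C /\
    good i C.
  case: (cid H0) => C gC /=; exists C => //; split=> //.
  by case: gC => c [t [hc ht _ ->]]; exact: charts_bundle_chart.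
(* The chart selected for i need not be the preferred one at x. Any good chart will do, since its
   base contains [BM i] and hence x. *)
have Cz : dom C (existT _ x e).
  by case: gC => c [t [hc ht Bct ->]]; exact: (Bct x Bx).
have [||j [Bj BjU]] := bBV (fwd C @` (dom C `&` U)) (fwd C (existT _ x e)).
- exact: oU.
- by exists (existT _ x e).
exists (pickle (i, j)); rewrite /B pickleK.
(* The selected chart depends formally on the existence proof; identifying the two proofs identifies
   the charts. *)
case: pselect => // H; have -> : H = H0 by exact: Prop_irrelevance.
rewrite -EC; split=> // w [Cw /BjU[w' [Cw' Uw'] ew]].
by rewrite -(fwdK hT hC Cw) -ew (fwdK hT hC Cw').
Qed.

End Topology.

(** * Differential forms *)

Section Forms.
Context {R : realType}.

Lemma local_pullback_Cinfty n p (N : set 'rV[R]_n) (N' : set 'rV[R]_p)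
    (F : 'rV[R]_n -> 'rV[R]_p) (A : 'rV[R]_p -> 'rV[R]_p -> R^o) w :
  open N -> N `<=` F @^-1` N' -> Cinfty N F ->
  (forall y, N' y -> linear_form (A ^~ y)) -> (forall w, Cinfty N' (A w)) ->
  Cinfty N (fun y => A ('d F y w) (F y) : R^o).
Proof.
move=> oN FN CF lA CA.
apply: (@Cinfty_eq _ _ _ _
    (fun y => \sum_i 'd F y w 0 i * A (delta_mx 0 i) (F y) : R^o)) => //.
  by move=> y Ny; rewrite (linear_form_sum ('d F y w) (lA _ (FN _ Ny))).
apply: (Cinfty_sum _ oN) => i; apply: (Cinfty_mul oN).
  by apply: Cinfty_coord => //; exact: Cinfty_diff.
exact: Cinfty_comp_scalar oN FN CF (CA _).
Qed.

Lemma diff_scale_add (V : normedModType R) (f g h : V -> R^o) (k : R) x v :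
  differentiable f x -> differentiable g x ->
  (forall y, h y = k * f y + g y) -> 'd h x v = k * 'd f x v + 'd g x v.
Proof.
move=> df dg hE.
have -> : h = (k *: f : V -> R^o) + g by rewrite funeqE => y; rewrite hE.
have dkf : differentiable (k *: f : V -> R^o) x by exact: differentiableZ.
apply: etrans (congr1 (@^~ v) (diffD dkf dg)) _.
exact: (congr1 (fun t : V -> R^o => t v + 'd g x v) (diffZ k df)).
Qed.

Section OneForm.
Context {n : nat} {X : chartedSpace R n}.
Hypothesis hX : smooth_atlas X.

Lemma coef1_linear c (a : form1 X) y : smooth_form1 a ->
  linear_form (fun v => coef1 c a v y).
Proof.
by move=> [la _] k u v; rewrite /coef1 (tbwd_chart_linear c y k u v) la.
Qed.

Lemma coef1_near (a b : form1 X) (U : set X) x c v : mopen U -> U x ->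
  charts X c -> dom c x -> (forall y w, U y -> a y w = b y w) ->
  \forall y \near fwd c x, coef1 c a v y = coef1 c b v y.
Proof.
move=> oU Ux hc cx ab; apply: near_open (oU c hc) _ _; first by exists x.
by move=> _ [y [cy Uy] <-]; rewrite /coef1 ab // (fwdK hX hc cy).
Qed.

Lemma ext_d1_eq (a b : form1 X) (U : set X) x u v : mopen U -> U x ->
  (forall y w, U y -> a y w = b y w) -> ext_d1 a x u v = ext_d1 b x u v.
Proof.
move=> oU Ux ab.
have hc := chart_at_charts hX x; have cx := dom_chart_at hX x.
rewrite /ext_d1; congr (_ - _); apply: near_eq_derive.
  exact: (coef1_near v oU Ux hc cx ab).
exact: (coef1_near u oU Ux hc cx ab).
Qed.

Lemma coef1_derivable c (a : form1 X) x u v : smooth_form1 a -> charts X c ->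
  dom c x -> derivable (coef1 c a u) (fwd c x) v.
Proof.
move=> [_ sa] hc cx; apply: Cinfty_derivable (sa c hc u) _.
by exists x.
Qed.

Lemma ext_d1_sub (a b : form1 X) x u v : smooth_form1 a -> smooth_form1 b ->
  ext_d1 (fun z w => a z w - b z w) x u v = ext_d1 a x u v - ext_d1 b x u v.
Proof.
move=> sa sb.
have hc := chart_at_charts hX x; have cx := dom_chart_at hX x.
have D w z : 'D_w (coef1 (chart_at x) (fun z w => a z w - b z w) z) (fwd (chart_at x) x)
    = 'D_w (coef1 (chart_at x) a z) (fwd (chart_at x) x)
      - 'D_w (coef1 (chart_at x) b z) (fwd (chart_at x) x).
  have -> : coef1 (chart_at x) (fun z w => a z w - b z w) z
      = coef1 (chart_at x) a z - coef1 (chart_at x) b z by [].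
  exact: (deriveB (coef1_derivable (u := z) (v := w) sa hc cx)
      (coef1_derivable (u := z) (v := w) sb hc cx)).
by rewrite /ext_d1 !D; ring.
Qed.

End OneForm.

(** * Naturality of the exterior derivative on manifolds *)

Section Pullback.
Context {n p : nat} {X : chartedSpace R n} {Y : chartedSpace R p}.
Hypotheses (hX : smooth_atlas X) (hY : smooth_atlas Y).
Variables (U : set X) (f : X -> Y) (a : form1 Y).
Hypothesis (sf : smooth_on U f).

(** On the chart image f composed with [bwd c] equals [bwd d] composed with F. The chain rule on
    both sides removes the preferred charts and leaves a pullback between Euclidean spaces. *)
Lemma coef1_pull c d v y : charts X c -> charts Y d ->
  (fwd c @` (dom c `&` U `&` f @^-1` dom d)) y ->
  let F y := fwd d (f (bwd c y)) in
  coef1 c (pull1 f a) v y = coef1 d a ('d F y v) (F y).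
Proof.
move=> hc hd [x [[cx Ux] dfx] ex] F.
have hE k := @smooth_atlas_euclid R k.
pose N := fwd c @` (dom c `&` U `&` f @^-1` dom d).
have oU := smooth_on_mopen hX sf.
have oV : mopen (U `&` f @^-1` dom d) := smooth_on_preimage hX hY sf (mopen_dom hY hd).
have oN : open N by rewrite /N -setIA; exact: oV.
have Ny : N y by exists x.
have CF : Cinfty N F := smooth_on_Cinfty hX hY sf hc hd.
have sF := smooth_on_euclid oN CF.
have bx : bwd c y = x by rewrite -ex (fwdK hX hc cx).
rewrite /coef1 /pull1 bx /F bx (fwdK hY hd dfx); congr (a _ _).
rewrite -{1}bx /tbwd_chart.
have sbc : smooth_on (X := euclid n) N (bwd c).
  apply: (smooth_on_sub (hE n) (smooth_bwd hX hc) (mopen_euclid oN)).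
  by move=> _ [z [[cz _] _] <-]; exists z.
have bU : forall y, N y -> U (bwd c y).
  by move=> _ [z [[cz Uz] _] <-]; rewrite (fwdK hX hc cz).
rewrite -(tmap_comp (X := euclid n) (hE n) hX hY v sbc Ny sf (bU y Ny)).
have FN : forall y, N y -> (fwd d @` dom d) (F y).
  by move=> _ [z [[cz Uz] dz] <-]; rewrite /F (fwdK hX hc cz); exists (f z).
have sfb : smooth_on (X := euclid n) N (fun y => f (bwd c y)).
  exact: (smooth_on_comp (X := euclid n) (hE n) hX sbc sf bU).
rewrite (tmap_eq (X := euclid n) (hE n) hY v sfb Ny (g := fun y => bwd d (F y)));
    last first.
  by move=> _ [z [[cz Uz] dz] <-]; rewrite /F (fwdK hX hc cz) (fwdK hY hd dz).
rewrite (tmap_comp (X := euclid n) (Y := euclid p) (hE n) (hE p) hY v sF Ny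
    (smooth_bwd hY hd) (FN y Ny)).
by rewrite {1}/F bx.
Qed.

Hypothesis sa : smooth_form1 a.

Lemma coef1_pull_Cinfty c d v : charts X c -> charts Y d ->
  Cinfty (fwd c @` (dom c `&` U `&` f @^-1` dom d)) (coef1 c (pull1 f a) v).
Proof.
move=> hc hd; set N := fwd c @` _.
have oV : mopen (U `&` f @^-1` dom d) := smooth_on_preimage hX hY sf (mopen_dom hY hd).
have oN : open N by rewrite /N -setIA; exact: oV.
pose F y := fwd d (f (bwd c y)).
apply: (@Cinfty_eq _ _ _ _ (fun y => coef1 d a ('d F y v) (F y) : R^o)) => //.
  by move=> y Ny; rewrite (coef1_pull v hc hd Ny).
have FN : N `<=` F @^-1` (fwd d @` dom d).
  by move=> _ [z [[cz Uz] dz] <-]; rewrite /preimage /F /= (fwdK hX hc cz);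
      exists (f z).
apply: (local_pullback_Cinfty v oN FN (A := coef1 d a)).
- exact: (smooth_on_Cinfty hX hY sf hc hd).
- by move=> y _; exact: coef1_linear.
- by move=> w; have [_] := sa; apply.
Qed.

(** With the preferred charts at x and f x, [tmap f x] is by definition the differential of F, so
    the coordinate statement [local_ext_d_pullback] is the claim once the coefficients are
    identified near x. *)
Lemma ext_d1_pull x u v : U x ->
  ext_d1 (pull1 f a) x u v = ext_d1 a (f x) (tmap f x u) (tmap f x v).
Proof.
move=> Ux.
have hc := chart_at_charts hX x; have cx := dom_chart_at hX x.
have hd := chart_at_charts hY (f x); have dx := dom_chart_at hY (f x).
set c := chart_at x in hc cx *; set d := chart_at (f x) in hd dx *.
pose N := fwd c @` (dom c `&` U `&` f @^-1` dom d).
have oV : mopen (U `&` f @^-1` dom d) := smooth_on_preimage hX hY sf (mopen_dom hY hd).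
have oN : open N by rewrite /N -setIA; exact: oV.
have Nx : N (fwd c x) by exists x.
pose F y := fwd d (f (bwd c y)).
have FN : N `<=` F @^-1` (fwd d @` dom d).
  by move=> _ [z [[cz Uz] dz] <-]; rewrite /preimage /F /= (fwdK hX hc cz);
      exists (f z).
have := @local_ext_d_pullback _ _ _ N (fwd d @` dom d) F (coef1 d a) (fwd c x) u v
  oN (open_fwd_dom hY hd) FN (smooth_on_Cinfty hX hY sf hc hd)
  (fun y _ => coef1_linear d y sa) (fun w => sa.2 d hd w) Nx.
have Fx : F (fwd c x) = fwd d (f x) by rewrite /F (fwdK hX hc cx).
have near w : \forall y \near fwd c x, coef1 c (pull1 f a) w y =
    coef1 d a ('d F y w) (F y).
  by apply: near_open oN Nx _ => y Ny; exact: (coef1_pull w hc hd Ny).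
rewrite Fx => E; apply: etrans E; rewrite /ext_d1 -/c.
congr (_ - _); apply: near_eq_derive.
  exact: near.
exact: near.
Qed.

End Pullback.

Lemma smooth_form1_pull n p (X : chartedSpace R n) (Y : chartedSpace R p)
    (f : X -> Y) (a : form1 Y) : smooth_atlas X -> smooth_atlas Y ->
  smooth_on setT f -> smooth_form1 a -> smooth_form1 (pull1 f a).
Proof.
move=> hX hY sf sa; split.
  move=> x k u v; rewrite /pull1 (tmap_linear f x k u v); exact: sa.1.
move=> c hc v; apply: Cinfty_local => _ [x cx <-].
exists (fwd c @` (dom c `&` setT `&` f @^-1` dom (chart_at (f x)))).
  by exists x => //; split=> //; exact: dom_chart_at.
exact: (coef1_pull_Cinfty hX hY sf sa v hc (chart_at_charts hY (f x))).
Qed.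

(** * Exact 2-forms *)

Section Exact.
Context {n : nat} {X : chartedSpace R n}.
Hypothesis hX : smooth_atlas X.
Variable a : form1 X.
Hypothesis sa : smooth_form1 a.

(** Independence of the chart: this is naturality of d along [bwd c], seen as a map from Euclidean
    space, where d is the plain coordinate formula. *)
Lemma coef2_ext_d1 c u v y : charts X c -> (fwd c @` dom c) y ->
  coef2 c (ext_d1 a) u v y = 'D_u (coef1 c a v) y - 'D_v (coef1 c a u) y.
Proof.
move=> hc hy; have hE := @smooth_atlas_euclid R n.
rewrite /coef2 /tbwd_chart.
rewrite -(ext_d1_pull (X := euclid n) hE hX (smooth_bwd hX hc) sa u v hy).
have E w : coef1 (X := euclid n) (euclid_chart n) (pull1 (X := euclid n) (bwd c) a) w
    = coef1 c a w.
  rewrite funeqE => z; rewrite /coef1 /pull1 /tbwd_chart /=; congr (a _ (tmap _ _ _)).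
  exact: (tmap_id (X := euclid n) z w hE).
by rewrite /ext_d1 /= !E.
Qed.

Lemma coef2_ext_d1_diff c u v y : charts X c -> (fwd c @` dom c) y ->
  coef2 c (ext_d1 a) u v y = 'd (coef1 c a v) y u - 'd (coef1 c a u) y v.
Proof.
move=> hc hy; rewrite coef2_ext_d1 //.
have d w := Cinfty_differentiable (sa.2 c hc w) hy.
by rewrite (deriveE _ (d v)) (deriveE _ (d u)).
Qed.

Lemma ext_d1E x u v : let c := chart_at x in
  ext_d1 a x u v = 'd (coef1 c a v) (fwd c x) u - 'd (coef1 c a u) (fwd c x) v.
Proof.
move=> c; have hc := chart_at_charts hX x; have cx := dom_chart_at hX x.
have d w := Cinfty_differentiable (sa.2 c hc w) (imageP _ cx).
by rewrite /ext_d1 (deriveE _ (d v)) (deriveE _ (d u)).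
Qed.

Lemma ext_d1_linear_l x v : linear_form (fun u => ext_d1 a x u v).
Proof.
move=> k u u'; rewrite !ext_d1E /=; set c := chart_at x; set y := fwd c x.
have hc := chart_at_charts hX x; have cx := dom_chart_at hX x.
have d w := Cinfty_differentiable (sa.2 c hc w) (imageP _ cx).
have E z : coef1 c a (k *: u + u') z = k * coef1 c a u z + coef1 c a u' z.
  exact: (coef1_linear c z sa k u u').
have E1 := diff_scale_add v (d u) (d u') E.
have E2 : 'd (coef1 c a v) y (k *: u + u')
    = k * 'd (coef1 c a v) y u + 'd (coef1 c a v) y u' := linearP _ _ _ _.
have alg (p q r s : R) : (k * p + q) - (k * r + s) = k * (p - r) + (q - s) by ring.
exact: (etrans (congr2 (fun s t => s - t) E2 E1) (alg _ _ _ _)).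
Qed.

Lemma ext_d1_antisym x u v : ext_d1 a x u v = - ext_d1 a x v u.
Proof. by rewrite !ext_d1E opprB. Qed.

Lemma smooth_form2_ext_d1 (U : set X) : mopen U -> smooth_form2_on U (ext_d1 a).
Proof.
move=> oU; split.
  move=> x Ux; split.
  - move=> u k v v'; rewrite ext_d1_antisym (ext_d1_linear_l x u) opprD.
    by rewrite (ext_d1_antisym _ u v) (ext_d1_antisym _ u v') mulrN.
  - by move=> v; exact: ext_d1_linear_l.
  - by move=> u; rewrite ext_d1E subrr.
move=> c hc u v; apply: (@Cinfty_sub _ _ _ (fwd c @` dom c)).
  by move=> _ [x [cx _] <-]; exists x.
have oN := open_fwd_dom hX hc.
apply: (@Cinfty_eq _ _ _ _
    (fun y => 'd (coef1 c a v) y u + - 1 * 'd (coef1 c a u) y v : R^o)) => //.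
  by move=> y hy; rewrite (coef2_ext_d1_diff _ _ hc hy) mulN1r.
apply: (Cinfty_add oN); first exact: (Cinfty_diff _ (sa.2 c hc v)).
apply: (Cinfty_mul oN); first exact: Cinfty_cst.
exact: (Cinfty_diff _ (sa.2 c hc u)).
Qed.

Lemma closed_form2_ext_d1 (U : set X) : closed_form2_on U (ext_d1 a).
Proof.
move=> x Ux u v t c y.
have hc : charts X c := chart_at_charts hX x; have cx : dom c x := dom_chart_at hX x.
have oN := open_fwd_dom hX hc; have Ny : (fwd c @` dom c) y by exists x.
have sc w := sa.2 c hc w.
(* H w1 w2 w3 is the second derivative, along w2 and w1, of the coefficient of the form on w3. Its
   symmetry in the first two arguments cancels the six terms of the cyclic sum. *)
have [H [HD Hs]] : exists H : 'rV[R]_n -> 'rV[R]_n -> 'rV[R]_n -> R,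
    (forall w1 w2 w3, 'D_w1 (coef2 c (ext_d1 a) w2 w3) y = H w1 w2 w3 - H w1 w3 w2)
    /\ (forall w1 w2 w3, H w1 w2 w3 = H w2 w1 w3).
  exists (fun w1 w2 w3 => 'd (fun z => 'd (coef1 c a w3) z w2 : R^o) y w1); split.
    move=> w1 w2 w3.
    have d1 := Cinfty_differentiable (Cinfty_diff w2 (sc w3)) Ny.
    have d2 := Cinfty_differentiable (Cinfty_diff w3 (sc w2)) Ny.
    have -> : 'D_w1 (coef2 c (ext_d1 a) w2 w3) y
        = 'D_w1 ((fun z => 'd (coef1 c a w3) z w2 : R^o)
                 - (fun z => 'd (coef1 c a w2) z w3 : R^o)) y.
      by apply: near_eq_derive; apply: near_open oN Ny _ => z Nz;
          exact: coef2_ext_d1_diff.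
    apply: etrans (deriveB (diff_derivable d1) (diff_derivable d2)) _.
    by rewrite (deriveE _ d1) (deriveE _ d2).
  by move=> w1 w2 w3; exact: (schwarz w2 w1 oN Ny (sc w3)).
apply: etrans (congr2 +%R (congr2 (fun s t => s - t) (HD u v t) (HD v u t))
    (HD t u v)) _.
by rewrite (Hs u v t) (Hs u t v) (Hs v t u); ring.
Qed.

End Exact.
End Forms.

(** * The canonical form of the cotangent bundle *)

Section CanonicalForm.
Context {R : realType} {n : nat} {M : chartedSpace R n}.
Hypothesis hM : smooth_atlas M.
Local Notation TM := (total_space (cotangent M)).
Let hV := vector_bundle_cotangent hM.
Let hT := smooth_atlas_total hM hV.

Lemma pairing_linear (z : TM) k (u v : 'rV[R]_n) :
  pairing z (k *: u + v) = k * pairing z u + pairing z v.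
Proof. by rewrite /pairing linearP. Qed.

(* The base chart c and the fiber chart d of a chart of T*M are chosen
   independently, hence the transition map. *)
Lemma coef1_canonical c d v y : charts M c -> charts M d ->
  let C : chart R (n + n) TM := bundle_chart (E := cotangent M) c (cotangent_triv d) in
  (fwd C @` dom C) y ->
  coef1 (X := TM) C (@canonical_form _ _ M) v y = \sum_i rsubmx y 0 i *
     ('d (fun y => fwd d (bwd c y)) (lsubmx y) (lsubmx v)) 0 i.
Proof.
move=> hc hd C hy.
have hE k := @smooth_atlas_euclid R k.
have hC : charts TM C by exists c => //; exists (cotangent_triv d) => //; exists d.
have oN : open (fwd C @` dom C) := open_fwd_dom hT hC.
have Ny : (fwd c @` (dom c `&` dom d)) (lsubmx y).
  by have [z [cz dz] <-] := hy; rewrite /= row_mxKl; exists (projT1 z).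
have Nly z : (fwd C @` dom C) z -> (fwd c @` dom c) (lsubmx z).
  by move=> [w [cw dw] <-]; rewrite /= row_mxKl; exists (projT1 w).
rewrite /coef1 /canonical_form /tbwd_chart.
rewrite -(tmap_comp (X := euclid (n + n)) (hE _) hT hM v (smooth_bwd hT hC) hy
   (smooth_bproj hM hV) I).
have sL : smooth_on (X := euclid (n + n)) (Y := euclid n) (fwd C @` dom C) lsubmx.
  exact: (smooth_on_euclid oN (Cinfty_linear _ (@lsubmx_linear _ _ _))).
rewrite [tmap _ _ _](tmap_comp (X := euclid (n + n)) (Y := euclid n) (hE _) (hE _) hM
    v sL hy
   (smooth_bwd hM hc) (Nly y hy)).
have -> : tmap (X := euclid (n + n)) (Y := euclid n) lsubmx y v = lsubmx v.
  exact: (diff_linear y v (@lsubmx_linear _ _ _)).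
apply: etrans (cotangent_tbwdE d (bwd c (lsubmx y)) (rsubmx y) _) _.
apply: eq_bigr => i _.
by rewrite -(tfwd_tbwd_transition hM (lsubmx v) hd hc Ny).
Qed.

Lemma smooth_form1_canonical : smooth_form1 (@canonical_form _ _ M).
Proof.
split.
  move=> z k u v; rewrite /canonical_form.
  by rewrite (tmap_linear (@bproj _ _ _ _ (cotangent M)) z k u v) pairing_linear.
move=> _ [c hc [_ [d hd <-] <-]] v.
pose C : chart R (n + n) TM := bundle_chart (E := cotangent M) c (cotangent_triv d);
    rewrite -/C.
have hC : charts TM C by exists c => //; exists (cotangent_triv d) => //; exists d.
have oN := open_fwd_dom hT hC.
apply: (@Cinfty_eq _ _ _ _ (fun y => \sum_i rsubmx y 0 i *
     ('d (fun y => fwd d (bwd c y)) (lsubmx y) (lsubmx v)) 0 i : R^o)) => //.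
  by move=> y hy; rewrite (coef1_canonical v hc hd hy).
apply: (Cinfty_sum _ oN) => i; apply: (Cinfty_mul oN).
  by apply: Cinfty_coord => //; exact: Cinfty_linear (@rsubmx_linear _ _ _).
apply: (Cinfty_coord _ oN).
have NT : fwd C @` dom C `<=` lsubmx @^-1` (fwd c @` (dom c `&` dom d)).
  by move=> _ [z [cz dz] <-]; rewrite /preimage /= row_mxKl; exists (projT1 z).
exact: (Cinfty_comp oN (open_transition hM hc hd) NT
  (Cinfty_linear _ (@lsubmx_linear _ _ _))
  (Cinfty_diff (lsubmx v) (Cinfty_transition hM hc hd))).
Qed.

(** In the preferred chart at z the base chart and the fibre chart coincide, so the transition map
    has identity differential. The coefficients of theta are then linear functions of the fibre
    coordinates and are their own derivatives. *)
Lemma ext_d1_canonical (z : TM) u v :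
  ext_d1 (@canonical_form _ _ M) z u v
    = \sum_i rsubmx u 0 i * lsubmx v 0 i - \sum_i rsubmx v 0 i * lsubmx u 0 i.
Proof.
pose x : M := bproj z; pose c := chart_at x.
have hc : charts M c := chart_at_charts hM x.
pose C : chart R (n + n) TM := chart_at z.
have hC : charts TM C := chart_at_charts hT z.
have Cz : dom C z := dom_chart_at hT z.
pose L (v y : 'rV[R]_(n + n)) : R^o := \sum_i rsubmx y 0 i * lsubmx v 0 i.
have lL w : linear (L w).
  move=> k a b; rewrite /L scaler_sumr -big_split /=; apply: eq_bigr => i _.
  by rewrite linearP !mxE mulrDl /GRing.scale /= mulrA.
have near w : \forall y \near fwd C z, coef1 C (@canonical_form _ _ M) w y = L w y.
  apply: near_open (open_fwd_dom hT hC) _ _; first by exists z.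
  move=> y hy; apply: etrans (coef1_canonical w hc hc hy) _.
  apply: eq_bigr => i _; congr (_ * _); congr (fun_of_matrix _ _ _).
  have oN := open_fwd_dom hM hc.
  have Ny : (fwd c @` dom c) (lsubmx y).
    by have [t [ct _] <-] := hy; rewrite /= row_mxKl; exists (projT1 t).
  have FG : \forall t \near lsubmx y, id t = fwd c (bwd c t).
    by apply: near_open oN Ny _ => t ht; rewrite (bwdK hM hc ht).
  have [_ E] := diff_near_eq FG (ex_diff (is_diff_def := is_diff_id _)).
  apply: etrans (congr1 (@^~ (lsubmx w)) E) _.
  by apply: diff_linear => k a b.
have D w t : 'D_t (coef1 C (@canonical_form _ _ M) w) (fwd C z) = L w t.
  apply: etrans (near_eq_derive _ (near w)) _.
  apply: etrans (deriveE _ (Cinfty_differentiable (Cinfty_linear setT (lL w)) I)) _.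
  exact: diff_linear.
exact: (congr2 (fun s t => s - t) (D v u) (D u v)).
Qed.

Lemma smooth_form1_opp (a : form1 TM) :
  smooth_form1 a -> smooth_form1 (fun z v => - a z v).
Proof.
move=> [la sa]; split.
  by move=> z k u v; rewrite la opprD mulrN.
move=> c hc v; have oN := open_fwd_dom hT hc.
apply: (@Cinfty_eq _ _ _ _ (fun y => - 1 * coef1 c a v y : R^o)) => //.
  by move=> y _; rewrite mulN1r.
apply: (Cinfty_mul oN); first exact: Cinfty_cst.
exact: sa.
Qed.

(** Exhibits the symplectic form as exact, so that the results on [ext_d1] give its bilinearity,
    smoothness and closedness. *)
Lemma minus_dthetaE :
  @minus_dtheta _ _ M = ext_d1 (fun z v => - canonical_form z v).
Proof.
rewrite funeqE => z; rewrite funeqE => u; rewrite funeqE => v.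
(* -theta is read as 0 - theta, to which [ext_d1_sub] applies. *)
have s0 : smooth_form1 (fun (z : TM) (v : 'rV[R]_(n + n)) => 0 : R).
  split; first by move=> x k a b; rewrite mulr0 addr0.
  by move=> c hc w; exact: Cinfty_cst.
have := ext_d1_sub hT z u v s0 smooth_form1_canonical.
have -> : (fun (z0 : TM) w => 0 - canonical_form z0 w) =
    (fun z v => - canonical_form z v).
  by rewrite funeqE => z0; rewrite funeqE => w; rewrite sub0r.
move=> ->; rewrite /minus_dtheta [X in _ = X - _](_ : _ = 0) ?sub0r //.
by rewrite /ext_d1 (derive_cst (0 : R^o)) (derive_cst (0 : R^o)) subrr.
Qed.

End CanonicalForm.

(** For non-degeneracy, testing u against the fibre direction of index i isolates its i-th base
    coordinate, and testing against the base direction isolates its i-th fibre coordinate. *)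
Lemma symplectic_on_cotangent (R : realType) n (M : chartedSpace R n)
    (V : set (total_space (cotangent M))) :
  smooth_manifold M -> mopen V -> symplectic_on V (@minus_dtheta R n M).
Proof.
move=> sM oV; have hM := smooth_manifold_atlas sM.
have hV := vector_bundle_cotangent hM; have hT := smooth_atlas_total hM hV.
have sa := smooth_form1_opp hM (smooth_form1_canonical hM).
split=> //.
- exact: smooth_manifold_total.
- by rewrite minus_dthetaE //; exact: smooth_form2_ext_d1.
- by rewrite minus_dthetaE //; exact: closed_form2_ext_d1.
move=> z Vz u H; rewrite -[u]hsubmxK.
have {}H (v : 'rV[R]_(n + n)) : \sum_i rsubmx u 0 i * lsubmx v 0 i =
    \sum_i rsubmx v 0 i * lsubmx u 0 i.
  have /eqP := H v; rewrite /minus_dtheta (ext_d1_canonical hM) oppr_eq0 subr_eq0.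
  by move/eqP.
have -> : lsubmx u = 0.
  apply/rowP => i; have := H (row_mx 0 (delta_mx 0 i)).
  rewrite row_mxKl row_mxKr big1 => [|j _]; last by rewrite [X in _ * X]mxE mulr0.
  rewrite (bigD1 i) //= big1 => [|j ji]; last by rewrite [X in X * _]mxE (negbTE ji)
      andbF mul0r.
  by rewrite [X in X * _]mxE !eqxx mul1r addr0 mxE => <-; rewrite mxE.
have -> : rsubmx u = 0.
  apply/rowP => i; have := H (row_mx (delta_mx 0 i) 0).
  rewrite row_mxKl row_mxKr [RHS]big1 => [|j _]; last by rewrite [X in X * _]mxE mul0r.
  rewrite (bigD1 i) //= big1 => [|j ji]; last by rewrite [X in _ * X]mxE (negbTE ji)
      andbF mulr0.
  by rewrite [X in _ * X]mxE !eqxx mulr1 addr0 => ->; rewrite mxE.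
by rewrite row_mx0.
Qed.

(** * Diffeomorphisms, adapted charts and vectors tangent to a subset *)

Section Diffeomorphisms.
Context {R : realType}.

Lemma smooth_on_fst_comp n p q (X : chartedSpace R n) (Y : chartedSpace R p)
    (Z : chartedSpace R q) (U : set X) (f : X -> prod_mfd Y Z) :
  smooth_atlas X -> smooth_atlas Y -> smooth_atlas Z -> smooth_on U f ->
  smooth_on U (fun x => (f x).1 : Y).
Proof.
move=> hX hY hZ sf.
exact: (smooth_on_comp hX (smooth_atlas_prod hY hZ) sf (smooth_fst hY hZ)
    (fun _ _ => I)).
Qed.

Lemma smooth_on_snd_comp n p q (X : chartedSpace R n) (Y : chartedSpace R p)
    (Z : chartedSpace R q) (U : set X) (f : X -> prod_mfd Y Z) :
  smooth_atlas X -> smooth_atlas Y -> smooth_atlas Z -> smooth_on U f ->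
  smooth_on U (fun x => (f x).2 : Z).
Proof.
move=> hX hY hZ sf.
exact: (smooth_on_comp hX (smooth_atlas_prod hY hZ) sf (smooth_snd hY hZ)
    (fun _ _ => I)).
Qed.

Lemma mopen_setX n p (X : chartedSpace R n) (Y : chartedSpace R p)
    (U : set X) (V : set Y) : smooth_atlas X -> smooth_atlas Y ->
  mopen U -> mopen V -> mopen (X := prod_mfd X Y) (U `*` V).
Proof.
move=> hX hY oU oV; have hXY := smooth_atlas_prod hX hY.
have o1 := smooth_on_preimage hXY hX (smooth_fst hX hY) oU.
have o2 := smooth_on_preimage hXY hY (smooth_snd hX hY) oV.
have -> : U `*` V = (setT `&` (fun z : prod_mfd X Y => z.1 : X) @^-1` U)
     `&` (setT `&` (fun z : prod_mfd X Y => z.2 : Y) @^-1` V).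
  by apply/seteqP; split=> -[x y] /= [] => [? ?|[_ ?] [_ ?]].
exact: (mopenI hXY o1 o2).
Qed.

Lemma diffeo_prod n1 n2 p1 p2 (X1 : chartedSpace R n1) (X2 : chartedSpace R n2)
    (Y1 : chartedSpace R p1) (Y2 : chartedSpace R p2)
    (U1 : set X1) (U2 : set X2) (O1 : set Y1) (O2 : set Y2)
    (f1 : X1 -> Y1) (f2 : X2 -> Y2) :
  smooth_atlas X1 -> smooth_atlas X2 -> smooth_atlas Y1 -> smooth_atlas Y2 ->
  diffeo_onto U1 O1 f1 -> diffeo_onto U2 O2 f2 ->
  diffeo_onto (X := prod_mfd X1 X2) (Y := prod_mfd Y1 Y2) (U1 `*` U2) (O1 `*` O2)
    (fun z => (f1 z.1, f2 z.2)).
Proof.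
move=> hX1 hX2 hY1 hY2 [oU1 oO1 fU1 sf1 [g1 [sg1 gK1]]]
    [oU2 oO2 fU2 sf2 [g2 [sg2 gK2]]].
have hX := smooth_atlas_prod hX1 hX2; have hY := smooth_atlas_prod hY1 hY2.
have oU := mopen_setX hX1 hX2 oU1 oU2; have oO := mopen_setX hY1 hY2 oO1 oO2.
(* Stated for arbitrary manifolds because it is applied both to the product of the maps and to the
   product of their inverses. *)
have aux k1 k2 l1 l2 (A1 : chartedSpace R k1) (A2 : chartedSpace R k2)
    (B1 : chartedSpace R l1) (B2 : chartedSpace R l2) (C1 : set A1) (C2 : set A2)
    (h1 : A1 -> B1) (h2 : A2 -> B2) :
    smooth_atlas A1 -> smooth_atlas A2 -> smooth_atlas B1 -> smooth_atlas B2 ->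
    mopen (X := prod_mfd A1 A2) (C1 `*` C2) -> smooth_on C1 h1 -> smooth_on C2 h2 ->
    smooth_on (X := prod_mfd A1 A2) (Y := prod_mfd B1 B2) (C1 `*` C2)
        (fun z => (h1 z.1, h2 z.2)).
  move=> hA1 hA2 hB1 hB2 oC sh1 sh2; have hA := smooth_atlas_prod hA1 hA2.
  have s1 := smooth_on_sub hA (smooth_fst hA1 hA2) oC (@subsetT _ _).
  have s2 := smooth_on_sub hA (smooth_snd hA1 hA2) oC (@subsetT _ _).
  apply: (smooth_pair hB1 hB2 hA).
    by refine (smooth_on_comp hA hA1 s1 sh1 _) => z [].
  by refine (smooth_on_comp hA hA2 s2 sh2 _) => z [].
split=> //.
- rewrite -fU1 -fU2; apply/seteqP; split=>
    [_ [[x1 x2] [/= h1 h2] <-]|[y1 y2] /= [[x1 h1 <-] [x2 h2 <-]]].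
    by split; [exists x1|exists x2].
  by exists (x1, x2).
- exact: aux.
exists (fun z => (g1 z.1, g2 z.2)); split; first exact: aux.
by move=> [x1 x2] [/= h1 h2]; rewrite gK1 // gK2.
Qed.

Lemma diffeo_inv n p (X : chartedSpace R n) (Y : chartedSpace R p) (U : set X)
    (O : set Y) (f : X -> Y) (g : Y -> X) : (forall x, U x -> g (f x) = x) ->
  f @` U = O -> forall y, O y -> U (g y) /\ f (g y) = y.
Proof. by move=> gK <- _ [x Ux <-]; rewrite gK. Qed.

(** A source of charts adapted to a submanifold: a chart of Y is pulled back along f, and a linear
    change of coordinates then straightens the subset. *)
Lemma smooth_chart_diffeo n (X Y : chartedSpace R n) (U : set X) (O : set Y)
    (f : X -> Y) (c : chart R n Y) (L L' : 'rV[R]_n -> 'rV[R]_n) :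
  smooth_atlas X -> smooth_atlas Y -> diffeo_onto U O f -> charts Y c ->
  linear L -> linear L' -> cancel L L' -> cancel L' L ->
  exists C : chart R n X, [/\ smooth_chart C, dom C = U `&` f @^-1` dom c &
     forall x, fwd C x = L (fwd c (f x))].
Proof.
move=> hX hY [oU oO fU sf [g [sg gK]]] hc lL lL' LK LK'.
have gO := diffeo_inv gK fU.
have hE := @smooth_atlas_euclid R n.
pose D := U `&` f @^-1` dom c.
exists (@Chart R n X D (fun x => L (fwd c (f x))) (fun y => g (bwd c (L' y)))).
have gfK x : D x -> g (bwd c (L' (L (fwd c (f x))))) = x.
  by move=> [Ux cx]; rewrite LK (fwdK hY hc cx) gK.
split=> //; split=> //=.
have oD : mopen D := smooth_on_preimage hX hY sf (mopen_dom hY hc).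
have EI : (fun x => L (fwd c (f x))) @` D = L' @^-1` (fwd c @` (dom c `&` O)).
  apply/seteqP; split=> [_ [x [Ux cx] <-]|y [z [cz Oz] ez]].
    by rewrite /preimage /= LK; exists (f x) => //; split=> //; rewrite -fU; exists x.
  have [Ug fg] := gO z Oz.
  by exists (g z); [split; rewrite //= fg|rewrite fg ez LK'].
have oI : mopen (X := euclid n) ((fun x => L (fwd c (f x))) @` D).
  rewrite EI; apply: mopen_euclid.
  have := open_preimage_Cinfty openT (Cinfty_linear setT lL') (oO c hc).
  by rewrite setTI.
split=> //.
  apply: (smooth_linear_comp hX lL).
  have sfD := smooth_on_sub hX sf oD (@subIsetl _ _ _).
  by refine (smooth_on_comp hX hY sfD (smooth_fwd hY hc) _) => x [].
exists (fun y => g (bwd c (L' y))); split=> //.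
have sL' := smooth_on_sub (X := euclid n) (Y := euclid n) hE (smooth_on_linear lL') oI
    (@subsetT _ _).
have IE y : ((fun x => L (fwd c (f x))) @` D) y ->
    (fwd c @` dom c) (L' y) /\ O (bwd c (L' y)).
  by rewrite EI => -[z [cz Oz] ez]; rewrite -ez (fwdK hY hc cz); split=> //; exists z.
have sb := smooth_on_comp (X := euclid n) (Y := euclid n) hE hE sL' (smooth_bwd hY hc)
  (fun y hy => (IE y hy).1).
exact: (smooth_on_comp (X := euclid n) hE hY sb sg (fun y hy => (IE y hy).2)).
Qed.

Lemma smooth_chart_atlas n (X : chartedSpace R n) c :
  smooth_atlas X -> charts X c -> smooth_chart c.
Proof.
move=> hX hc; split; last by move=> x; exact: fwdK.
split=> //; first exact: mopen_dom.
- by apply: mopen_euclid; exact: (open_fwd_dom hX).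
- exact: smooth_fwd.
by exists (bwd c); split; [exact: smooth_bwd|move=> x; exact: fwdK].
Qed.

(** The maps agree on S, which need not be open, so [tmap_eq] does not apply to them. After
    composition with a curve in S they agree on an open set of parameters. *)
Lemma tmap_tangent_eq n p (X : chartedSpace R n) (Y : chartedSpace R p)
    (U S : set X) (f g : X -> Y) x u : smooth_atlas X -> smooth_atlas Y ->
  smooth_on U f -> smooth_on U g -> S `<=` U -> (forall x, S x -> f x = g x) ->
  tangent_space S x u -> tmap f x u = tmap g x u.
Proof.
move=> hX hY sf sg SU fg [N [c [oN N0 sc cS [<- <-]]]].
have hE := @smooth_atlas_euclid R 1.
have cU y : N y -> U (c y) by move=> Ny; apply: SU; apply: cS; exists y.
rewrite -(tmap_comp (X := euclid 1) hE hX hY _ sc N0 sf (cU _ N0)).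
rewrite -(tmap_comp (X := euclid 1) hE hX hY _ sc N0 sg (cU _ N0)).
apply: (tmap_eq (X := euclid 1) hE hY _ _ N0).
  exact: (smooth_on_comp (X := euclid 1) hE hX sc sf cU).
by move=> y Ny; apply: fg; apply: cS; exists y.
Qed.

End Diffeomorphisms.

(** * The local groupoid transported from the pair groupoid *)

Section Groupoid.
Context {R : realType} {n : nat} {M : chartedSpace R n}.
Local Notation TM := (total_space (cotangent M)).
Local Notation MM := (prod_mfd M M).
Hypothesis sM : smooth_manifold M.
Variables (omega : form2 M) (V : set TM) (f : TM -> MM).
Hypothesis df : diffeo_onto V (f @` V) f.
Hypothesis f0 : forall x, V (zero_section (cotangent M) x) /\ f
    (zero_section (cotangent M) x) = (x, x).
Local Notation s := (fun a : TM => (f a).2 : M).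
Local Notation t := (fun a : TM => (f a).1 : M).
Hypothesis fw : forall a u v, V a -> minus_dtheta a u v
  = omega (s a) (tmap s a u) (tmap s a v) - omega (t a) (tmap t a u) (tmap t a v).
Local Notation G := (transported_groupoid V f).

Let hM := smooth_manifold_atlas sM.
Let hV := vector_bundle_cotangent hM.
Let hT := smooth_atlas_total hM hV.
Let hMM := smooth_atlas_prod hM hM.

(** The same term as in [transported_groupoid], default value included, so that the rewriting rules
    [gE] below hold by conversion. *)
Let g (y : MM) : TM := inverse_on V f (zero_section (cotangent M) y.1) y.

Lemma inverse_onP y : (f @` V) y -> V (g y) /\ f (g y) = y.
Proof.
move=> [a Va fa]; rewrite /g /inverse_on; case: pselect => [H|[]]; last by exists a.
by case: (cid H).
Qed.

Let finj a b : V a -> V b -> f a = f b -> a = b.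
Proof.
have [_ _ _ _ [h [_ hK]]] := df.
by move=> Va Vb fab; rewrite -(hK a Va) fab hK.
Qed.

Lemma inverse_onK a : V a -> g (f a) = a.
Proof.
move=> Va; have [Vg fg] := inverse_onP (imageP f Va).
exact: finj.
Qed.

Let oV : mopen V. Proof. by have [] := df. Qed.
Let oO : mopen (f @` V). Proof. by have [] := df. Qed.
Let sf : smooth_on V f. Proof. by have [] := df. Qed.
Let ss : smooth_on V s. Proof. exact: smooth_on_snd_comp hT hM hM sf. Qed.
Let st : smooth_on V t. Proof. exact: smooth_on_fst_comp hT hM hM sf. Qed.

Lemma smooth_inverse_on : smooth_on (f @` V) g.
Proof.
have [_ _ _ _ [h [sh hK]]] := df.
by apply: (smooth_on_eq hMM sh) => _ [a Va <-]; rewrite hK // inverse_onK.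
Qed.

Let units_in_V : range (zero_section (cotangent M)) `<=` V.
Proof. by move=> _ [x _ <-]; have [] := f0 x. Qed.

(** Since f (g (x, y)) = (x, y) on the image of V, source and target of every result are known, and
    injectivity of f on V reduces each law to the pair groupoid. *)
Lemma transported_groupoid_laws : local_groupoid_laws G.
Proof.
have f0x x := (f0 x).2.
have gE x y : inverse_on V f (zero_section (cotangent M) x) (x, y) = g (x, y) by [].
split => /=.
- by move=> x; rewrite !f0x; split=> //; exact: (f0 x).1.
- move=> a Va; rewrite !f0x /=.
  have e : ((f a).1, (f a).2) = f a by case: (f a).
  have E b : V b -> f b = ((f a).1, (f a).2) -> g ((f a).1, (f a).2) = a.
    by move=> Vb fb; rewrite e inverse_onK.
  split.
  + by split=> //; [exact: (f0 _).1|exists a].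
  + by rewrite gE (E a).
  + by split=> //; [exact: (f0 _).1|exists a].
  + by rewrite gE (E a).
- split.
    move=> x; rewrite f0x /=; split.
      by split; [exact: (f0 x).1|exists (zero_section (cotangent M) x);
          [exact: (f0 x).1|]].
    by rewrite gE -f0x inverse_onK //; exact: (f0 x).1.
  move=> a [Va Wa]; rewrite gE.
  have [Vg fg] := inverse_onP Wa; rewrite fg /=.
  have e : ((f a).1, (f a).2) = f a by case: (f a).
  split; split=> //.
  + by rewrite e; split=> //; exists a.
  + by rewrite gE e inverse_onK.
  + by split=> //; exists (zero_section (cotangent M) (f a).1); [exact: (f0 _).1|].
  + by rewrite gE -f0x inverse_onK //; exact: (f0 _).1.
  + by split=> //; exists (zero_section (cotangent M) (f a).2); [exact: (f0 _).1|].
  + by rewrite gE -f0x inverse_onK //; exact: (f0 _).1.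
- move=> a b [Va Vb ab Wab]; rewrite gE.
  by have [Vg ->] := inverse_onP Wab.
(* Either bracketing of the triple product asks for the same thing, that (t a, s c) lie in the image
   of V, and both yield g (t a, s c). *)
move=> a b c [/= Va Vb ab Wab] [/= _ Vc bc Wbc].
rewrite !gE.
have [Vg ->] := inverse_onP Wab; have [Vg' ->] := inverse_onP Wbc.
by split=> //=; split=> -[].
Qed.

(* y |-> g (t a, y) is a section of s through a. *)
Lemma submersion_src a w : V a -> exists v, tmap s a v = w.
Proof.
move=> Va; pose U := setT `&` (fun y => ((f a).1, y) : MM) @^-1` (f @` V).
have sc := smooth_on_cst hM hM ((f a).1 : M) (mopenT hM).
have si := smooth_pair hM hM hM sc (smooth_on_id hM (mopenT hM)).
have oU : mopen U := smooth_on_preimage hM hMM si oO.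
have siU := smooth_on_sub hM si oU (@subsetT _ _).
have sgi := smooth_on_comp hM hMM siU smooth_inverse_on (fun y (h : U y) => h.2).
have Us : U (s a) by split=> //; exists a => //; case: (f a).
have gs : g ((f a).1, s a) = a by rewrite -surjective_pairing inverse_onK.
exists (tmap (fun y => g ((f a).1, y)) (s a) w).
have VU y : U y -> V (g ((f a).1, y)) by move=> [_ /inverse_onP[]].
have := tmap_comp hM hT hM w sgi Us ss (VU _ Us).
rewrite gs => <-; rewrite -[RHS](tmap_id (s a) w hM); apply/esym.
apply: (tmap_eq hM hM w (smooth_on_id hM oU) Us) => y [_ /inverse_onP[_ fy]].
by rewrite fy.
Qed.

Lemma submersion_tgt a w : V a -> exists v, tmap t a v = w.
Proof.
move=> Va; pose U := setT `&` (fun y => (y, (f a).2) : MM) @^-1` (f @` V).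
have sc := smooth_on_cst hM hM ((f a).2 : M) (mopenT hM).
have si := smooth_pair hM hM hM (smooth_on_id hM (mopenT hM)) sc.
have oU : mopen U := smooth_on_preimage hM hMM si oO.
have siU := smooth_on_sub hM si oU (@subsetT _ _).
have sgi := smooth_on_comp hM hMM siU smooth_inverse_on (fun y (h : U y) => h.2).
have Us : U (t a) by split=> //; exists a => //; case: (f a).
have gs : g (t a, (f a).2) = a by rewrite -surjective_pairing inverse_onK.
exists (tmap (fun y => g (y, (f a).2)) (t a) w).
have VU y : U y -> V (g (y, (f a).2)) by move=> [_ /inverse_onP[]].
have := tmap_comp hM hT hM w sgi Us st (VU _ Us).
rewrite gs => <-; rewrite -[RHS](tmap_id (t a) w hM); apply/esym.
apply: (tmap_eq hM hM w (smooth_on_id hM oU) Us) => y [_ /inverse_onP[_ fy]].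
by rewrite fy.
Qed.

(** The bundle projection is a smooth left inverse. It gives injectivity of the map and of its
    tangent maps, and its preimage of U cuts out the image of U in the range. *)
Lemma embedding_zero_section : embedding (zero_section (cotangent M)).
Proof.
have s0 := smooth_zero_section hM hV; have sb := smooth_bproj hM hV.
split=> //.
- by move=> x y /(congr1 (@bproj _ _ _ _ (cotangent M))).
- move=> x u v e.
  have E w : tmap (@bproj _ _ _ _ (cotangent M)) (zero_section (cotangent M) x)
      (tmap (zero_section (cotangent M)) x w) = w.
    rewrite -(tmap_comp hM hT hM w s0 I sb I).
    exact: (tmap_id x w hM).
  by rewrite -(E u) e E.
move=> U oU; exists (setT `&` @bproj _ _ _ _ (cotangent M) @^-1` U); split.
  exact: (smooth_on_preimage hT hM sb oU).
apply/seteqP; split=> [_ [x Ux <-]|z [[_ Ux] [x _ ex]]].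
  by split=> //; exists x.
by exists x => //; move: Ux; rewrite -ex.
Qed.

Lemma transported_groupoid_lie : local_lie_groupoid G.
Proof.
have sg := smooth_inverse_on.
split.
- by split=> //; exact: smooth_manifold_total.
- exact: transported_groupoid_laws.
- split.
  + split; first by split=> // a Va w; exact: submersion_src.
    apply/seteqP; split=> // x _; have [Vx fx] := f0 x.
    by exists (zero_section (cotangent M) x) => //=; rewrite fx.
  + split; first by split=> // a Va w; exact: submersion_tgt.
    apply/seteqP; split=> // x _; have [Vx fx] := f0 x.
    by exists (zero_section (cotangent M) x) => //=; rewrite fx.
  + exact: embedding_zero_section.
- have sfl : smooth_on V (fun a => (s a, t a) : MM) := smooth_pair hM hM hT ss st.
  have oI : mopen (linvdom G) := smooth_on_preimage hT hMM sfl oO.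
  split=> //; have sflI := smooth_on_sub hT sfl oI (@subIsetl _ _ _).
  exact: (smooth_on_comp hT hMM sflI sg (fun a (h : linvdom G a) => h.2)).
have hTT := smooth_atlas_prod hT hT.
have oVV := mopen_setX hT hT oV oV.
have s1 := smooth_on_sub hTT (smooth_fst hT hT) oVV (@subsetT _ _).
have s2 := smooth_on_sub hTT (smooth_snd hT hT) oVV (@subsetT _ _).
have st1 : smooth_on (X := prod_mfd TM TM) (V `*` V) (fun z => t z.1).
  by refine (smooth_on_comp hTT hT s1 st _) => z [].
have ss2 : smooth_on (X := prod_mfd TM TM) (V `*` V) (fun z => s z.2).
  by refine (smooth_on_comp hTT hT s2 ss _) => z [].
have sp := smooth_pair hM hM hTT st1 ss2.
(* The domain of the multiplication without the equation s a = t b. It is open, and the formula for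
   the product makes sense and is smooth on all of it, which supplies the extension required by
   [smooth_on_subset]. *)
pose O := (V `*` V) `&` (fun z : prod_mfd TM TM => (t z.1, s z.2) : MM) @^-1` (f @` V).
have oO2 : mopen (X := prod_mfd TM TM) O := smooth_on_preimage hTT hMM sp oO.
split.
  exists O; split=> //; apply/seteqP; split=>
      [[a b] [/= Va Vb ab Wab]|[a b] [[[/= Va Vb] Wab] [_ _ ab]]].
    by [].
  by [].
move=> [a b] [/= Va Vb ab Wab].
exists O, (fun z => g (t z.1, s z.2)); split=> //.
have spO := smooth_on_sub hTT sp oO2 (@subIsetl _ _ _).
exact: (smooth_on_comp hTT hMM spO sg (fun z (h : O z) => h.2)).
Qed.

Lemma pull2_inverse_on a u v : linvdom G a ->
  pull2 (linv G) (@minus_dtheta _ _ M) a u v = - minus_dtheta a u v.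
Proof.
move=> Ia; have [Va Wa] := Ia.
have sfl : smooth_on V (fun a => (s a, t a) : MM) := smooth_pair hM hM hT ss st.
have oI : mopen (linvdom G) := smooth_on_preimage hT hMM sfl oO.
have sflI := smooth_on_sub hT sfl oI (@subIsetl _ _ _).
have si : smooth_on (linvdom G) (linv G) :=
  smooth_on_comp hT hMM sflI smooth_inverse_on (fun a (h : linvdom G a) => h.2).
have IV b : linvdom G b -> V (linv G b) by move=> [_ /inverse_onP[]].
have fi b : linvdom G b -> f (linv G b) = (s b, t b) by move=> [_ /inverse_onP[]].
have Es w : tmap s (linv G a) (tmap (linv G) a w) = tmap t a w.
  rewrite -(tmap_comp hT hT hM w si Ia ss (IV a Ia)).
  apply: (tmap_eq hT hM w (smooth_on_comp hT hT si ss IV) Ia) => b Ib.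
  by rewrite fi.
have Et w : tmap t (linv G a) (tmap (linv G) a w) = tmap s a w.
  rewrite -(tmap_comp hT hT hM w si Ia st (IV a Ia)).
  apply: (tmap_eq hT hM w (smooth_on_comp hT hT si st IV) Ia) => b Ib.
  by rewrite fi.
by rewrite /pull2 (fw _ _ (IV a Ia)) (fw _ _ Va) !Es !Et (fi a Ia) opprB.
Qed.

Lemma lagrangian_units :
  lagrangian_submanifold (@minus_dtheta _ _ M) (range (zero_section (cotangent M))).
Proof.
split.
  exists n; split=> //; split; first exact: leq_addr.
  move=> _ [x _ <-].
  (* A bundle chart is already adapted: its last n coordinates are linear fibre coordinates and
     vanish exactly on zero covectors. *)
  pose c : chart R (n + n) TM := chart_at (zero_section (cotangent M) x).
  have hc : charts TM c := chart_at_charts hT _.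
  exists c; split; [exact: smooth_chart_atlas|exact: dom_chart_at|].
  have hx := triv_at_trivs hV x.
  pose tx := triv_at (cotangent M) x.
  have tx0 y : base tx y -> tfwd tx (0 : fib (cotangent M) y) =
      0 by move=> /(tfwd0 hV hx).
  move=> z [cz tz].
  have fz : fwd c z = row_mx (fwd (chart_at x) (projT1 z)) (tfwd tx (projT2 z)) by [].
  split=> [[y _ ez] i ni|H].
    have e0 : tfwd tx (projT2 z) = 0 by move: tz; rewrite -ez => ty; exact: tx0.
    rewrite fz e0; case: (split_ordP i) ni => j -> nj; last by rewrite row_mxEr mxE.
    by move: nj; rewrite leqNgt (ltn_ord j).
  have e0 : tfwd tx (projT2 z) = 0.
    apply/rowP => j; have := H (rshift n j) (leq_addr _ _).
    by rewrite fz row_mxEr => ->; rewrite mxE.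
  exists (projT1 z) => //; case: z tz e0 {cz H fz} => y xi ty e0.
  have -> // : xi = 0.
  by apply: (can_inj (tfwdK hV hx ty)); apply: etrans e0 (esym (tx0 y ty)).
move=> a Sa u v Su Sv.
have st_units b : range (zero_section (cotangent M)) b -> s b = t b.
  by move=> [x _ <-]; rewrite (f0 x).2.
rewrite (fw _ _ (units_in_V Sa)) (st_units a Sa).
rewrite (tmap_tangent_eq hT hM ss st units_in_V st_units Su).
by rewrite (tmap_tangent_eq hT hM ss st units_in_V st_units Sv) subrr.
Qed.

(** A triple product is g (t a, s c). As f maps the unit at x to (x, x), it is a unit exactly when s
    c = t a, the relation that closes the triangle. *)
Lemma transported_groupoid_cycles : lcycles_spec G.
Proof.
have f0x x := (f0 x).2; have V0 x := (f0 x).1.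
have gE x y : inverse_on V f (zero_section (cotangent M) x) (x, y) = g (x, y) by [].
have gu x y z : (f @` V) (x, y) -> g (x, y) = zero_section (cotangent M) z -> x = y.
  by move=> Wxy e; have [_] := inverse_onP Wxy; rewrite e f0x => -[<- <-].
have gd x : g (x, x) = zero_section (cotangent M) x.
  by rewrite -f0x inverse_onK.
split.
- by move=> a b c [/= [Va Vb Vc] [ab bc ca]].
- move=> a b c [/= Va Vb ab Wab]; rewrite !gE.
  have [Vg ->] := inverse_onP Wab => -[/= _ Vc bc Wc]; rewrite ?gE.
  split=> [[_ [_ _ ca]]|[x]].
    by exists (t a); rewrite ca gd.
  by move=> /(gu _ _ _ Wc) e; split.
move=> a b c [/= Vb Vc bc Wbc]; rewrite !gE.
have [Vg ->] := inverse_onP Wbc => -[/= Va _ ab Wa]; rewrite ?gE.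
split=> [[_ [_ _ ca]]|[x]].
  by exists (t a); rewrite ca gd.
by move=> /(gu _ _ _ Wa) e; split.
Qed.
Local Notation TTT := (prod_mfd (prod_mfd TM TM) TM).
Local Notation M6 := (prod_mfd (prod_mfd MM MM) MM).

(* Sends the coordinates (x1, y1, x2, y2, x3, y3) of the (t, s) of three arrows
   to (x1, x2, x3, y1 - x2, y2 - x3, y3 - x1); the 3-cycles are where the last
   three vanish. *)
Definition cycle_coord (y : 'rV[R]_((n + n + (n + n)) + (n + n))) :
    'rV[R]_((n + n + (n + n)) + (n + n)) :=
  let x1 := lsubmx (lsubmx (lsubmx y)) in let y1 := rsubmx (lsubmx (lsubmx y)) in
  let x2 := lsubmx (rsubmx (lsubmx y)) in let y2 := rsubmx (rsubmx (lsubmx y)) in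
  let x3 := lsubmx (rsubmx y) in let y3 := rsubmx (rsubmx y) in
  row_mx (row_mx (row_mx x1 x2) (row_mx x3 (y1 - x2))) (row_mx (y2 - x3) (y3 - x1)).

Definition cycle_coord_inv (y : 'rV[R]_((n + n + (n + n)) + (n + n))) :
    'rV[R]_((n + n + (n + n)) + (n + n)) :=
  let x1 := lsubmx (lsubmx (lsubmx y)) in let x2 := rsubmx (lsubmx (lsubmx y)) in
  let x3 := lsubmx (rsubmx (lsubmx y)) in let d1 := rsubmx (rsubmx (lsubmx y)) in
  let d2 := lsubmx (rsubmx y) in let d3 := rsubmx (rsubmx y) in
  row_mx (row_mx (row_mx x1 (d1 + x2)) (row_mx x2 (d2 + x3))) (row_mx x3 (d3 + x1)).

Lemma cycle_coordK : cancel cycle_coord cycle_coord_inv.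
Proof.
by move=> y; rewrite /cycle_coord_inv /cycle_coord !(row_mxKl, row_mxKr) !subrK
    !hsubmxK.
Qed.

Lemma cycle_coord_invK : cancel cycle_coord_inv cycle_coord.
Proof.
by move=> y; rewrite /cycle_coord_inv /cycle_coord !(row_mxKl, row_mxKr) !addrK
    !hsubmxK.
Qed.

Lemma cycle_coord_linear : linear cycle_coord.
Proof.
move=> k u v; rewrite /cycle_coord !(lsubmx_linear, rsubmx_linear)
    !(scale_row_mx, add_row_mx).
by congr (row_mx (row_mx _ (row_mx _ _)) (row_mx _ _)); rewrite scalerBr opprD addrACA.
Qed.

Lemma cycle_coord_inv_linear : linear cycle_coord_inv.
Proof.
move=> k u v; rewrite /cycle_coord_inv !(lsubmx_linear, rsubmx_linear)
    !(scale_row_mx, add_row_mx).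
by congr (row_mx (row_mx (row_mx _ _) (row_mx _ _)) (row_mx _ _));
    rewrite scalerDr addrACA.
Qed.

(** Matches the block layout of [cycle_coord]: the first difference closes the second group of
    blocks, while [d2] stands for the other two differences together. *)
Lemma row_mx_tail_eq0 (A : 'rV[R]_(n + n)) (B d1 : 'rV[R]_n) (d2 : 'rV[R]_(n + n)) :
  (d1 = 0 /\ d2 = 0) <->
  forall i : 'I_((n + n + (n + n)) + (n + n)), (n + n + n <= i)%N ->
    row_mx (row_mx A (row_mx B d1)) d2 0 i = 0.
Proof.
split=> [[-> ->] i|H].
  case: (split_ordP i) => j -> hj; last by rewrite row_mxEr mxE.
  rewrite row_mxEl; move: hj; case: (split_ordP j) => k -> hk.
    by move: hk; rewrite leqNgt (leq_trans (ltn_ord k)) //= leq_addr.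
  rewrite row_mxEr; move: hk; case: (split_ordP k) => l -> hl.
    by move: hl; rewrite leqNgt /= ltn_add2l (ltn_ord l).
  by rewrite row_mxEr mxE.
split; apply/rowP => j.
  have := H (lshift (n + n) (rshift (n + n) (rshift n j))).
  rewrite row_mxEl !row_mxEr => -> /=; first by rewrite mxE.
  by rewrite addnA leq_addr.
have := H (rshift (n + n + (n + n)) j).
rewrite row_mxEr => -> /=; first by rewrite mxE.
by rewrite (leq_trans _ (leq_addr _ _)) // leq_add2l leq_addr.
Qed.

Let hTT := smooth_atlas_prod hT hT.
Let hTTT := smooth_atlas_prod hTT hT.

Lemma submanifold_cycles :
  submanifold (X := TTT) (n + n + n) (lcycles G).
Proof.
split; first by rewrite (leq_trans _ (leq_addr _ _)) // leq_add2l leq_addr.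
move=> [[a b] c] [/= [Va Vb Vc] [ab bc ca]].
have hMM2 := smooth_atlas_prod hMM hMM; have hM6 := smooth_atlas_prod hMM2 hMM.
have df3 := diffeo_prod hTT hT hMM2 hMM (diffeo_prod hT hT hMM hMM df df) df.
(* On a cycle s a = t b, s b = t c and s c = t a. Each of these points gets one chart, used for both
   of its occurrences; only then does a zero difference of coordinates mean equality of points. The
   six factors thus carry p, q, q, r, r, p. *)
pose cp := chart_at (t a); pose cq := chart_at (t b); pose cr := chart_at (t c).
have hcp : charts M cp := chart_at_charts hM (t a).
have hcq : charts M cq := chart_at_charts hM (t b).
have hcr : charts M cr := chart_at_charts hM (t c).
pose c6 := prod_chart (prod_chart (prod_chart cp cq) (prod_chart cq cr))
    (prod_chart cr cp).
have hc6 : charts M6 c6.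
  exists (prod_chart (prod_chart cp cq) (prod_chart cq cr)); last first.
    by exists (prod_chart cr cp) => //; exists cr => //; exists cp.
  exists (prod_chart cp cq); first by exists cp => //; exists cq.
  by exists (prod_chart cq cr) => //; exists cq => //; exists cr.
have [C [sC dC fC]] := smooth_chart_diffeo hTTT hM6 df3 hc6 cycle_coord_linear
  cycle_coord_inv_linear cycle_coordK cycle_coord_invK.
exists C; split=> //.
  rewrite dC; split=> //; rewrite /= ab bc ca.
  by split; [split|]; split; exact: (dom_chart_at hM).
move=> [[a' b'] c']; rewrite dC =>
    -[[[/= Va' Vb'] Vc'] [[[/= c1 c2] [c3 c4]] [c5 c6']]].
have fE : fwd C (a', b', c') = row_mx
   (row_mx (row_mx (fwd cp (t a')) (fwd cq (t b')))
       (row_mx (fwd cr (t c')) (fwd cq (s a') - fwd cq (t b'))))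
   (row_mx (fwd cr (s b') - fwd cr (t c')) (fwd cp (s c') - fwd cp (t a'))).
  by rewrite fC /cycle_coord /= !(row_mxKl, row_mxKr).
rewrite fE; apply: iff_trans (row_mx_tail_eq0 _ _ _ _).
have inj (e : chart R n M) x y : charts M e -> dom e x -> dom e y ->
    fwd e x - fwd e y = 0 -> x = y.
  by move=> he ex ey /subr0_eq exy; rewrite -(fwdK hM he ex) exy (fwdK hM he ey).
split=> [[_ [/= -> -> ->]]|[e1 e23]]; first by rewrite !subrr row_mx0.
have [e2 e3] : fwd cr (s b') - fwd cr (t c') = 0 /\ fwd cp (s c') - fwd cp (t a') = 0.
  by split; [rewrite -[LHS](row_mxKl _ (fwd cp (s c') - fwd cp (t a')))
            |rewrite -[LHS](row_mxKr (fwd cr (s b') - fwd cr (t c')))];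
                rewrite e23 linear0.
split=> //=; split.
- exact: inj hcq c2 c3 e1.
- exact: inj hcr c4 c5 e2.
- exact: inj hcp c6' c1 e3.
Qed.

Lemma lagrangian_cycles :
  lagrangian_submanifold (X := TTT) (sum3_form (@minus_dtheta _ _ M)) (lcycles G).
Proof.
split.
  exists (n + n + n)%N; split; last exact: submanifold_cycles.
  by rewrite -!addnA.
move=> z Sz u v Su Sv.
pose U : set TTT := (V `*` V) `*` V.
have SU : lcycles G `<=` U by move=> w [[? ? ?] _].
have oU : mopen U := mopen_setX hTT hT (mopen_setX hT hT oV oV) oV.
have p1 : smooth_on U (fun w : TTT => w.1.1 : TM).
  apply: (smooth_on_sub hTTT _ oU (@subsetT _ _)).
  exact: (smooth_on_fst_comp hTTT hT hT (smooth_fst hTT hT)).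
have p2 : smooth_on U (fun w : TTT => w.1.2 : TM).
  apply: (smooth_on_sub hTTT _ oU (@subsetT _ _)).
  exact: (smooth_on_snd_comp hTTT hT hT (smooth_fst hTT hT)).
have p3 : smooth_on U (fun w : TTT => w.2 : TM).
  by apply: (smooth_on_sub hTTT (smooth_snd hTT hT) oU).
have U1 w : U w -> V w.1.1 by move=> [[]].
have U2 w : U w -> V w.1.2 by move=> [[]].
have U3 w : U w -> V w.2 by move=> [[]].
have Uz := SU z Sz.
have [_ [/= e12 e23 e31]] := Sz.
(* Differentiates an incidence relation s = t between two arrows along vectors tangent to the set of
   cycles. *)
have key (P Q : TTT -> TM) (sP : smooth_on U P) (sQ : smooth_on U Q)
    (PV : forall w, U w -> V (P w)) (QV : forall w, U w -> V (Q w)) :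
    (forall w, lcycles G w -> s (P w) = t (Q w)) ->
    forall x, tangent_space (X := TTT) (lcycles G) z x ->
      tmap s (P z) (tmap P z x) = tmap t (Q z) (tmap Q z x).
  move=> PQ x Tx.
  rewrite -(tmap_comp hTTT hT hM x sP Uz ss (PV z Uz)).
  rewrite -(tmap_comp hTTT hT hM x sQ Uz st (QV z Uz)).
  apply: (tmap_tangent_eq hTTT hM _ _ SU PQ Tx).
    exact: (smooth_on_comp hTTT hT sP ss PV).
  exact: (smooth_on_comp hTTT hT sQ st QV).
have k12 := key _ _ p1 p2 U1 U2
    (fun w (h : lcycles G w) => let: conj _ (And3 e _ _) := h in e).
have k23 := key _ _ p2 p3 U2 U3
    (fun w (h : lcycles G w) => let: conj _ (And3 _ e _) := h in e).
have k31 := key _ _ p3 p1 U3 U1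
    (fun w (h : lcycles G w) => let: conj _ (And3 _ _ e) := h in e).
rewrite /sum3_form /pull2 (fw _ _ (U1 z Uz)) (fw _ _ (U2 z Uz)) (fw _ _ (U3 z Uz)).
rewrite (k12 _ Su) (k12 _ Sv) (k23 _ Su) (k23 _ Sv) (k31 _ Su) (k31 _ Sv).
have alg (x1 x2 x3 : R) : x2 - x1 + (x3 - x2) + (x1 - x3) = 0 by ring.
rewrite e12 e23 e31; exact: alg.
Qed.

Theorem transported_groupoid_symplectic :
  local_symplectic_groupoid (@minus_dtheta _ _ M) G.
Proof.
split.
- exact: transported_groupoid_lie.
- exact: symplectic_on_cotangent.
- exact: lagrangian_units.
- by move=> a Ia u v; exact: pull2_inverse_on.
split; [exact: transported_groupoid_cycles|exact: lagrangian_cycles].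
Qed.

End Groupoid.

(** * From the Lagrangian fields to the transported groupoid *)

Theorem theorem3p1 (R : realType) (m : nat) (M : chartedSpace R (2 * m)%N)
  (omega : form2 M) (hM : symplectic_on setT omega)
  (E E' : bundle m M) (lam : total_space E -> M) (lam' : total_space E' -> M)
  (hE : lagrangian_field omega lam) (hE' : lagrangian_field omega lam')
  (htr : transversal_fields lam lam')
  (phi : form1 (total_space E)) (hphi : is_phi omega lam phi)
  (phi' : form1 (total_space E')) (hphi' : is_phi omega lam' phi')
  (chi : total_space (whitney_sum E E') -> total_space (cotangent M))
  (hchi : is_chi phi phi' chi)
  (W1 W2 : set (total_space (whitney_sum E E')))
  (hZ1 : range (zero_section (whitney_sum E E')) `<=` W1)
  (hZ2 : range (zero_section (whitney_sum E E')) `<=` W2)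
  (hW1 : exists O : set (total_space (cotangent M)),
     range (zero_section (cotangent M)) `<=` O /\ diffeo_onto W1 O chi)
  (hW2 : exists O : set (prod_mfd M M),
     range (fun x : M => (x, x)) `<=` O /\
     diffeo_onto (Y := prod_mfd M M) W2 O
       (fun z => (lam' (wproj2 z), lam (wproj1 z))))
  (f : total_space (cotangent M) -> prod_mfd M M)
  (hf : forall z, (W1 `&` W2) z ->
     f (chi z) = (lam' (wproj2 z), lam (wproj1 z))) :
  let V := chi @` (W1 `&` W2) in
  let G := transported_groupoid V f in
  [/\ local_symplectic_groupoid (@minus_dtheta R (2 * m)%N M) G,
      lsrc G = (fun a => (f a).2) /\ ltgt G = (fun a => (f a).1),
      forall x : M, lsrc G @` ([set a | bproj a = x] `&` V) `<=` leaf lam x &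
      forall x : M, ltgt G @` ([set a | bproj a = x] `&` V) `<=` leaf lam' x].
Proof.
move=> V G.
have sM : smooth_manifold M by have [] := hM.
have aM := smooth_manifold_atlas sM.
have [vE [[slam _] _] _ _ lam0] := hE; have [vE' [[slam' _] _] _ _ lam0'] := hE'.
have vT := vector_bundle_cotangent aM.
have vW := vector_bundle_whitney aM vE vE'.
have aT := smooth_atlas_total aM vT; have aW := smooth_atlas_total aM vW.
have aE := smooth_atlas_total aM vE; have aE' := smooth_atlas_total aM vE'.
have aMM := smooth_atlas_prod aM aM.
pose W := W1 `&` W2; pose F z : prod_mfd M M := (lam' (wproj2 z), lam (wproj1 z)).
have [A1 [_ [oW1 oO1 chiO1 schi [g1 [sg1 g1K]]]]] := hW1.
have [A2 [_ [oW2 oO2 FO2 sF [g2 [sg2 g2K]]]]] := hW2.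
have oW : mopen W := mopenI aW oW1 oW2.
have g1O := diffeo_inv g1K chiO1; have g2O := diffeo_inv g2K FO2.
(* V is a direct image. Rewriting it as a preimage under the smooth inverse of [chi] makes it open;
   the same device serves for the image of V under f, with the inverse [g2]. *)
have VE : V = A1 `&` g1 @^-1` W.
  apply/seteqP; split=> [_ [z Wz <-]|a [A1a Wa]].
    by have [W1z _] := Wz; rewrite /preimage /= g1K // -chiO1; split=> //; exists z.
  by exists (g1 a) => //; have [_ ->] := g1O a A1a.
have oV : mopen V by rewrite VE; exact: (smooth_on_preimage aT aW sg1 oW).
have VO1 : V `<=` A1 by rewrite VE => a [].
have g1W a : V a -> W (g1 a) by rewrite VE => -[].
have chig1 a : V a -> chi (g1 a) = a by move=> /VO1/g1O[].
have chiV z : W z -> V (chi z) by move=> Wz; exists z.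
have fVE : f @` V = A2 `&` g2 @^-1` W.
  apply/seteqP; split=> [_ [_ [z Wz <-] <-]|y [A2y Wy]].
    have [_ W2z] := Wz; rewrite hf // /preimage /= g2K //; split=> //.
    by rewrite -FO2; exists z.
  exists (chi (g2 y)); first by exists (g2 y).
  by rewrite hf //; have [_] := g2O y A2y.
have ofV : mopen (f @` V) by rewrite fVE; exact: (smooth_on_preimage aMM aW sg2 oW).
have sg1V : smooth_on V g1 := smooth_on_sub aT sg1 oV VO1.
have sFW : smooth_on W F by exact: (smooth_on_sub aW sF oW (@subIsetr _ _ _)).
have schiW : smooth_on W chi := smooth_on_sub aW schi oW (@subIsetl _ _ _).
(* f is given only through its values on [chi z]; on V it equals F composed with [g1]. *)
have sf : smooth_on V f.
  apply: (smooth_on_eq aT (smooth_on_comp aT aW sg1V sFW g1W)) => a Va.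
  by rewrite -[in RHS](chig1 a Va) hf //; exact: g1W.
have df : diffeo_onto V (f @` V) f.
  split=> //; exists (fun y => chi (g2 y)); split.
    have sg2V : smooth_on (f @` V) g2.
      by apply: (smooth_on_sub aMM sg2 ofV); rewrite fVE => y [].
    refine (smooth_on_comp aMM aW sg2V schiW _).
    by rewrite fVE => y [].
  move=> _ [z Wz <-]; rewrite hf //; congr chi.
  by have [_ /g2K] := Wz.
have W0 x : W (zero_section (whitney_sum E E') x).
  by split; [apply: hZ1|apply: hZ2]; exists x.
(* The covector [chi z] is known only on projections of vectors from the Whitney sum. A vector v at
   x is lifted by the differential of the zero section, and there [phi] and [phi'] vanish. *)
have chi0 x : chi (zero_section (whitney_sum E E') x) = zero_section (cotangent M) x.
  have [bz cz] := hchi (zero_section (whitney_sum E E') x).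
  have c0 v : pairing (chi (zero_section (whitney_sum E E') x)) v = 0.
    have s0 := smooth_zero_section aM vW; have sb := smooth_bproj aM vW.
    have := cz (tmap (zero_section (whitney_sum E E')) x v).
    rewrite -(tmap_comp aM aW aM v s0 I sb I).
    rewrite (tmap_id x v aM) => ->.
    have [_ _ p0 _] := hphi; have [_ _ p0' _] := hphi'.
    by rewrite /pull1 [X in X - _]p0' [X in _ - X]p0 subrr.
  case: (chi _) bz c0 => y xi /= bz c0; rewrite /bproj /= in bz; subst y.
  have -> // : xi = 0.
  by apply/lfunP => v; rewrite zero_lfunE; exact: c0.
have f0 x : V (zero_section (cotangent M) x) /\ f (zero_section (cotangent M) x) =
    (x, x).
  rewrite -chi0; split; first exact: chiV.
  have e : lam (wproj1 (zero_section (whitney_sum E E') x)) = x := lam0 x.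
  have e' : lam' (wproj2 (zero_section (whitney_sum E E') x)) = x := lam0' x.
  by rewrite (hf _ (W0 x)) e e'.
have sw1 := smooth_wproj1 aM vE vE'; have sw2 := smooth_wproj2 aM vE vE'.
have sphi : smooth_form1 phi by have [] := hphi.
have sphi' : smooth_form1 phi' by have [] := hphi'.
have bchi : (fun z => bproj (chi z)) = @bproj _ _ _ _ (whitney_sum E E').
  by rewrite funeqE => z; have [] := hchi z.
(* The tautological property of theta: as [chi] preserves base points, its differential does not
   change the projection of a vector to M. *)
have chi_theta z v : W z -> pull1 chi (@canonical_form _ _ M) z v
    = pull1 (@wproj2 _ _ _ _ _ E E') phi' z v - pull1 (@wproj1 _ _ _ _ _ E E') phi z v.
  move=> Wz; have [_ <-] := hchi z.
  rewrite /pull1 /canonical_form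
      -(tmap_comp aW aT aM v schiW Wz (smooth_bproj aM vT) I).
  by rewrite bchi.
have fw a u v : V a -> minus_dtheta a u v
  = omega (f a).2 (tmap (fun a => (f a).2 : M) a u) (tmap (fun a => (f a).2 : M) a v)
  - omega (f a).1 (tmap (fun a => (f a).1 : M) a u) (tmap (fun a => (f a).1 : M) a v).
  move=> Va; pose z := g1 a; have Wz : W z := g1W a Va.
  (* Vectors at a are carried to z by the differential of [g1] and recovered by that of [chi], so
     the identity can be computed on the Whitney sum. *)
  have Tchi w : tmap chi z (tmap g1 a w) = w.
    rewrite -(tmap_comp aT aW aT w sg1V Va schiW Wz) -[RHS](tmap_id a w aT).
    apply/esym/(tmap_eq aT aT w (smooth_on_id aT oV) Va) => b Vb.
    by rewrite chig1.
  have Ts w : tmap (fun a => (f a).2 : M) a w =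
      tmap lam (wproj1 z) (tmap (@wproj1 _ _ _ _ _ E E') z (tmap g1 a w)).
    rewrite -(tmap_comp aW aE aM _ sw1 I slam I).
    rewrite -(tmap_comp aT aW aM w sg1V Va
        (smooth_on_comp aW aE sw1 slam (fun _ _ => I)) I).
    apply: (tmap_eq aT aM w (smooth_on_snd_comp aT aM aM sf) Va) => b Vb.
    by rewrite -[in LHS](chig1 b Vb) hf //; exact: g1W.
  have Tt w : tmap (fun a => (f a).1 : M) a w =
      tmap lam' (wproj2 z) (tmap (@wproj2 _ _ _ _ _ E E') z (tmap g1 a w)).
    rewrite -(tmap_comp aW aE' aM _ sw2 I slam' I).
    rewrite -(tmap_comp aT aW aM w sg1V Va
        (smooth_on_comp aW aE' sw2 slam' (fun _ _ => I)) I).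
    apply: (tmap_eq aT aM w (smooth_on_fst_comp aT aM aM sf) Va) => b Vb.
    by rewrite -[in LHS](chig1 b Vb) hf //; exact: g1W.
  (* The two paths from the Whitney sum down to M coincide. This is why the two pullbacks of omega
     along the bundle projections cancel. *)
  have Tb w : tmap (@bproj _ _ _ _ E) (wproj1 z) (tmap (@wproj1 _ _ _ _ _ E E') z w)
      = tmap (@bproj _ _ _ _ E') (wproj2 z) (tmap (@wproj2 _ _ _ _ _ E E') z w).
    rewrite -(tmap_comp aW aE aM w sw1 I (smooth_bproj aM vE) I).
    by rewrite -(tmap_comp aW aE' aM w sw2 I (smooth_bproj aM vE') I).
  have fa : f a = (lam' (wproj2 z), lam (wproj1 z)) by rewrite -[in LHS](chig1 a Va) hf.
  have az : chi z = a := chig1 a Va.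
  set u' := tmap g1 a u; set v' := tmap g1 a v.
  have e1 : ext_d1 (@canonical_form _ _ M) a u v =
      ext_d1 (pull1 chi (@canonical_form _ _ M)) z u' v'.
    rewrite (ext_d1_pull aW aT schiW (smooth_form1_canonical aM) _ _ Wz).
    by rewrite /u' /v' !Tchi az.
  have e2 : ext_d1 (pull1 chi (@canonical_form _ _ M)) z u' v'
     = ext_d1 phi' (wproj2 z) (tmap (@wproj2 _ _ _ _ _ E E') z u')
         (tmap (@wproj2 _ _ _ _ _ E E') z v')
     - ext_d1 phi (wproj1 z) (tmap (@wproj1 _ _ _ _ _ E E') z u')
         (tmap (@wproj1 _ _ _ _ _ E E') z v').
    rewrite -(ext_d1_pull aW aE' sw2 sphi' _ _ I) -(ext_d1_pull aW aE sw1 sphi _ _ I).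
    rewrite -(ext_d1_sub aW _ _ _ (smooth_form1_pull aW aE' sw2 sphi')
        (smooth_form1_pull aW aE sw1 sphi)).
    by apply: (ext_d1_eq aW _ _ oW Wz) => y w Wy; exact: chi_theta.
  have [_ _ _ dphi] := hphi; have [_ _ _ dphi'] := hphi'.
  rewrite /minus_dtheta e1 e2 -dphi -dphi' /pull2 fa /= !Ts !Tt -/u' -/v' !Tb.
  have alg (p q r : R) : - (p - q - (r - q)) = r - p by ring.
  exact: alg.
split=> //.
- exact: (transported_groupoid_symplectic sM df f0 fw).
(* Since [chi] preserves base points, an arrow over x comes from a pair of vectors in the fibres at
   x; its source is the image under [lam] of the first of them. *)
- move=> x y [a [/= bx [z Wz ez]] <-]; rewrite -ez hf //=.
  have [bz _] := hchi z; rewrite -ez bz in bx; rewrite -bx.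
  by exists (projT2 z).1.
move=> x y [a [/= bx [z Wz ez]] <-]; rewrite -ez hf //=.
have [bz _] := hchi z; rewrite -ez bz in bx; rewrite -bx.
by exists (projT2 z).2.
Qed.
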